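(* Let $G$ be a second countable locally compact group and $\chi\in V^\infty(G)$. The following are equivalent: (i) $\Phi_\chi(\mathrm{VN}(G))\subseteq\mathrm{VN}(G)$; (ii) $\mathcal{T}\circ(\Gamma\otimes\Gamma_{\mathrm{op}})(\chi)\in L^\infty(G)\bar\otimes1\bar\otimes L^\infty(G)$; (iii) $\mathcal{T}\circ(\Gamma\otimes\Gamma_{\mathrm{op}})(\chi)=(\mathrm{id}\otimes\sigma)(\chi\otimes1)$; (iv) $\chi\in V^\infty_{\mathrm{inv}}(G)$.
   Context: $G$ is equipped with left Haar measure and products with product measures. $L^\infty(G)$ is viewed as the von Neumann algebra of multiplication operators $M_a$ on $L^2(G)$; $\mathrm{VN}(G)$ is the von Neumann algebra generated by the left regular representation on $L^2(G)$. $\bar\otimes$ is the weak* spatial tensor product, and $L^\infty(G)\bar\otimes L^\infty(G)\equiv L^\infty(G\times G)$. The maps $\Gamma,\Gamma_{\mathrm{op}}:L^\infty(G)\to L^\infty(G\times G)$ are $\Gamma(a)(s,t)=a(st)$ and $\Gamma_{\mathrm{op}}(a)(s,t)=a(ts)$ for almost all $(s,t)$; $\sigma:L^\infty(G\times G)\to L^\infty(G\times G)$ is the flip $\sigma(h)(s,t)=h(t,s)$. For dual operator spaces $\mathcal{X},\mathcal{Y}$, the normal Haagerup tensor product $\mathcal{X}\otimes_{\sigma\mathrm{h}}\mathcal{Y}$ is the operator space dual of the operator space of all separately weak* continuous (normal) completely bounded bilinear forms on $\mathcal{X}\times\mathcal{Y}$; the elementary tensor $a\otimes b$ is the functional $F\mapsto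 F(a,b)$. If $\phi,\psi$ are normal completely bounded maps between dual operator spaces, $\phi\otimes\psi$ denotes the unique normal completely bounded map between the normal Haagerup tensor products with $(\phi\otimes\psi)(a\otimes b)=\phi(a)\otimes\psi(b)$. $V^\infty(G)=L^\infty(G)\otimes_{\mathrm{eh}}L^\infty(G)$ is the extended (weak* ) Haagerup tensor product (the space of Schur multipliers), canonically a subspace of $L^\infty(G)\otimes_{\sigma\mathrm{h}}L^\infty(G)$. Each $\chi\in V^\infty(G)$ has a w*-representation $\chi\sim\sum_{i=1}^\infty a_i\otimes b_i$ with $a_i,b_i\in L^\infty(G)$, $\mathrm{esssup}_s\sum_i|a_i(s)|^2<\infty$, $\mathrm{esssup}_t\sum_i|b_i(t)|^2<\infty$; it is identified with the function $\chi(s,t)=\sum_ia_i(s)b_i(t)$, and in this way $V^\infty(G)$ is a subspace of $L^\infty(G\times G)$ (this identification is used in (iii)). The corresponding weak* continuous completely bounded map on $\mathcal{B}(L^2(G))$ is $\Phi_\chi(T)=\sum_iM_{a_i}TM_{b_i}$ (weak* convergence). For $r\in G$ let $\chi_r(s,t)=\chi(sr,tr)$, and $$V^\infty_{\mathrm{inv}}(G)=\{\chi\in V^\infty(G):\chi_r=\chi\text{ almost everywhere, for all }r\in G\}.$$ With $\mathcal{M}=L^\infty(G)$, $\mathcal{M}_*=L^1(G)$: for $f,g\in\mathcal{M}_*$, $L_f=f\otimes\mathrm{id}$ and $R_g=\mathrm{id}\otimes g$ are the normal slice maps $\mathcal{M}\bar\otimes\mathcal{M}\to\mathcal{M}$;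 $\mathrm{m}:\mathcal{M}\otimes_{\sigma\mathrm{h}}\mathcal{M}\to\mathcal{M}$ is the unique weak* continuous completely contractive extension of multiplication; and $\mathcal{T}:(\mathcal{M}\bar\otimes\mathcal{M})\otimes_{\sigma\mathrm{h}}(\mathcal{M}\bar\otimes\mathcal{M})\to\mathcal{M}\bar\otimes\mathcal{M}\bar\otimes\mathcal{M}$ is the weak* continuous linear contraction determined by $\langle\mathcal{T}(\psi),f\otimes\omega\otimes g\rangle=\langle\mathrm{m}((L_f\otimes R_g)(\psi)),\omega\rangle$ for $f,\omega,g\in\mathcal{M}_*$; it satisfies $\mathcal{T}(\chi_1\otimes\chi_2)=(\chi_1\otimes1)(1\otimes\chi_2)$. *)

(* Defs.v *)
From HB Require Import structures.
From mathcomp Require Import all_boot all_order all_algebra.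
From mathcomp Require Import all_classical all_reals all_analysis.
From mathcomp Require Import ess_sup_inf complex.

Set Implicit Arguments.
Unset Strict Implicit.
Unset Printing Implicit Defensive.

Import Order.TTheory GRing.Theory Num.Theory.
Import numFieldNormedType.Exports.

Local Open Scope classical_set_scope.
Local Open Scope ring_scope.
Local Open Scope complex_scope.

(* Elements of L^1, L^2 and L^oo are represented by measurable functions with
   values in R[i], and bounded operators on L^2 by maps on such functions;
   equality of two elements is equality almost everywhere, and every notion
   below is invariant under it. *)

HB.mixin Record isTopologicalGroup G & Group G & PointedTopological G := {
  mulg_continuous : continuous (fun x : G * G => (x.1 * x.2)%g) ;
  invg_continuous : continuous (fun x : G => (x^-1)%g)
}.

#[short(type="topGroupType")]
HB.structure Definition TopologicalGroup :=
  {G of Group G & PointedTopological G & isTopologicalGroup G}.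

Notation borel G := (g_sigma_algebraType (@open G)).

Notation normc := Normc.normc.

Section ComplexSequences.
Context {R : realType}.
Implicit Types (u : nat -> R[i]) (l : R[i]).

Definition ccvg u l := (fun n => normc (u n - l)) @ \oo --> (0 : R).

Definition csum u : R[i] :=
  limn (series (fun n => complex.Re (u n))) +i*
  limn (series (fun n => complex.Im (u n))).

End ComplexSequences.

Section FunctionSpaces.
Context {R : realType} d {T : measurableType d}.
Variable mu : {measure set T -> \bar R}.
Implicit Types f g h a xi eta : T -> R[i].

Definition cmeasurable f :=
  measurable_fun setT (fun x => complex.Re (f x)) /\
  measurable_fun setT (fun x => complex.Im (f x)).

Definition cintegral f : R[i] :=
  (\int[mu]_x complex.Re (f x)) +i* (\int[mu]_x complex.Im (f x)).

Definition L1 f := cmeasurable f /\ (\int[mu]_x (normc (f x))%:E < +oo)%E.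

Definition sqnorm xi : \bar R := (\int[mu]_x (normc (xi x) ^+ 2)%:E)%E.

Definition L2 xi := cmeasurable xi /\ (sqnorm xi < +oo)%E.

Definition Linf h :=
  cmeasurable h /\ (ess_sup mu (fun x => (normc (h x))%:E) < +oo)%E.

Definition dual_pairing h f : R[i] := cintegral (fun x => h x * f x).

Definition inner_product xi eta : R[i] :=
  cintegral (fun x => xi x * (eta x)^*).

(* Continuity at 0 for the weak* topology of L^oo = (L^1)^*; this is weak*
   continuity for a linear functional. *)
Definition wstar_continuous (phi : (T -> R[i]) -> R[i]) :=
  forall e : R, 0 < e ->
  exists n (f : 'I_n -> T -> R[i]) (delta : R),
    [/\ 0 < delta, forall k, L1 (f k) &
        forall h, Linf h ->
          (forall k, normc (dual_pairing h (f k)) < delta) ->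
          normc (phi h) < e].

Definition wstar_closure (A : set (T -> R[i])) : set (T -> R[i]) :=
  [set h | Linf h /\
    forall (e : R) n (f : 'I_n -> T -> R[i]), 0 < e -> (forall k, L1 (f k)) ->
      exists2 g, A g &
        forall k, normc (dual_pairing h (f k) - dual_pairing g (f k)) < e].

Definition mulop a xi : T -> R[i] := fun x => a x * xi x.

(* The operator space structure of L^oo as an algebra of multiplication
   operators: the operator [M_{a i j}] on the n-fold direct sum of L^2 has
   norm at most K. *)
Definition Linf_mx_norm_le n (a : 'I_n -> 'I_n -> T -> R[i]) (K : R) :=
  forall xi : 'I_n -> T -> R[i], (forall j, L2 (xi j)) ->
    (\sum_(i < n) sqnorm (\sum_(j < n) mulop (a i j) (xi j))%R
       <= (K ^+ 2)%:E * \sum_(j < n) sqnorm (xi j))%E.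

End FunctionSpaces.

Section NormalHaagerup.
Context {R : realType} d1 d2 {X : measurableType d1} {Y : measurableType d2}.
Variables (mu : {measure set X -> \bar R}) (nu : {measure set Y -> \bar R}).

Definition form := (X -> R[i]) -> (Y -> R[i]) -> R[i].

Implicit Types (F : form).

Definition C_mx_norm_le n (A : 'M[R[i]]_n) (K : R) :=
  forall v : 'cV[R[i]]_n,
    \sum_(i < n) normc ((A *m v) i 0) ^+ 2
      <= K ^+ 2 * \sum_(j < n) normc (v j 0) ^+ 2.

Definition bilinear_form F :=
  (forall c a a' b, Linf mu a -> Linf mu a' -> Linf nu b ->
     F (c *: a + a') b = c * F a b + F a' b) /\
  (forall c a b b', Linf mu a -> Linf nu b -> Linf nu b' ->
     F a (c *: b + b') = c * F a b + F a b').

(* The completely bounded norm of the bilinear form F is at most K; the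
   amplifications are [x_ij], [y_ij] |-> [\sum_k F x_ik y_kj]. *)
Definition cb_norm_le F (K : R) :=
  forall n (x : 'I_n -> 'I_n -> X -> R[i]) (y : 'I_n -> 'I_n -> Y -> R[i])
    (s t : R),
    (forall i k, Linf mu (x i k)) -> (forall k j, Linf nu (y k j)) ->
    0 <= s -> 0 <= t -> Linf_mx_norm_le mu x s -> Linf_mx_norm_le nu y t ->
    C_mx_norm_le (\matrix_(i, j) \sum_(k < n) F (x i k) (y k j)) (K * s * t).

Definition normal_cb_form F :=
  [/\ bilinear_form F,
      exists2 K : R, 0 <= K & cb_norm_le F K,
      forall b, Linf nu b -> wstar_continuous mu (fun a => F a b) &
      forall a, Linf mu a -> wstar_continuous nu (fun b => F a b)].

(* The normal Haagerup tensor product of L^oo(X) and L^oo(Y): the bounded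
   functionals on the space of normal completely bounded bilinear forms. The
   values of u outside that space are irrelevant. *)
Definition normal_haagerup : set (form -> R[i]) :=
  [set u |
    (forall (c : R[i]) F F', normal_cb_form F -> normal_cb_form F' ->
       u (fun a b => c * F a b + F' a b) = c * u F + u F') /\
    (exists2 M : R, 0 <= M & forall F K, normal_cb_form F -> 0 <= K ->
       cb_norm_le F K -> normc (u F) <= M * K)].

End NormalHaagerup.

(* phi \otimes psi on normal Haagerup tensor products, for normal completely
   bounded phi and psi: the adjoint of F |-> F \o (phi \x psi). *)
Definition haagerup_map {R : realType} {X X' Y Y' : Type}
    (phi : (X -> R[i]) -> (X' -> R[i])) (psi : (Y -> R[i]) -> (Y' -> R[i]))
    (u : ((X -> R[i]) -> (Y -> R[i]) -> R[i]) -> R[i]) :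
    ((X' -> R[i]) -> (Y' -> R[i]) -> R[i]) -> R[i] :=
  fun F => u (fun a b => F (phi a) (psi b)).

(* The canonical image in the normal Haagerup tensor product of the element
   \sum_i a_i \otimes b_i of the extended Haagerup tensor product. *)
Definition haagerup_sum {R : realType} {X Y : Type}
    (a : nat -> X -> R[i]) (b : nat -> Y -> R[i]) :
    ((X -> R[i]) -> (Y -> R[i]) -> R[i]) -> R[i] :=
  fun F => csum (fun i => F (a i) (b i)).

Section Multiplication.
Context {R : realType} d {T : measurableType d}.
Variable mu : {measure set T -> \bar R}.

(* m is the adjoint of the map taking w in L^1 to the form
   (a, b) |-> <ab, w>. *)
Definition haagerup_mult (u : ((T -> R[i]) -> (T -> R[i]) -> R[i]) -> R[i]) :
    T -> R[i] :=
  xget (fun=> 0) [set c | [/\ normal_haagerup mu mu u, Linf mu c &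
    forall w, L1 mu w ->
      dual_pairing mu c w = u (fun a b => dual_pairing mu (a * b) w)]].

End Multiplication.

Section Operators.
Context {R : realType} d {T : measurableType d}.
Variable mu : {measure set T -> \bar R}.

Definition operator := (T -> R[i]) -> (T -> R[i]).

Implicit Types (A B S : operator) (xi eta : nat -> T -> R[i]).

(* Compatibility with equality almost everywhere follows from linearity and
   boundedness. *)
Definition bounded_operator A :=
  [/\ forall f, L2 mu f -> L2 mu (A f),
      forall (c : R[i]) f g, L2 mu f -> L2 mu g ->
        A (c *: f + g) = c *: A f + A g %[ae mu] &
      exists2 K : R, 0 <= K & forall f, L2 mu f ->
        (sqnorm mu (A f) <= (K ^+ 2)%:E * sqnorm mu f)%E].

Definition adjoint_operators A B :=
  forall f g, L2 mu f -> L2 mu g ->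
    inner_product mu (A f) g = inner_product mu f (B g).

Definition square_summable xi :=
  (forall k, L2 mu (xi k)) /\
  (\sum_(0 <= k <oo) sqnorm mu (xi k) < +oo)%E.

(* The weak* continuous functional on B(L^2) attached to the trace class
   operator given by the square summable families xi and eta. *)
Definition normal_functional xi eta A : R[i] :=
  csum (fun k => inner_product mu (A (xi k)) (eta k)).

Definition operator_wstar_closure (M : set operator) : set operator :=
  [set A | bounded_operator A /\
    forall (e : R) n (xi eta : 'I_n -> nat -> T -> R[i]), 0 < e ->
      (forall i, square_summable (xi i)) ->
      (forall i, square_summable (eta i)) ->
      exists2 B, M B & forall i,
        normc (normal_functional (xi i) (eta i) A -
               normal_functional (xi i) (eta i) B) < e].

Definition von_neumann_algebra (M : set operator) :=
  [/\ M `<=` bounded_operator,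
      M id,
      forall (c : R[i]) A B, M A -> M B -> M (fun f => c *: A f + B f),
      forall A B, M A -> M B -> M (A \o B) &
      (forall A B, M A -> bounded_operator B -> adjoint_operators A B -> M B)
      /\ operator_wstar_closure M `<=` M].

Definition von_neumann_generated (D : set operator) : set operator :=
  [set A | forall M, von_neumann_algebra M -> D `<=` M -> M A].

(* The weak* convergent sum \sum_i M_{a_i} A M_{b_i}; the limit is unique up
   to equality almost everywhere. *)
Definition Phi (a b : nat -> T -> R[i]) A : operator :=
  xget (id : operator) [set S : operator | bounded_operator S /\
    forall xi eta, square_summable xi -> square_summable eta ->
      ccvg (fun n => normal_functional xi eta
              (fun f => \sum_(i < n) mulop (a i) (A (mulop (b i) f))))
           (normal_functional xi eta S)].

End Operators.

Section LocallyCompactGroup.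
Context {R : realType} {G : topGroupType}.

(* On a second countable locally compact Hausdorff space a Borel measure that
   is finite on compact sets is regular and sigma-finite. *)
Definition left_haar (mu : {measure set (borel G) -> \bar R}) :=
  [/\ mu setT != 0%E,
      forall K : set G, compact K -> (mu K < +oo)%E &
      forall (s : G) (A : set (borel G)), measurable A ->
        mu [set (s * x)%g | x in A] = mu A].

Variable mu : {sigma_finite_measure set (borel G) -> \bar R}.

Local Notation mu2 := (mu \x mu)%E.
Local Notation mu3 := ((mu \x mu) \x mu)%E.
Local Notation G2 := (borel G * borel G)%type.
Local Notation G3 := (borel G * borel G * borel G)%type.

Definition lambda (s : G) : operator (T := borel G) (R := R) :=
  fun f t => f (s^-1 * t)%g.

Definition VN : set (operator (T := borel G) (R := R)) :=
  von_neumann_generated mu (range lambda).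

Definition Gamma (a : borel G -> R[i]) : G2 -> R[i] :=
  fun st => a (st.1 * st.2)%g.

Definition Gamma_op (a : borel G -> R[i]) : G2 -> R[i] :=
  fun st => a (st.2 * st.1)%g.

Definition slice_left (f : borel G -> R[i]) (h : G2 -> R[i]) :
    borel G -> R[i] :=
  fun t => cintegral mu (fun s => f s * h (s, t)).

Definition slice_right (g : borel G -> R[i]) (h : G2 -> R[i]) :
    borel G -> R[i] :=
  fun s => cintegral mu (fun t => h (s, t) * g t).

Definition tensor3 (f w g : borel G -> R[i]) : G3 -> R[i] :=
  fun x => f x.1.1 * w x.1.2 * g x.2.

Definition Tmap (u : ((G2 -> R[i]) -> (G2 -> R[i]) -> R[i]) -> R[i]) :
    G3 -> R[i] :=
  xget (fun=> 0) [set h | [/\ normal_haagerup mu2 mu2 u, Linf mu3 h &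
    forall f w g, L1 mu f -> L1 mu w -> L1 mu g ->
      dual_pairing mu3 h (tensor3 f w g) =
      dual_pairing mu
        (haagerup_mult mu (haagerup_map (slice_left f) (slice_right g) u)) w]].

(* L^oo(G) \bar\otimes 1 \bar\otimes L^oo(G) *)
Definition Linf_1_Linf : set (G3 -> R[i]) :=
  wstar_closure mu3
    [set h | exists n (a b : 'I_n -> borel G -> R[i]),
      [/\ forall i, Linf mu (a i), forall i, Linf mu (b i) &
          h = \sum_(i < n) tensor3 (a i) (fun=> 1) (b i)]].

(* chi \otimes 1 *)
Definition tensor_one (chi : G2 -> R[i]) : G3 -> R[i] := fun x => chi x.1.

(* id \otimes sigma *)
Definition id_flip (h : G3 -> R[i]) : G3 -> R[i] :=
  fun x => h (x.1.1, x.2, x.1.2).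

Definition wstar_representation (chi : G2 -> R[i])
    (a b : nat -> borel G -> R[i]) :=
  [/\ Linf mu2 chi,
      (forall i, Linf mu (a i)) /\ (forall i, Linf mu (b i)),
      (ess_sup mu (fun s => \sum_(0 <= i <oo) (normc (a i s) ^+ 2)%:E)
         < +oo)%E,
      (ess_sup mu (fun t => \sum_(0 <= i <oo) (normc (b i t) ^+ 2)%:E)
         < +oo)%E &
      \forall st \ae mu2,
        ccvg (fun n => \sum_(i < n) a i st.1 * b i st.2) (chi st)].

Definition Vinf : set (G2 -> R[i]) :=
  [set chi | exists a b, wstar_representation chi a b].

Definition Vinf_inv : set (G2 -> R[i]) :=
  [set chi | Vinf chi /\
    forall r : G,
      (fun st : G2 => chi ((st.1 * r)%g, (st.2 * r)%g)) = chi %[ae mu2]].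

End LocallyCompactGroup.

(* Main.v *)
(* Write X for the everywhere defined kernel of bounded l^2 representatives of a
   and b. For almost all (s, t, r), the value of T((Gamma x Gamma_op) chi) is
   X(s t, r t), and each of the conditions says that for every q,
     X(s q, r q) = X(s, r)  for almost all (s, r).
   For (iii) and (iv) this is a matter of Fubini's theorem. For (ii), functions
   in the weak* closure are invariant under translation of the middle variable.
   For (i), Phi_chi(lambda_x) is the translation lambda_x followed by
   multiplication by s |-> X(s, x^-1 s). Operators in VN(G) commute with right
   translations, so if (i) holds these functions are invariant, for every x.
   Conversely they live on null sets of the product, and one has to restrict an
   almost everywhere invariance to them: this works because l^2 is separable, so
   that X is determined, up to a small uniform error, by countably many of its
   rows. Then Phi_chi(lambda_x) is a multiple of lambda_x, and (i) follows since
   Phi_chi is weak* continuous and the span of the lambda_x is weak* dense. *)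

Require Import Defs.
From HB Require Import structures.
From mathcomp Require Import all_boot all_order all_algebra.
From mathcomp Require Import all_classical all_reals all_analysis.
From mathcomp Require Import measurable_realfun ess_sup_inf complex.
From mathcomp Require Import ring lra.

Set Implicit Arguments.
Unset Strict Implicit.
Unset Printing Implicit Defensive.

Import Order.TTheory GRing.Theory Num.Theory.
Import numFieldNormedType.Exports.

Local Open Scope classical_set_scope.
Local Open Scope ring_scope.
Local Open Scope complex_scope.

(** * Complex numbers and series *)

(** [Tmap], [haagerup_mult] and [Phi] are chosen by [xget], so nothing is known of them before their
    specification has a witness. Each time the witness is an explicit series: [translated_kernel],
    the diagonal of a [kernel], [schur_operator]. The pairings in the specification then carry what
    is known of the witness over to the chosen element. The hypotheses bound the sums of squares
    only almost everywhere. [l2_truncation] passes to representatives bounded at every point, whose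
    kernel is a bounded measurable function that can be evaluated on the graph of a translation.
    Right translations need not preserve the measure. Their constant is constructed from left
    invariance alone, and [scales_measure] carries it through the changes of variables. Weak*
    continuity of [Phi] is explicit: [amplify] turns a pair of square summable families into another
    such pair, and the functional of the first pair at [Phi mu a b A] is the functional of the
    second at [A]. An approximation of [A] in the span of the translations, tested on the second
    pair, is thus an approximation of its image, tested on the first. *)

Section ComplexNumbers.
Context {R : realType}.
Implicit Types (x y z : R[i]).

Lemma normrE z : `|z| = (normc z)%:C.
Proof. by []. Qed.

Lemma normc_ge0 z : 0 <= normc z.
Proof. by case: z => a b; rewrite sqrtr_ge0. Qed.

Lemma normcC (r : R) : normc r%:C = `|r|.
Proof. by rewrite /Normc.normc/= expr0n/= addr0 sqrtr_sqr. Qed.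

Lemma normcB x y : normc (x - y) = normc (y - x).
Proof. by rewrite -opprB normcN. Qed.

Lemma normc_conj z : normc z^*%C = normc z.
Proof. by case: z => a b; rewrite /Normc.normc/= sqrrN. Qed.

Lemma sqr_normcE z : normc z ^+ 2 = complex.Re z ^+ 2 + complex.Im z ^+ 2.
Proof. by case: z => a b; rewrite /Normc.normc/= sqr_sqrtr// addr_ge0 ?sqr_ge0. Qed.

Lemma mul_conj z : z * z^*%C = (normc z ^+ 2)%:C.
Proof. by rewrite -sqr_normc normrE rmorphXn. Qed.

Lemma normr_Re_le z : `|complex.Re z| <= normc z.
Proof.
rewrite -(ler_pXn2r (n := 2))// ?nnegrE ?normc_ge0//.
by rewrite sqr_normcE real_normK ?num_real// lerDl sqr_ge0.
Qed.

Lemma normr_Im_le z : `|complex.Im z| <= normc z.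
Proof.
rewrite -(ler_pXn2r (n := 2))// ?nnegrE ?normc_ge0//.
by rewrite sqr_normcE real_normK ?num_real// lerDr sqr_ge0.
Qed.

Lemma normc_le_ReIm z : normc z <= `|complex.Re z| + `|complex.Im z|.
Proof.
rewrite -(ler_pXn2r (n := 2))// ?nnegrE ?normc_ge0 ?addr_ge0//.
rewrite sqr_normcE sqrrD !real_normK ?num_real//.
by rewrite lerD2r lerDl mulrn_wge0// mulr_ge0.
Qed.

Lemma normc_sum I (r : seq I) (P : pred I) (F : I -> R[i]) :
  normc (\sum_(i <- r | P i) F i) <= \sum_(i <- r | P i) normc (F i).
Proof.
elim/big_ind2 : _ => //; first by rewrite Normc.normc0.
by move=> x1 x2 y1 y2 h1 h2; rewrite (le_trans (le_normcD _ _))// lerD.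
Qed.

Lemma ReD x y : complex.Re (x + y) = complex.Re x + complex.Re y.
Proof. by case: x y => [? ?] []. Qed.

Lemma ImD x y : complex.Im (x + y) = complex.Im x + complex.Im y.
Proof. by case: x y => [? ?] []. Qed.

Lemma ReB x y : complex.Re (x - y) = complex.Re x - complex.Re y.
Proof. by case: x y => [? ?] []. Qed.

Lemma ImB x y : complex.Im (x - y) = complex.Im x - complex.Im y.
Proof. by case: x y => [? ?] []. Qed.

Lemma ReM x y : complex.Re (x * y) =
  complex.Re x * complex.Re y - complex.Im x * complex.Im y.
Proof. by case: x y => [? ?] []. Qed.

Lemma ImM x y : complex.Im (x * y) =
  complex.Re x * complex.Im y + complex.Im x * complex.Re y.
Proof. by case: x y => [? ?] []. Qed.

Lemma Re_sum I (r : seq I) (P : pred I) (F : I -> R[i]) :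
  complex.Re (\sum_(i <- r | P i) F i) = \sum_(i <- r | P i) complex.Re (F i).
Proof. exact: (big_morph (@complex.Re R) ReD). Qed.

Lemma Im_sum I (r : seq I) (P : pred I) (F : I -> R[i]) :
  complex.Im (\sum_(i <- r | P i) F i) = \sum_(i <- r | P i) complex.Im (F i).
Proof. exact: (big_morph (@complex.Im R) ImD). Qed.

Lemma complex_eq x y : complex.Re x = complex.Re y -> complex.Im x = complex.Im y -> x = y.
Proof. by case: x y => [? ?] [? ?] /= -> ->. Qed.

Lemma conj_sum I (r : seq I) (P : pred I) (F : I -> R[i]) :
  (\sum_(i <- r | P i) F i)^*%C = \sum_(i <- r | P i) (F i)^*%C.
Proof. exact: rmorph_sum. Qed.

(** Induction on [n]. The induction hypothesis bounds the new cross term, and the square of sqrt b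
    |g_n| - sqrt c |f_n| shows that it is absorbed by b g_n^2 + c f_n^2. *)
Lemma real_cauchy_schwarz n (f g : nat -> R) :
  (\sum_(i < n) f i * g i) ^+ 2 <=
  (\sum_(i < n) f i ^+ 2) * (\sum_(i < n) g i ^+ 2).
Proof.
elim: n => [|n IH]; first by rewrite !big_ord0 expr0n/= mulr0.
rewrite !big_ord_recr/=.
set a := \sum_(i < n) _ in IH *; set b := \sum_(i < n) f i ^+ 2 in IH *.
set c := \sum_(i < n) g i ^+ 2 in IH *.
have b0 : 0 <= b by apply: sumr_ge0 => i _; exact: sqr_ge0.
have c0 : 0 <= c by apply: sumr_ge0 => i _; exact: sqr_ge0.
have h : (2 * a * (f n * g n)) <= b * g n ^+ 2 + c * f n ^+ 2.
  have [sb sc] := (sqr_sqrtr b0, sqr_sqrtr c0).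
  have ha : `|a| <= Num.sqrt b * Num.sqrt c.
    by rewrite -sqrtrM// -sqrtr_sqr ler_wsqrtr.
  have : a * (f n * g n) <= Num.sqrt b * Num.sqrt c * `|f n * g n|.
    by rewrite (le_trans (ler_norm _))// normrM ler_wpM2r.
  rewrite normrM => h1.
  have := sqr_ge0 (Num.sqrt b * `|g n| - Num.sqrt c * `|f n|).
  rewrite sqrrB !exprMn sb sc !real_normK ?num_real//.
  nra.
rewrite !sqrrD mulrDl !mulrDr exprMn; nra.
Qed.

Lemma cauchy_schwarz n (f g : nat -> R[i]) :
  normc (\sum_(i < n) f i * g i) ^+ 2 <=
  (\sum_(i < n) normc (f i) ^+ 2) * (\sum_(i < n) normc (g i) ^+ 2).
Proof.
have := real_cauchy_schwarz n (fun i => normc (f i)) (fun i => normc (g i)).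
apply: le_trans.
rewrite ler_pXn2r// ?nnegrE ?normc_ge0//; last first.
  by apply: sumr_ge0 => i _; rewrite mulr_ge0 ?normc_ge0.
rewrite (le_trans (normc_sum _ _ _))//.
by apply: ler_sum => i _; rewrite Normc.normcM.
Qed.

End ComplexNumbers.

Section ComplexSeries.
Context {R : realType}.
Implicit Types (u v : nat -> R[i]) (l : R[i]).

(** Absolute convergence, stated in the extended reals so that it compares directly with sums of
    [sqnorm]. *)
Definition csummable u := (\sum_(0 <= k <oo) (normc (u k))%:E < +oo)%E.

Lemma dist_le_cvg (f g : nat -> R) (l : R) : (forall n, `|f n - l| <= g n) ->
  g @ \oo --> (0 : R) -> f @ \oo --> l.
Proof.
move=> fg g0; apply/subr_cvg0; apply/cvgr0Pnorm_le => e e0.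
move/cvgr0Pnorm_le : g0 => /(_ _ e0); apply: filterS => n.
by apply: le_trans; rewrite (le_trans (fg n))// ler_norm.
Qed.

Lemma ccvgP u l : ccvg u l <->
  ((fun n => complex.Re (u n)) @ \oo --> complex.Re l) /\
  ((fun n => complex.Im (u n)) @ \oo --> complex.Im l).
Proof.
split=> [h|[hr hi]].
  split; apply: dist_le_cvg h => n.
    by rewrite -ReB normr_Re_le.
  by rewrite -ImB normr_Im_le.
rewrite /ccvg.
have h0 : (fun n => `|complex.Re (u n) - complex.Re l| +
    `|complex.Im (u n) - complex.Im l|) @ \oo --> (0 : R).
  move/subr_cvg0 : hr => /cvg_norm; rewrite normr0 => hr.
  move/subr_cvg0 : hi => /cvg_norm; rewrite normr0 => hi.
  by rewrite -[0 in X in _ --> X]addr0; exact: cvgD.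
apply: (squeeze_cvgr _ (@cvg_cst _ _ _ _ _) h0).
by near=> n; rewrite normc_ge0 -ReB -ImB normc_le_ReIm.
Unshelve. all: by end_near. Qed.

Lemma ccvg_unique u l l' : ccvg u l -> ccvg u l' -> l = l'.
Proof.
move=> /ccvgP[hr hi] /ccvgP[hr' hi'].
by apply: complex_eq; [exact: (cvg_unique _ hr hr')|exact: (cvg_unique _ hi hi')].
Qed.

Lemma ccvg_cst l : ccvg (fun=> l) l.
Proof. by apply/ccvgP; split; exact: cvg_cst. Qed.

Lemma ccvgD u v l m : ccvg u l -> ccvg v m -> ccvg (fun n => u n + v n) (l + m).
Proof.
move=> /ccvgP[hr hi] /ccvgP[hr' hi']; apply/ccvgP; split.
  by rewrite ReD; under eq_fun do rewrite ReD; exact: cvgD.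
by rewrite ImD; under eq_fun do rewrite ImD; exact: cvgD.
Qed.

Lemma ccvgM u v l m : ccvg u l -> ccvg v m -> ccvg (fun n => u n * v n) (l * m).
Proof.
move=> /ccvgP[hr hi] /ccvgP[hr' hi']; apply/ccvgP; split.
  by rewrite ReM; under eq_fun do rewrite ReM; apply: cvgB; exact: cvgM.
by rewrite ImM; under eq_fun do rewrite ImM; apply: cvgD; exact: cvgM.
Qed.

Lemma ccvgZ c u l : ccvg u l -> ccvg (fun n => c * u n) (c * l).
Proof. by apply: ccvgM; exact: ccvg_cst. Qed.

Lemma ccvg_conj u l : ccvg u l -> ccvg (fun n => (u n)^*%C) l^*%C.
Proof.
rewrite /ccvg; suff -> : (fun n => normc (u n - l)) =
  (fun n => normc ((u n)^*%C - l^*%C)) by [].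
by apply/funext => n; rewrite -rmorphB normc_conj.
Qed.

Lemma ccvg_norm u l : ccvg u l -> (fun n => normc (u n)) @ \oo --> normc l.
Proof.
move=> h; apply: dist_le_cvg h => n.
have h1 := le_normcD (u n - l) l; have h2 := le_normcD (l - u n) (u n).
rewrite !subrK in h1 h2; rewrite normcB in h2.
by rewrite ler_norml; apply/andP; split; lra.
Qed.

Lemma ccvg_normc_le u l M : (forall n, normc (u n) <= M) -> ccvg u l -> normc l <= M.
Proof.
move=> h /ccvg_norm hl; rewrite -(cvg_lim _ hl)//; apply: limr_le => //.
  by apply/cvg_ex; eexists; exact: hl.
by near=> n.
Unshelve. all: by end_near. Qed.

Lemma ccvg_csum u l : ccvg (fun n => \sum_(i < n) u i) l -> csum u = l.
Proof.
move=> /ccvgP[hr hi]; apply: complex_eq; apply: cvg_lim => //.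
  by rewrite /series/=; under eq_fun do rewrite big_mkord -Re_sum.
by rewrite /series/=; under eq_fun do rewrite big_mkord -Im_sum.
Qed.

Lemma nneseries_lty_bound (p : nat -> R) (M : R) : (forall n, 0 <= p n) ->
  (forall n, \sum_(i < n) p i <= M) -> (\sum_(0 <= k <oo) (p k)%:E <= M%:E)%E.
Proof.
move=> p0 h; apply: lime_le.
  by apply: is_cvg_nneseries => n _ _; rewrite lee_fin.
by near=> n; rewrite sumEFin big_mkord lee_fin.
Unshelve. all: by end_near. Qed.

Lemma le_sum_nneseries (p : nat -> R) n : (forall n, 0 <= p n) ->
  ((\sum_(i < n) p i)%:E <= \sum_(0 <= k <oo) (p k)%:E)%E.
Proof.
move=> p0; rewrite -sumEFin -(big_mkord xpredT (fun i => (p i)%:E)).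
by apply: nneseries_lim_ge => k _; rewrite lee_fin.
Qed.

Lemma nneseries_cvgn (p : nat -> R) : (forall n, 0 <= p n) ->
  (\sum_(0 <= k <oo) (p k)%:E < +oo)%E ->
  series p @ \oo --> fine (\sum_(0 <= k <oo) (p k)%:E)%E.
Proof.
move=> p0 h.
have hf : (\sum_(0 <= k <oo) (p k)%:E)%E \is a fin_num.
  by rewrite ge0_fin_numE// nneseries_ge0// => n _ _; rewrite lee_fin.
have hc : (fun n => (\sum_(0 <= k < n) (p k)%:E)%E) @ \oo -->
    (fine (\sum_(0 <= k <oo) (p k)%:E)%E)%:E.
  rewrite fineK//; apply: is_cvg_nneseries => n _ _; by rewrite lee_fin.
move/fine_cvg : hc; apply: cvg_trans; apply: near_eq_cvg; near=> n.
by rewrite /= sumEFin.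
Unshelve. all: by end_near. Qed.

(** [csum] is built from [limn], which is arbitrary for a divergent series; absolute convergence
    makes it a genuine limit. *)
Lemma csum_cvg u : csummable u -> ccvg (fun n => \sum_(i < n) u i) (csum u).
Proof.
move=> su; have cn : cvgn (series (fun k => normc (u k))).
  by apply/cvg_ex; eexists; apply: nneseries_cvgn => // n; exact: normc_ge0.
apply/ccvgP; split.
  under eq_fun do rewrite Re_sum -(big_mkord xpredT (fun k => complex.Re (u k))).
  apply: (@normed_cvg _ _ (fun k => complex.Re (u k))).
  apply: series_le_cvg cn => n; rewrite ?normc_ge0//=.
  exact: normr_Re_le.
under eq_fun do rewrite Im_sum -(big_mkord xpredT (fun k => complex.Im (u k))).
apply: (@normed_cvg _ _ (fun k => complex.Im (u k))).
apply: series_le_cvg cn => n; rewrite ?normc_ge0//=.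
exact: normr_Im_le.
Qed.

Lemma csummable_bound u M : (forall n, \sum_(i < n) normc (u i) <= M) -> csummable u.
Proof.
move=> h; apply: (@le_lt_trans _ _ M%:E); last by rewrite ltry.
by apply: nneseries_lty_bound => // n; exact: normc_ge0.
Qed.

Lemma normc_csum_bound u M : (forall n, \sum_(i < n) normc (u i) <= M) ->
  normc (csum u) <= M.
Proof.
move=> h; apply: ccvg_normc_le (csum_cvg (csummable_bound h)) => n.
exact: le_trans (normc_sum _ _ _) (h n).
Qed.

Lemma csummable_normc_csum u : csummable u ->
  ((normc (csum u))%:E <= \sum_(0 <= k <oo) (normc (u k))%:E)%E.
Proof.
move=> su; rewrite -[leRHS]fineK; last first.
  by rewrite ge0_fin_numE// nneseries_ge0// => n _ _; rewrite lee_fin normc_ge0.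
rewrite lee_fin; apply: normc_csum_bound => n.
rewrite -lee_fin fineK; last first.
  by rewrite ge0_fin_numE// nneseries_ge0// => k _ _; rewrite lee_fin normc_ge0.
by apply: le_sum_nneseries => k; exact: normc_ge0.
Qed.

Lemma csummableD u v : csummable u -> csummable v ->
  csummable (fun k => u k + v k).
Proof.
move=> su sv; rewrite /csummable; apply: (@le_lt_trans _ _
    (\sum_(0 <= k <oo) ((normc (u k))%:E + (normc (v k))%:E))%E).
  apply: lee_nneseries => n; first by rewrite lee_fin normc_ge0.
  by move=> _; rewrite lee_fin le_normcD.
by rewrite nneseriesD ?lte_add_pinfty// => n _; rewrite lee_fin normc_ge0.
Qed.

Lemma csummableZ c u : csummable u -> csummable (fun k => c * u k).
Proof.
move=> su; rewrite /csummable; under eq_eseriesr do rewrite Normc.normcM EFinM.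
rewrite nneseriesZl; last by move=> n _; rewrite lee_fin normc_ge0.
by rewrite lte_mul_pinfty// lee_fin normc_ge0.
Qed.

Lemma csumD u v : csummable u -> csummable v ->
  csum (fun k => u k + v k) = csum u + csum v.
Proof.
move=> su sv; apply: ccvg_csum; under eq_fun do rewrite big_split/=.
by apply: ccvgD; exact: csum_cvg.
Qed.

Lemma csumZ c u : csummable u -> csum (fun k => c * u k) = c * csum u.
Proof.
move=> su; apply: ccvg_csum; under eq_fun do rewrite -mulr_sumr.
by apply: ccvgZ; exact: csum_cvg.
Qed.

Lemma csum_conj u : csummable u -> csum (fun k => (u k)^*%C) = (csum u)^*%C.
Proof.
move=> su; apply: ccvg_csum; under eq_fun do rewrite -conj_sum.
by apply: ccvg_conj; exact: csum_cvg.
Qed.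

End ComplexSeries.

(** * Rearrangement of double series *)

Section DoubleSeries.
Context {R : realType}.

(** For nonnegative terms both sides are the unordered sum over all pairs. *)
Lemma double_series_ge0 (p : nat -> nat -> R) (e : nat -> nat * nat) :
  set_bij setT setT e -> (forall i k, 0 <= p i k) ->
  (\sum_(0 <= m <oo) (p (e m).1 (e m).2)%:E =
   \sum_(0 <= i <oo) \sum_(0 <= k <oo) (p i k)%:E)%E.
Proof.
move=> be p0.
rewrite nneseries_esumT; last by move=> n; rewrite lee_fin.
have := @reindex_esum R _ _ setT setT e (fun x => (p x.1 x.2)%:E) be.
move=> /= <-.
under [RHS]eq_eseriesr => i _.
  rewrite nneseries_esumT; last by move=> n; rewrite lee_fin.
  over.
rewrite nneseries_esumT; last first.
  by move=> n; apply: esum_ge0 => k _; rewrite lee_fin.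
rewrite esum_esum//; last by move=> *; rewrite lee_fin.
congr (esum _ _); by apply/seteqP; split.
Qed.

Lemma csum_ge0E (p : nat -> R) : (forall k, 0 <= p k) ->
  (\sum_(0 <= k <oo) (p k)%:E < +oo)%E ->
  csum (fun k => (p k)%:C) = (fine (\sum_(0 <= k <oo) (p k)%:E)%E)%:C.
Proof.
move=> p0 sp; rewrite /csum/=; congr (_ +i* _).
  by apply: cvg_lim => //; exact: nneseries_cvgn.
apply: cvg_lim => //; have -> : series (fun=> 0 : R) = (fun=> 0).
  by apply/funext => n; rewrite /series/= big1.
exact: cvg_cst.
Qed.

Definition dsummable (u : nat -> nat -> R[i]) :=
  (\sum_(0 <= i <oo) \sum_(0 <= k <oo) (normc (u i k))%:E < +oo)%E.

Lemma nneseries_normc_ge0 (u : nat -> R[i]) :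
  (0 <= \sum_(0 <= k <oo) (normc (u k))%:E)%E.
Proof. by apply: nneseries_ge0 => n _ _; rewrite lee_fin normc_ge0. Qed.

Lemma dsummable_row u i : dsummable u -> csummable (u i).
Proof.
move=> su; apply: le_lt_trans su.
pose g i := (\sum_(0 <= k <oo) (normc (u i k))%:E)%E.
have h : (\sum_(0 <= j < i.+1) g j <= \sum_(0 <= j <oo) g j)%E.
  by apply: nneseries_lim_ge => j _ _; exact: nneseries_normc_ge0.
apply: le_trans h; rewrite big_nat_recr//= leeDr// sume_ge0// => j _.
exact: nneseries_normc_ge0.
Qed.

Lemma dsummable_csum u : dsummable u -> csummable (fun i => csum (u i)).
Proof.
move=> su; apply: le_lt_trans (su); apply: lee_nneseries => i *.
  by rewrite lee_fin normc_ge0.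
by apply: csummable_normc_csum; exact: dsummable_row.
Qed.

Lemma dsummable_reindex u (e : nat -> nat * nat) : set_bij setT setT e ->
  dsummable u -> csummable (fun m => u (e m).1 (e m).2).
Proof.
move=> be; rewrite /dsummable -(double_series_ge0 be)// => i k.
exact: normc_ge0.
Qed.

Lemma le_dsummable (u v : nat -> nat -> R[i]) :
  (forall i k, normc (u i k) <= normc (v i k)) -> dsummable v -> dsummable u.
Proof.
move=> uv; apply: le_lt_trans; apply: lee_nneseries => i *.
  exact: nneseries_normc_ge0.
by apply: lee_nneseries => k *; rewrite lee_fin ?normc_ge0.
Qed.

Let good (e : nat -> nat * nat) (u : nat -> nat -> R[i]) := dsummable u /\
  csum (fun m => u (e m).1 (e m).2) = csum (fun i => csum (u i)).

Let goodD e u v : set_bij setT setT e -> good e u -> good e v ->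
  good e (fun i k => u i k + v i k).
Proof.
move=> be [su eu] [sv ev]; split.
  apply: (@le_lt_trans _ _ (\sum_(0 <= i <oo) ((\sum_(0 <= k <oo) (normc (u i k))%:E) + (\sum_(0 <= k <oo) (normc (v i k))%:E)))%E).
    apply: lee_nneseries => i *; first exact: nneseries_normc_ge0.
    rewrite -nneseriesD; try by move=> *; rewrite lee_fin normc_ge0.
    apply: lee_nneseries => k *; first by rewrite lee_fin normc_ge0.
    by rewrite lee_fin le_normcD.
  rewrite nneseriesD ?lte_add_pinfty//.
    by move=> *; exact: nneseries_normc_ge0.
  by move=> *; exact: nneseries_normc_ge0.
rewrite csumD; [|exact: dsummable_reindex|exact: dsummable_reindex].
rewrite eu ev -csumD; [|exact: dsummable_csum|exact: dsummable_csum].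
by congr csum; apply/funext => i; rewrite csumD//; exact: dsummable_row.
Qed.

Let goodZ e c u : set_bij setT setT e -> good e u -> good e (fun i k => c * u i k).
Proof.
move=> be [su eu]; split.
  rewrite /dsummable.
  under eq_eseriesr => i _.
    under eq_eseriesr do rewrite Normc.normcM EFinM.
    rewrite nneseriesZl; last by move=> *; rewrite lee_fin normc_ge0.
    over.
  rewrite nneseriesZl; last by move=> *; exact: nneseries_normc_ge0.
  by rewrite lte_mul_pinfty// lee_fin normc_ge0.
rewrite csumZ; last exact: dsummable_reindex.
rewrite eu -csumZ; last exact: dsummable_csum.
by congr csum; apply/funext => i; rewrite csumZ//; exact: dsummable_row.
Qed.

Let good_ge0 e (p : nat -> nat -> R) : set_bij setT setT e ->
  (forall i k, 0 <= p i k) -> dsummable (fun i k => (p i k)%:C) ->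
  good e (fun i k => (p i k)%:C).
Proof.
move=> be p0 sp; split => //.
have pE i k : normc (p i k)%:C = p i k by rewrite normcC ger0_norm.
have sr i : (\sum_(0 <= k <oo) (p i k)%:E < +oo)%E.
  by have := dsummable_row i sp; rewrite /csummable; under eq_eseriesr do rewrite pE.
have sp' : (\sum_(0 <= i <oo) \sum_(0 <= k <oo) (p i k)%:E < +oo)%E.
  by move: sp; rewrite /dsummable; under eq_eseriesr do under eq_eseriesr do rewrite pE.
have fE i : ((fine (\sum_(0 <= k <oo) (p i k)%:E))%:E = \sum_(0 <= k <oo) (p i k)%:E)%E.
  by rewrite fineK// ge0_fin_numE// nneseries_ge0// => *; rewrite lee_fin.
rewrite csum_ge0E//; last by rewrite (double_series_ge0 be).
under [in RHS]eq_fun => i do rewrite csum_ge0E//.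
rewrite csum_ge0E.
- by congr (fine _)%:C; rewrite (double_series_ge0 be)//; apply: eq_eseriesr => i _; rewrite fE.
- by move=> i; rewrite fine_ge0// nneseries_ge0// => *; rewrite lee_fin.
- by under eq_eseriesr do rewrite fE.
Qed.

(* Both sides are complex linear in [u], so it suffices to treat the positive
   and negative parts of its real and imaginary parts. *)
Lemma csum_double u (e : nat -> nat * nat) : set_bij setT setT e ->
  dsummable u ->
  csum (fun m => u (e m).1 (e m).2) = csum (fun i => csum (u i)).
Proof.
move=> be su.
have key (f : nat -> nat -> R) : (forall i k, `|f i k| <= normc (u i k)) ->
    good e (fun i k => (f i k)%:C).
  move=> fu.
  pose fp i k := Num.max (f i k) 0; pose fn i k := Num.max (- f i k) 0.
  have fE : (fun i k => (f i k)%:C) = (fun i k => (fp i k)%:C + (-1) * (fn i k)%:C).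
    apply/funext => i; apply/funext => k; apply: complex_eq => /=; last first.
      by rewrite !Monoid.simpm/= ; lra.
    rewrite /fp /fn /Num.max; do 2!case: ifPn; rewrite -?leNgt; lra.
  rewrite fE; apply: goodD => //; last apply: goodZ => //.
    apply: good_ge0 => //; first by move=> i k; rewrite le_max lexx orbT.
    apply: le_dsummable su => i k; rewrite normcC ger0_norm; last by rewrite le_max lexx orbT.
    by rewrite ge_max normc_ge0 (le_trans (ler_norm _) (fu i k)).
  apply: good_ge0 => //; first by move=> i k; rewrite le_max lexx orbT.
  apply: le_dsummable su => i k; rewrite normcC ger0_norm; last by rewrite le_max lexx orbT.
  by rewrite ge_max normc_ge0 andbT (le_trans (ler_norm _))// normrN.
have uE : u = (fun i k => (complex.Re (u i k))%:C + 'i * (complex.Im (u i k))%:C).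
  apply/funext => i; apply/funext => k; apply: complex_eq => /=.
    by rewrite mul0r mulr0 subrr addr0.
  by rewrite mul0r mul1r !add0r.
suff [] : good e u by [].
rewrite uE; apply: goodD => //; last apply: goodZ => //; apply: key => i k.
  exact: normr_Re_le.
exact: normr_Im_le.
Qed.

Lemma nat2_bij : exists e : nat -> nat * nat, set_bij setT setT e.
Proof.
have := card_nat2; rewrite card_eq_sym => /ppcard_eqP[f].
by exists f; exact: bij.
Qed.

End DoubleSeries.

(** * Integration of complex functions *)

Section ComplexMeasurable.
Context {R : realType} d {T : measurableType d}.
Implicit Types (f g : T -> R[i]).

Lemma cmeasurable_normc f : cmeasurable f ->
  measurable_fun setT (fun x => normc (f x)).
Proof.
move=> [mr mi].
have -> : (fun x => normc (f x)) =
    (fun x => Num.sqrt (complex.Re (f x) ^+ 2 + complex.Im (f x) ^+ 2)).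
  by apply/funext => x; case: (f x).
pose g x := complex.Re (f x) ^+ 2 + complex.Im (f x) ^+ 2.
have mg : measurable_fun setT g by apply: measurable_funD; exact: measurable_funX.
exact: (measurableT_comp (continuous_measurable_fun (@sqrt_continuous R)) mg).
Qed.

Lemma cmeasurable_sqr f : cmeasurable f ->
  measurable_fun setT (fun x => ((normc (f x) ^+ 2 : R)%:E)).
Proof.
by move=> mf; apply/measurable_EFinP/measurable_funX; exact: cmeasurable_normc.
Qed.

Lemma cmeasurable_cst (c : R[i]) : cmeasurable (fun _ : T => c).
Proof. by split; exact: measurable_cst. Qed.

Lemma cmeasurableD f g : cmeasurable f -> cmeasurable g ->
  cmeasurable (fun x => f x + g x).
Proof.
move=> [fr fi] [gr gi]; split.
  by under eq_fun do rewrite ReD; exact: measurable_funD.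
by under eq_fun do rewrite ImD; exact: measurable_funD.
Qed.

Lemma cmeasurableM f g : cmeasurable f -> cmeasurable g ->
  cmeasurable (fun x => f x * g x).
Proof.
move=> [fr fi] [gr gi]; split.
  by under eq_fun do rewrite ReM; apply: measurable_funB; exact: measurable_funM.
by under eq_fun do rewrite ImM; apply: measurable_funD; exact: measurable_funM.
Qed.

Lemma cmeasurableZ c f : cmeasurable f -> cmeasurable (fun x => c * f x).
Proof. by move=> mf; apply: cmeasurableM => //; exact: cmeasurable_cst. Qed.

Lemma cmeasurableN f : cmeasurable f -> cmeasurable (fun x => - f x).
Proof.
by move=> /(cmeasurableZ (-1)); congr cmeasurable; apply/funext => x; rewrite mulN1r.
Qed.

Lemma cmeasurableB f g : cmeasurable f -> cmeasurable g ->
  cmeasurable (fun x => f x - g x).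
Proof. by move=> mf mg; apply: cmeasurableD => //; exact: cmeasurableN. Qed.

Lemma cmeasurable_conj f : cmeasurable f -> cmeasurable (fun x => (f x)^*%C).
Proof.
move=> [fr fi]; split.
  by apply: eq_measurable_fun fr => x _; case: (f x).
by move/measurable_funN : fi; apply: eq_measurable_fun => x _ /=; case: (f x).
Qed.

Lemma cmeasurable_sum I (r : seq I) (P : pred I) (F : I -> T -> R[i]) :
  (forall i, P i -> cmeasurable (F i)) ->
  cmeasurable (fun x => \sum_(i <- r | P i) F i x).
Proof.
move=> mF; elim: r => [|i r ih].
  by under eq_fun do rewrite big_nil; exact: cmeasurable_cst.
under eq_fun do rewrite big_cons.
case: (P i) (mF i) => // mFi; apply: cmeasurableD => //; exact: mFi.
Qed.

Lemma cmeasurable_cvg (F : nat -> T -> R[i]) g :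
  (forall n, cmeasurable (F n)) -> (forall x, ccvg (fun n => F n x) (g x)) ->
  cmeasurable g.
Proof.
move=> mF Fg; split.
  apply: (@measurable_fun_cvg _ _ _ _ (fun n x => complex.Re (F n x))) => //.
    by move=> n; case: (mF n).
  by move=> x _; case/ccvgP: (Fg x).
apply: (@measurable_fun_cvg _ _ _ _ (fun n x => complex.Im (F n x))) => //.
  by move=> n; case: (mF n).
by move=> x _; case/ccvgP: (Fg x).
Qed.

Lemma cmeasurable_csum (F : nat -> T -> R[i]) :
  (forall n, cmeasurable (F n)) -> (forall x, csummable (fun n => F n x)) ->
  cmeasurable (fun x => csum (fun n => F n x)).
Proof.
move=> mF sF; apply: (@cmeasurable_cvg (fun n x => \sum_(i < n) F i x)) => [n|x].
  exact: cmeasurable_sum.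
exact: csum_cvg.
Qed.

Lemma cmeasurable_comp d' (T' : measurableType d') (h : T' -> R[i]) (p : T -> T') :
  cmeasurable h -> measurable_fun setT p -> cmeasurable (fun x => h (p x)).
Proof. by move=> [hr hi] mp; split; [exact: measurableT_comp hr mp|exact: measurableT_comp hi mp]. Qed.

Lemma cmeasurable_indic (A : set T) f : measurable A -> cmeasurable f ->
  cmeasurable (fun x => (\1_A x)%:C * f x).
Proof.
move=> mA mf; apply: cmeasurableM => //; split => /=.
  exact: measurable_indic.
exact: measurable_cst.
Qed.

Lemma measurable_ceq f g : cmeasurable f -> cmeasurable g ->
  measurable [set x | f x = g x].
Proof.
move=> mf mg.
have -> : [set x | f x = g x] =
    (fun x => normc (f x - g x)) @^-1` [set 0].
  apply/seteqP; split => x /= ; first by move->; rewrite subrr Normc.normc0.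
  by move/Normc.eq0_normc/subr0_eq.
rewrite -[X in measurable X]setTI; apply: cmeasurable_normc => //.
exact: cmeasurableB.
Qed.

End ComplexMeasurable.

Section ComplexIntegral.
Context {R : realType} d {T : measurableType d}.
Variable mu : {measure set T -> \bar R}.
Implicit Types (f g : T -> R[i]).

Lemma integrableD_EFin (f g : T -> R) : mu.-integrable setT (fun x => (f x)%:E) ->
  mu.-integrable setT (fun x => (g x)%:E) ->
  mu.-integrable setT (fun x => (f x + g x)%:E).
Proof. by move=> fi gi; have := integrableD measurableT fi gi. Qed.

Lemma integrableZ_EFin (k : R) (f : T -> R) : mu.-integrable setT (fun x => (f x)%:E) ->
  mu.-integrable setT (fun x => (k * f x)%:E).
Proof. by move=> fi; have := integrableZl measurableT k fi. Qed.

Lemma L1_Re f : L1 mu f -> mu.-integrable setT (fun x => (complex.Re (f x))%:E).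
Proof.
move=> [mf fi]; apply/integrableP; split; first by case: mf => ? _; exact/measurable_EFinP.
apply: le_lt_trans fi; apply: ge0_le_integral => //.
- by apply/measurable_EFinP; apply: measurableT_comp => //; case: mf.
- by apply/measurable_EFinP; exact: cmeasurable_normc.
- by move=> x _; rewrite lee_fin; exact: normr_Re_le.
Qed.

Lemma L1_Im f : L1 mu f -> mu.-integrable setT (fun x => (complex.Im (f x))%:E).
Proof.
move=> [mf fi]; apply/integrableP; split; first by case: mf => _ ?; exact/measurable_EFinP.
apply: le_lt_trans fi; apply: ge0_le_integral => //.
- by apply/measurable_EFinP; apply: measurableT_comp => //; case: mf.
- by apply/measurable_EFinP; exact: cmeasurable_normc.
- by move=> x _; rewrite lee_fin; exact: normr_Im_le.
Qed.

Lemma L1_normc f : L1 mu f -> mu.-integrable setT (fun x => (normc (f x))%:E).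
Proof.
move=> [mf fi]; apply/integrableP; split.
  by apply/measurable_EFinP; exact: cmeasurable_normc.
by under eq_integral do rewrite gee0_abs ?lee_fin ?normc_ge0//.
Qed.

Lemma le_L1 f (g : T -> R) : cmeasurable f ->
  mu.-integrable setT (fun x => (g x)%:E) ->
  (forall x, normc (f x) <= g x) -> L1 mu f.
Proof.
move=> mf /integrableP[mg gi] fg; split => //.
apply: le_lt_trans gi; apply: ge0_le_integral => //.
- by move=> x _; rewrite lee_fin normc_ge0.
- by apply/measurable_EFinP; exact: cmeasurable_normc.
- exact: measurableT_comp.
- by move=> x _; rewrite /= lee_fin (le_trans (fg x)) ?ler_norm.
Qed.

Lemma L1D f g : L1 mu f -> L1 mu g -> L1 mu (fun x => f x + g x).
Proof.
move=> f1 g1; apply: (@le_L1 _ (fun x => normc (f x) + normc (g x))).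
- by apply: cmeasurableD; [case: f1|case: g1].
- by apply: integrableD_EFin; exact: L1_normc.
- by move=> x; exact: le_normcD.
Qed.

Lemma L1Z c f : L1 mu f -> L1 mu (fun x => c * f x).
Proof.
move=> f1; apply: (@le_L1 _ (fun x => normc c * normc (f x))).
- by apply: cmeasurableZ; case: f1.
- by apply: integrableZ_EFin; exact: L1_normc.
- by move=> x; rewrite Normc.normcM.
Qed.

Lemma L1_0 : L1 mu (fun=> 0).
Proof.
split; first exact: cmeasurable_cst.
by under eq_integral do rewrite Normc.normc0; rewrite integral0 ltry.
Qed.

Lemma L1_sum I (r : seq I) (F : I -> T -> R[i]) :
  (forall i, L1 mu (F i)) -> L1 mu (fun x => \sum_(i <- r) F i x).
Proof.
move=> mF; elim: r => [|i r ih].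
  by under eq_fun do rewrite big_nil; exact: L1_0.
by under eq_fun do rewrite big_cons; exact: L1D.
Qed.

Lemma L1_bounded_mul (h f : T -> R[i]) (M : R) : cmeasurable h ->
  (forall x, normc (h x) <= M) -> L1 mu f -> L1 mu (fun x => h x * f x).
Proof.
move=> mh hM f1; apply: (@le_L1 _ (fun x => M * normc (f x))).
- by apply: cmeasurableM => //; case: f1.
- by apply: integrableZ_EFin; exact: L1_normc.
- by move=> x; rewrite Normc.normcM ler_wpM2r ?normc_ge0.
Qed.

Lemma cintegralD f g : L1 mu f -> L1 mu g ->
  cintegral mu (fun x => f x + g x) = cintegral mu f + cintegral mu g.
Proof.
move=> f1 g1; apply: complex_eq; rewrite ?(ReD, ImD)/=.
  by under eq_Rintegral do rewrite ReD; rewrite RintegralD//; exact: L1_Re.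
by under eq_Rintegral do rewrite ImD; rewrite RintegralD//; exact: L1_Im.
Qed.

Lemma cintegralZ c f : L1 mu f ->
  cintegral mu (fun x => c * f x) = c * cintegral mu f.
Proof.
move=> f1; have [fr fi] := (L1_Re f1, L1_Im f1).
apply: complex_eq; rewrite ?(ReM, ImM)/=.
  under eq_Rintegral do rewrite ReM.
  rewrite RintegralB//; [|exact: integrableZ_EFin|exact: integrableZ_EFin].
  by rewrite !RintegralZl.
under eq_Rintegral do rewrite ImM.
rewrite RintegralD//; [|exact: integrableZ_EFin|exact: integrableZ_EFin].
by rewrite !RintegralZl.
Qed.

Lemma cintegral0 : cintegral mu (fun=> 0) = 0.
Proof. by rewrite /cintegral/= /Rintegral integral0. Qed.

Lemma cintegralB f g : L1 mu f -> L1 mu g ->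
  cintegral mu (fun x => f x - g x) = cintegral mu f - cintegral mu g.
Proof.
move=> f1 g1; have := cintegralD f1 (L1Z (-1) g1).
rewrite cintegralZ// mulN1r => <-.
by congr cintegral; apply/funext => x; rewrite mulN1r.
Qed.

Lemma cintegral_sum I (r : seq I) (F : I -> T -> R[i]) :
  (forall i, L1 mu (F i)) ->
  cintegral mu (fun x => \sum_(i <- r) F i x) = \sum_(i <- r) cintegral mu (F i).
Proof.
move=> F1; elim: r => [|i r ih].
  by under eq_fun do rewrite big_nil; rewrite big_nil cintegral0.
under eq_fun do rewrite big_cons.
by rewrite cintegralD//; [rewrite ih big_cons|exact: L1_sum].
Qed.

Lemma cintegral_conj f : L1 mu f ->
  cintegral mu (fun x => (f x)^*%C) = (cintegral mu f)^*%C.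
Proof.
move=> f1; rewrite /cintegral/=; congr (_ +i* _).
  by apply: eq_Rintegral => x _; case: (f x).
rewrite -mulN1r -RintegralZl//; last exact: L1_Im.
by apply: eq_Rintegral => x _; case: (f x) => ? ? /=; rewrite mulN1r.
Qed.

(* Rotate the integral onto the nonnegative real axis. *)
Lemma normc_cintegral f : L1 mu f ->
  ((normc (cintegral mu f))%:E <= \int[mu]_x (normc (f x))%:E)%E.
Proof.
move=> f1; set z := cintegral mu f.
have [z0|z0] := eqVneq z 0.
  by rewrite z0 Normc.normc0 integral_ge0// => x _; rewrite lee_fin normc_ge0.
have nz : normc z != 0 by apply: contra z0 => /eqP/Normc.eq0_normc ->.
pose c := (normc z)^-1%:C * z^*%C.
have nc : normc c = 1.
  by rewrite Normc.normcM normcC normc_conj ger0_norm ?invr_ge0 ?normc_ge0// mulVf.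
have cz : c * z = (normc z)%:C.
  rewrite /c -mulrA [z^*%C * z]mulrC mul_conj -rmorphM/=; congr (_%:C).
  by rewrite expr2 mulKf.
have -> : normc z = complex.Re (c * z) by rewrite cz.
rewrite /z -cintegralZ//=.
have cf := L1Z c f1.
rewrite /Rintegral fineK; last exact: integrable_fin_num (L1_Re cf).
apply: le_integral => //; [exact: L1_Re cf|exact: L1_normc|] => x _.
rewrite lee_fin (le_trans (ler_norm _))// (le_trans (normr_Re_le _))//.
by rewrite Normc.normcM nc mul1r.
Qed.

Lemma eq_cintegral f g : (forall x, f x = g x) -> cintegral mu f = cintegral mu g.
Proof. by move=> fg; congr cintegral; exact/funext. Qed.

Lemma ae_eq_cintegral f g : cmeasurable f -> cmeasurable g ->
  (\forall x \ae mu, f x = g x) -> cintegral mu f = cintegral mu g.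
Proof.
move=> [fr fi] [gr gi] fg; rewrite /cintegral /Rintegral; congr (fine _ +i* fine _).
  by apply: ae_eq_integral => //; try exact/measurable_EFinP; apply: filterS fg => x -> .
by apply: ae_eq_integral => //; try exact/measurable_EFinP; apply: filterS fg => x -> .
Qed.

Lemma cdominated_convergence (F : nat -> T -> R[i]) f (g : T -> R) :
  (forall n, cmeasurable (F n)) -> cmeasurable f ->
  (\forall x \ae mu, ccvg (fun n => F n x) (f x)) ->
  mu.-integrable setT (fun x => (g x)%:E) ->
  (forall n x, normc (F n x) <= g x) ->
  ccvg (fun n => cintegral mu (F n)) (cintegral mu f).
Proof.
move=> mF mf Ff gi Fg; apply/ccvgP; split.
- have [] := @dominated_convergence _ _ _ mu setT measurableT
    (fun n x => (complex.Re (F n x))%:E) (fun x => (complex.Re (f x))%:E)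
    (fun x => (g x)%:E).
  + by move=> n; apply/measurable_EFinP; case: (mF n).
  + by apply/measurable_EFinP; case: mf.
  + apply: filterS Ff => x /ccvgP[h _] _.
    by apply: cvg_EFin h; near=> n.
  + exact: gi.
  + apply: aeW => x n _; rewrite lee_fin (le_trans (normr_Re_le _))//.
  move=> fi _ /= h; rewrite /Rintegral.
  apply: fine_cvg; rewrite fineK; last exact: integrable_fin_num fi.
  exact: h.
- have [] := @dominated_convergence _ _ _ mu setT measurableT
    (fun n x => (complex.Im (F n x))%:E) (fun x => (complex.Im (f x))%:E)
    (fun x => (g x)%:E).
  + by move=> n; apply/measurable_EFinP; case: (mF n).
  + by apply/measurable_EFinP; case: mf.
  + apply: filterS Ff => x /ccvgP[_ h] _.
    by apply: cvg_EFin h; near=> n.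
  + exact: gi.
  + apply: aeW => x n _; rewrite lee_fin (le_trans (normr_Im_le _))//.
  move=> fi _ /= h; rewrite /Rintegral.
  apply: fine_cvg; rewrite fineK; last exact: integrable_fin_num fi.
  exact: h.
Unshelve. all: by end_near. Qed.

End ComplexIntegral.

(** * Maps that scale a measure *)

Section ChangeOfVariables.
Context {R : realType} d d' {T : measurableType d} {T' : measurableType d'}.
Variables (mu : {measure set T -> \bar R}) (nu : {measure set T' -> \bar R}).
Variables (tau : T -> T') (kappa : R).

(** One notion for left translations, where [kappa] is 1, for right translations, where it is a
    value of the modular function, and for either of them acting on one coordinate of a product. *)
Definition scales_measure := [/\ measurable_fun setT tau, 0 <= kappa &
  forall A, measurable A -> (mu (tau @^-1` A) = kappa%:E * nu A)%E].

Hypothesis htau : scales_measure.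

Lemma ge0_integral_scales (f : T' -> \bar R) : measurable_fun setT f ->
  (forall y, 0 <= f y)%E ->
  (\int[mu]_x f (tau x) = kappa%:E * \int[nu]_y f y)%E.
Proof.
case: htau => mtau k0 hA mf f0.
pose k : {nonneg R} := NngNum k0.
pose tau' : {mfun T >-> T'} := mfun_Sub (mem_set mtau).
transitivity (\int[pushforward mu tau]_y f y)%E.
  by rewrite ge0_integral_pushforward// => y _; exact: f0.
rewrite -(@ge0_integral_mscale _ _ _ nu setT measurableT k)//.
apply: (@eq_measure_integral _ _ _ setT (mscale k nu) (pushforward mu tau')).
by move=> A mA _; exact: hA.
Qed.

Lemma cmeasurable_scales (f : T' -> R[i]) : cmeasurable f -> cmeasurable (f \o tau).
Proof. by case: htau => mtau _ _ mf; exact: cmeasurable_comp. Qed.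

Lemma L1_scales (f : T' -> R[i]) : L1 nu f -> L1 mu (f \o tau).
Proof.
case: (htau) => mtau k0 hA [mf fi]; split; first exact: cmeasurable_comp.
rewrite [X in (X < _)%E](ge0_integral_scales (f := fun y => (normc (f y))%:E)).
- by rewrite lte_mul_pinfty.
- by apply/measurable_EFinP; exact: cmeasurable_normc.
- by move=> y; rewrite lee_fin normc_ge0.
Qed.

Lemma Rintegral_scales (f : T' -> R) :
  nu.-integrable setT (fun x => (f x)%:E) ->
  \int[mu]_x f (tau x) = kappa * \int[nu]_y f y.
Proof.
move=> fi; rewrite /Rintegral integralE [in RHS]integralE.
have mf : measurable_fun setT (EFin \o f) by case/integrableP : fi.
have -> : (\int[mu]_x (fun x => (f (tau x))%:E)^\+ x =
    kappa%:E * \int[nu]_x (EFin \o f)^\+ x)%E.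
  rewrite -(ge0_integral_scales (f := (EFin \o f)^\+%E))//; last exact: measurable_funepos.
  by apply: eq_integral => x _; rewrite !funeposE.
have -> : (\int[mu]_x (fun x => (f (tau x))%:E)^\- x =
    kappa%:E * \int[nu]_x (EFin \o f)^\- x)%E.
  rewrite -(ge0_integral_scales (f := (EFin \o f)^\-%E))//; last exact: measurable_funeneg.
  by apply: eq_integral => x _; rewrite !funenegE.
have hp := integrable_pos_fin_num measurableT fi.
have hn := integrable_neg_fin_num measurableT fi.
have key (p q : \bar R) : p \is a fin_num -> q \is a fin_num ->
    fine (kappa%:E * p - kappa%:E * q)%E = kappa * fine (p - q)%E.
  by case: p q => [p| |] [q| |]//= _ _; rewrite mulrBr.
exact: key hp hn.
Qed.

Lemma cintegral_scales (f : T' -> R[i]) : L1 nu f ->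
  cintegral mu (fun x => f (tau x)) = kappa%:C * cintegral nu f.
Proof.
move=> f1; apply: complex_eq; rewrite ?(ReM, ImM)/= mul0r ?subr0 ?addr0.
  exact: (Rintegral_scales (L1_Re f1)).
exact: (Rintegral_scales (L1_Im f1)).
Qed.

Lemma ae_scales (P : T' -> Prop) :
  (\forall y \ae nu, P y) -> \forall x \ae mu, P (tau x).
Proof.
case: htau => mtau k0 hA [N [mN N0 sN]].
exists (tau @^-1` N); split.
- by rewrite -[X in measurable X]setTI; exact: mtau.
- by rewrite hA// N0 mule0.
- by move=> x /= nP; exact: sN.
Qed.

End ChangeOfVariables.

(** * Fubini's theorem for complex functions and for null sets *)

Section ComplexFubini.
Context {R : realType} d1 d2 {T1 : measurableType d1} {T2 : measurableType d2}.
Variables (m1 : {sigma_finite_measure set T1 -> \bar R}).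
Variables (m2 : {sigma_finite_measure set T2 -> \bar R}).
Local Notation m12 := (m1 \x m2)%E.

(** [Rintegral] is [fine] of the difference of the integrals of the positive and negative parts, and
    Tonelli's theorem makes both of these measurable in [x]. *)
Lemma measurable_fun_Rintegral (f : T1 * T2 -> R) : measurable_fun setT f ->
  measurable_fun setT (fun x => \int[m2]_y f (x, y)).
Proof.
move=> mf; rewrite /Rintegral.
apply: (measurableT_comp (fine_measurable measurableT)).
under eq_fun do rewrite integralE.
have mf' : measurable_fun setT (EFin \o f) by exact/measurable_EFinP.
apply: emeasurable_funB.
  apply: eq_measurable_fun (measurable_fun_fubini_tonelli_F (m2 := m2) _ (measurable_funepos mf') _) => // x _.
  by apply: eq_integral => y _; rewrite !funeposE.
apply: eq_measurable_fun (measurable_fun_fubini_tonelli_F (m2 := m2) _ (measurable_funeneg mf') _) => // x _.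
  by apply: eq_integral => y _; rewrite !funenegE.
Qed.

Lemma cmeasurable_cintegral (F : T1 * T2 -> R[i]) : cmeasurable F ->
  cmeasurable (fun x => cintegral m2 (fun y => F (x, y))).
Proof.
move=> [Fr Fi]; split => /=.
  exact: (measurable_fun_Rintegral Fr).
exact: (measurable_fun_Rintegral Fi).
Qed.

Lemma cFubini1 (F : T1 * T2 -> R[i]) : L1 m12 F ->
  cintegral m12 F = cintegral m1 (fun x => cintegral m2 (fun y => F (x, y))).
Proof.
have key (f : T1 * T2 -> R) : m12.-integrable setT (fun z => (f z)%:E) ->
    \int[m12]_z f z = \int[m1]_x \int[m2]_y f (x, y).
  move=> fi; rewrite /Rintegral -(integral12_prod_meas1 fi); congr fine.
  apply: ae_eq_integral => //.
  - by have := integrable_fubini_F fi; case/integrableP.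
  - apply/measurable_EFinP; apply: measurable_fun_Rintegral.
    by apply/measurable_EFinP; case/integrableP : fi.
  - apply: filterS (ae_integrable1 fi) => x xi _.
    by rewrite fineK//; apply: integrable_fin_num xi.
move=> F1; rewrite /cintegral/=; congr (_ +i* _).
  exact: key (L1_Re F1).
exact: key (L1_Im F1).
Qed.

Lemma cFubini2 (F : T1 * T2 -> R[i]) : L1 m12 F ->
  cintegral m12 F = cintegral m2 (fun y => cintegral m1 (fun x => F (x, y))).
Proof.
have key (f : T1 * T2 -> R) : m12.-integrable setT (fun z => (f z)%:E) ->
    \int[m12]_z f z = \int[m2]_y \int[m1]_x f (x, y).
  move=> fi; rewrite /Rintegral -(integral21_prod_meas1 fi); congr fine.
  apply: ae_eq_integral => //.
  - exact: (measurable_fubini_G fi).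
  - apply/measurable_EFinP.
    apply: (measurableT_comp (fine_measurable measurableT)).
    under eq_fun do rewrite integralE.
    have mf : measurable_fun setT (EFin \o f) by case/integrableP : fi.
    apply: emeasurable_funB.
      apply: eq_measurable_fun (measurable_fun_fubini_tonelli_G (m1 := m1) _ (measurable_funepos mf) _) => // x _.
  by apply: eq_integral => y _; rewrite !funeposE.
    apply: eq_measurable_fun (measurable_fun_fubini_tonelli_G (m1 := m1) _ (measurable_funeneg mf) _) => // x _.
  by apply: eq_integral => y _; rewrite !funenegE.
  - apply: filterS (ae_integrable2 fi) => x xi _.
    by rewrite fineK//; apply: integrable_fin_num xi.
move=> F1; rewrite /cintegral/=; congr (_ +i* _).
  exact: key (L1_Re F1).
exact: key (L1_Im F1).
Qed.

Lemma L1_tensor (f : T1 -> R[i]) (g : T2 -> R[i]) : L1 m1 f -> L1 m2 g ->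
  L1 m12 (fun z => f z.1 * g z.2).
Proof.
move=> [mf fi] [mg gi].
have mfg : cmeasurable (fun z : T1 * T2 => f z.1 * g z.2).
  apply: cmeasurableM.
    exact: (cmeasurable_comp mf (@measurable_fst _ _ T1 T2)).
  exact: (cmeasurable_comp mg (@measurable_snd _ _ T1 T2)).
split => //.
rewrite fubini_tonelli1; first last.
- by move=> z; rewrite lee_fin normc_ge0.
- by apply/measurable_EFinP; exact: cmeasurable_normc.
rewrite /fubini_F/=.
under eq_integral => x _.
  under eq_integral do rewrite Normc.normcM EFinM.
  rewrite ge0_integralZl//; first last.
  - by rewrite lee_fin normc_ge0.
  - by move=> y _; rewrite lee_fin normc_ge0.
  - by apply/measurable_EFinP; exact: cmeasurable_normc.
  over.
have g0 : (0 <= \int[m2]_y (normc (g y))%:E)%E.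
  by apply: integral_ge0 => y _; rewrite lee_fin normc_ge0.
rewrite ge0_integralZr//; first last.
- by move=> x _; rewrite lee_fin normc_ge0.
- by apply/measurable_EFinP; exact: cmeasurable_normc.
have f0 : (0 <= \int[m1]_y (normc (f y))%:E)%E.
  by apply: integral_ge0 => y _; rewrite lee_fin normc_ge0.
by apply: lte_mul_pinfty => //; rewrite ge0_fin_numE.
Qed.

Lemma product_measure2_integral (E : set (T1 * T2)) : measurable E ->
  (m12 E = \int[m2]_y m1 (ysection E y))%E.
Proof.
move=> mE; transitivity (\int[m12]_z (\1_E z)%:E)%E.
  by rewrite integral_indic// setIT.
rewrite (fubini_tonelli2 (fun z => (\1_E z)%:E))//; last first.
  by apply/measurable_EFinP; exact: measurable_indic.
have -> : fubini_G m1 (fun z => (\1_E z)%:E) = m1 \o ysection E by exact: indic_fubini_tonelli_GE.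
by [].
Qed.

(** The product measure of [E] is the integral of the measures of its sections, and a nonnegative
    function has integral 0 iff it vanishes almost everywhere. *)
Lemma measure0_prod1 (E : set (T1 * T2)) : measurable E ->
  m12 E = 0%E <-> (\forall x \ae m1, m2 (xsection E x) = 0%E).
Proof.
move=> mE; rewrite /product_measure1.
have mx : measurable_fun setT (m2 \o xsection E) by exact: measurable_fun_xsection.
have := @ae_eq_integral_abs _ _ _ m1 setT measurableT (m2 \o xsection E) mx.
under eq_integral do rewrite gee0_abs//.
by move=> h; apply: (iff_trans h); split; apply: filterS => x; [exact|move=> /= ->].
Qed.

Lemma measure0_prod2 (E : set (T1 * T2)) : measurable E ->
  m12 E = 0%E <-> (\forall y \ae m2, m1 (ysection E y) = 0%E).
Proof.
move=> mE; rewrite product_measure2_integral//.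
have my : measurable_fun setT (m1 \o ysection E) by exact: measurable_fun_ysection.
have := @ae_eq_integral_abs _ _ _ m2 setT measurableT (m1 \o ysection E) my.
under eq_integral do rewrite gee0_abs//.
by move=> h; apply: (iff_trans h); split; apply: filterS => x; [exact|move=> /= ->].
Qed.

Lemma ae_measurableP d (T : measurableType d) (m : {measure set T -> \bar R})
    (P : T -> Prop) : measurable [set x | P x] ->
  (\forall x \ae m, P x) <-> m (~` [set x | P x]) = 0%E.
Proof.
by move=> mP; split => [h|h]; [|]; apply/negligibleP => //; exact: measurableC.
Qed.

(** The [\ae] filter asks for a measurable null set containing the exceptions; when [P] is
    measurable, the set of exceptions can serve itself, and it is null iff almost all its sections
    are. *)
Lemma ae_prod1 (P : T1 * T2 -> Prop) : measurable [set z | P z] ->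
  (\forall z \ae m12, P z) <-> (\forall x \ae m1, \forall y \ae m2, P (x, y)).
Proof.
move=> mP; apply: (iff_trans (ae_measurableP m12 mP)).
apply: (iff_trans (measure0_prod1 (measurableC mP))).
split; apply: filterS => x h.
  apply/ae_measurableP; last by rewrite -h xsectionE.
  by have := measurable_xsection x mP; rewrite xsectionE.
move/ae_measurableP : h => <-; first by rewrite xsectionE.
by have := measurable_xsection x mP; rewrite xsectionE.
Qed.

Lemma ae_prod2 (P : T1 * T2 -> Prop) : measurable [set z | P z] ->
  (\forall z \ae m12, P z) <-> (\forall y \ae m2, \forall x \ae m1, P (x, y)).
Proof.
move=> mP; apply: (iff_trans (ae_measurableP m12 mP)).
apply: (iff_trans (measure0_prod2 (measurableC mP))).
split; apply: filterS => y h.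
  apply/ae_measurableP; last by rewrite -h ysectionE.
  by have := measurable_ysection y mP; rewrite ysectionE.
move/ae_measurableP : h => <-; first by rewrite ysectionE.
by have := measurable_ysection y mP; rewrite ysectionE.
Qed.

End ComplexFubini.

Section Linf.
Context {R : realType} d {T : measurableType d}.
Variable mu : {measure set T -> \bar R}.
Implicit Types (f h k : T -> R[i]).

Lemma LinfP h : Linf mu h <-> cmeasurable h /\
  exists2 M : R, 0 <= M & \forall x \ae mu, normc (h x) <= M.
Proof.
split=> [[mh hoo]|[mh [M M0 hM]]]; split => //.
  have [M hM] : exists M : R, (ess_sup mu (fun x => (normc (h x))%:E) <= M%:E)%E.
    case: (ess_sup _ _) hoo => [r| |] // _; first by exists r.
    by exists 0; rewrite leNye.
  exists (Num.max M 0); first by rewrite le_max lexx orbT.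
  move/ess_supP : hM; apply: filterS => x; rewrite lee_fin => /le_trans; apply.
  by rewrite le_max lexx.
apply: (@le_lt_trans _ _ M%:E); last by rewrite ltry.
by apply/ess_supP; apply: filterS hM => x; rewrite lee_fin.
Qed.

Lemma bounded_Linf h M : cmeasurable h -> (forall x, normc (h x) <= M) -> Linf mu h.
Proof.
move=> mh hM; apply/LinfP; split => //; exists (Num.max M 0); first by rewrite le_max lexx orbT.
by apply: aeW => x; rewrite le_max hM.
Qed.

Lemma LinfD h k : Linf mu h -> Linf mu k -> Linf mu (fun x => h x + k x).
Proof.
move=> /LinfP[mh [M M0 hM]] /LinfP[mk [N N0 kN]]; apply/LinfP.
split; [exact: cmeasurableD|exists (M + N); first exact: addr_ge0].
by apply: filterS2 hM kN => x *; rewrite (le_trans (le_normcD _ _))// lerD.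
Qed.

Lemma LinfZ c h : Linf mu h -> Linf mu (fun x => c * h x).
Proof.
move=> /LinfP[mh [M M0 hM]]; apply/LinfP.
split; [exact: cmeasurableZ|exists (normc c * M); first by rewrite mulr_ge0 ?normc_ge0].
by apply: filterS hM => x *; rewrite Normc.normcM ler_wpM2l ?normc_ge0.
Qed.

Lemma LinfM h k : Linf mu h -> Linf mu k -> Linf mu (fun x => h x * k x).
Proof.
move=> /LinfP[mh [M M0 hM]] /LinfP[mk [N N0 kN]]; apply/LinfP.
split; [exact: cmeasurableM|exists (M * N); first exact: mulr_ge0].
by apply: filterS2 hM kN => x *; rewrite Normc.normcM ler_pM ?normc_ge0.
Qed.

Lemma Linf_cst c : Linf mu (fun=> c).
Proof. by apply: (@bounded_Linf _ (normc c)) => //; exact: cmeasurable_cst. Qed.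

Lemma L1_ae_le f (g : T -> R) : cmeasurable f ->
  mu.-integrable setT (fun x => (g x)%:E) ->
  (\forall x \ae mu, normc (f x) <= g x) -> L1 mu f.
Proof.
move=> mf /integrableP[mg gi] fg; split => //.
apply: le_lt_trans gi; apply: ae_ge0_le_integral => //.
- by move=> x _; rewrite lee_fin normc_ge0.
- by apply/measurable_EFinP; exact: cmeasurable_normc.
- exact: measurableT_comp.
- by apply: filterS fg => x fg _; rewrite /= lee_fin (le_trans fg)// ler_norm.
Qed.

Lemma L1_Linf_mul h f : Linf mu h -> L1 mu f -> L1 mu (fun x => h x * f x).
Proof.
move=> /LinfP[mh [M M0 hM]] f1; apply: (@L1_ae_le _ (fun x => M * normc (f x))).
- by apply: cmeasurableM => //; case: f1.
- by apply: integrableZ_EFin; exact: L1_normc.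
- by apply: filterS hM => x ?; rewrite Normc.normcM ler_wpM2r ?normc_ge0.
Qed.

Lemma normc_indic (A : set T) x : normc (\1_A x)%:C = \1_A x :> R.
Proof. by rewrite normcC ger0_norm. Qed.

Lemma L1_indic (A : set T) : measurable A -> (mu A < +oo)%E ->
  L1 mu (fun x => (\1_A x : R)%:C).
Proof.
move=> mA Aoo; split.
  by split => /=; [exact: measurable_indic|exact: measurable_cst].
by under eq_integral do rewrite normc_indic; rewrite integral_indic// setIT.
Qed.

Lemma dual_pairingB h k f : Linf mu h -> Linf mu k -> L1 mu f ->
  dual_pairing mu (fun x => h x - k x) f = dual_pairing mu h f - dual_pairing mu k f.
Proof.
move=> hoo koo f1; rewrite /dual_pairing -cintegralB; try exact: L1_Linf_mul.
by apply: eq_cintegral => x; rewrite mulrBl.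
Qed.

Lemma ae_eq_dual_pairing h k f : cmeasurable h -> cmeasurable k -> cmeasurable f ->
  (\forall x \ae mu, h x = k x) -> dual_pairing mu h f = dual_pairing mu k f.
Proof.
move=> mh mk mf hk; apply: ae_eq_cintegral; try exact: cmeasurableM.
by apply: filterS hk => x ->.
Qed.

End Linf.

Lemma indic_setX {R : realType} (T1 T2 : Type) (A : set T1) (B : set T2) z :
  \1_(A `*` B) z = \1_A z.1 * \1_B z.2 :> R.
Proof. by rewrite !indicE classical_sets.in_setX -natrM mulnb. Qed.

(** * Functions determined by their pairings *)

Section Uniqueness.
Context {R : realType}.

(** Pairing [k] with its conjugate, cut to a piece [F n] of finite measure, gives the integral of
    |k|^2 over [F n]. *)
Lemma Linf_eq0 d {T : measurableType d} (mu : {sigma_finite_measure set T -> \bar R})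
    (k : T -> R[i]) : Linf mu k -> (forall f, L1 mu f -> dual_pairing mu k f = 0) ->
  \forall x \ae mu, k x = 0.
Proof.
move=> koo k0; have mk : cmeasurable k by case: koo.
have [F FT mF] := sigma_finiteT mu.
suff h n : \forall x \ae mu, F n x -> k x = 0.
  have := ae_foralln h; apply: filterS => x hx.
  have : [set: T] x by []. by rewrite FT => -[n _ Fn]; exact: hx Fn.
have [mFn Fnoo] := mF n.
pose f x := (k x)^*%C * (\1_(F n) x : R)%:C.
have f1 : L1 mu f.
  apply: L1_Linf_mul; last exact: L1_indic.
  have /LinfP[_ [M M0 kM]] := koo; apply/LinfP; split; first exact: cmeasurable_conj.
  by exists M => //; apply: filterS kM => x; rewrite normc_conj.
have := k0 _ f1; rewrite /dual_pairing.
have kfE x : k x * f x = (normc (k x) ^+ 2 * \1_(F n) x)%:C.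
  by rewrite /f mulrA mul_conj -rmorphM.
rewrite (eq_cintegral _ kfE) => -[+ _] /=.
have kf1 : L1 mu (fun x => (normc (k x) ^+ 2 * \1_(F n) x)%:C).
  have := L1_Linf_mul koo f1; congr L1; exact/funext.
have ki := L1_Re kf1.
rewrite /Rintegral => h0.
have h1 : (\int[mu]_x `|(normc (k x) ^+ 2 * \1_(F n) x)%:E| = 0)%E.
  rewrite -[RHS](_ : (fine (\int[mu]_x (normc (k x) ^+ 2 * \1_(F n) x)%:E))%:E = _); last by rewrite h0.
  rewrite fineK; last exact: integrable_fin_num ki.
  by apply: eq_integral => x _; rewrite gee0_abs// lee_fin mulr_ge0 ?sqr_ge0.
have /ae_eq_integral_abs : measurable_fun setT (fun x => (normc (k x) ^+ 2 * \1_(F n) x)%:E).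
  by case/integrableP : ki.
move=> /(_ mu measurableT)[+ _] => /(_ h1); apply: filterS => x hx Fx.
have := hx I; rewrite indicE mem_set// mulr1 => -[/eqP].
by rewrite sqrf_eq0 => /eqP /Normc.eq0_normc.
Qed.

Section Product.
Context d1 d2 {T1 : measurableType d1} {T2 : measurableType d2}.
Variables (m1 : {sigma_finite_measure set T1 -> \bar R}).
Variables (m2 : {sigma_finite_measure set T2 -> \bar R}).
Local Notation m12 := (m1 \x m2)%E.

(** The sets over which [g] integrates to 0 form a Dynkin system, and rectangles are a generating
    family stable under intersection. So the integral vanishes over every measurable set. *)
Lemma integrable_rect_eq0 (g : T1 * T2 -> R) :
  m12.-integrable setT (fun z => (g z)%:E) ->
  (forall A B, measurable A -> measurable B ->
     (\int[m12]_(z in A `*` B) (g z)%:E = 0)%E) ->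
  \forall z \ae m12, g z = 0.
Proof.
move=> gi g0.
have key E : measurable E -> (\int[m12]_(z in E) (g z)%:E = 0)%E.
  rewrite measurable_prod_measurableType.
  move=> sE; move: sE.
  apply: (@dynkin_induction _ _ _ (fun E => (\int[m12]_(z in E) (g z)%:E = 0)%E)).
  - exact: measurable_prod_measurableType.
  - move=> _ _ [A mA [B mB <-]] [A' mA' [B' mB' <-]].
    exists (A `&` A'); first exact: measurableI.
    exists (B `&` B'); first exact: measurableI.
    by rewrite setXI.
  - by rewrite -setXTT; exact: g0.
  - by move=> _ [A mA [B mB <-]]; exact: g0.
  - move=> S mS S0.
    have gT : (\int[m12]_(z in setT) (g z)%:E = 0)%E by rewrite -setXTT; exact: g0.
    move: gT; rewrite -(setUv S) integral_setU_EFin//.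
    + by rewrite S0 add0e.
    + exact: measurableC.
    + by rewrite setUv; case/integrableP : gi => /measurable_EFinP.
    + by apply/disj_set2P; exact: setICr.
  - move=> F mF tF F0; rewrite integral_bigcup//.
      by rewrite eseries0.
    apply: integrableS gi => //; exact: bigcup_measurable.
have := @integral_ae_eq _ _ _ m12 setT measurableT (cst 0)%E (fun z => (g z)%:E) gi.
move=> /(_ (measurable_cst _)) h.
have : ae_eq m12 setT (fun z => (g z)%:E) (cst 0%E).
  by apply: h => E _ mE; rewrite key// integral0.
by apply: filterS => z /(_ I)[].
Qed.

(* Rectangles generate the product sigma-algebra. *)
Lemma Linf_tensor_eq0 (k : T1 * T2 -> R[i]) : Linf m12 k ->
  (forall f g, L1 m1 f -> L1 m2 g ->
    dual_pairing m12 k (fun z => f z.1 * g z.2) = 0) ->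
  \forall z \ae m12, k z = 0.
Proof.
move=> koo k0.
have [F FT mF] := sigma_finiteT m1; have [G GT mG] := sigma_finiteT m2.
suff h i j : \forall z \ae m12, F i z.1 -> G j z.2 -> k z = 0.
  have := ae_foralln (fun i => ae_foralln (h i)); apply: filterS => z hz.
  have : [set: T1] z.1 by []. rewrite FT => -[i _ Fi].
  have : [set: T2] z.2 by []. rewrite GT => -[j _ Gj].
  exact: hz Fi Gj.
have [mFi Fioo] := mF i; have [mGj Gjoo] := mG j.
(* The indicator of a rectangle of finite measure makes [k * b] integrable; cutting it further to
   [A] and [B] still pairs [k] with a tensor. *)
pose b (z : T1 * T2) : R[i] := (\1_(F i) z.1 : R)%:C * (\1_(G j) z.2 : R)%:C.
have kb1 : L1 m12 (fun z => k z * b z).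
  exact: L1_Linf_mul koo (L1_tensor (L1_indic mFi Fioo) (L1_indic mGj Gjoo)).
have rect A B : measurable A -> measurable B ->
    cintegral m12 (fun z => (\1_(A `*` B) z : R)%:C * (k z * b z)) = 0.
  move=> mA mB; rewrite -(k0 (fun x => (\1_(A `&` F i) x : R)%:C) (fun y => (\1_(B `&` G j) y : R)%:C)).
  - apply: eq_cintegral => z; rewrite /b mulrCA; congr (_ * _).
    rewrite indic_setX !indicI/= -!rmorphM/=; congr (_%:C); ring.
  - by apply: L1_indic; [exact: measurableI|rewrite (le_lt_trans _ Fioo)// le_measure// ?inE//; exact: measurableI].
  - by apply: L1_indic; [exact: measurableI|rewrite (le_lt_trans _ Gjoo)// le_measure// ?inE//; exact: measurableI].
(* [p] will be the real and then the imaginary part; the assumptions let it pass through real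
   indicators and through the integral. *)
have key (p : R[i] -> R) : (forall (r : R) z, p (r%:C * z) = r * p z) -> p 0 = 0 ->
    (forall f, L1 m12 f -> m12.-integrable setT (fun z => (p (f z))%:E)) ->
    (forall f, L1 m12 f -> \int[m12]_z p (f z) = p (cintegral m12 f)) ->
    \forall z \ae m12, p (k z * b z) = 0.
  move=> pZ p0 pi pc; apply: integrable_rect_eq0; first exact: pi.
  move=> A B mA mB; rewrite integral_mkcond.
  have L : L1 m12 (fun z => (\1_(A `*` B) z : R)%:C * (k z * b z)).
    apply: (@L1_bounded_mul _ _ _ _ _ _ 1) => //.
      split => /=; last exact: measurable_cst.
      by apply: measurable_indic; exact: measurableX.
    by move=> z; rewrite normc_indic indicE; case: (_ \in _).
  have := pc _ L; rewrite rect// p0 /Rintegral => h0.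
  rewrite -[RHS](_ : (fine (\int[m12]_z (p ((\1_(A `*` B) z : R)%:C * (k z * b z)))%:E)%E)%:E = 0%E); last by rewrite h0.
  rewrite fineK; last by apply: integrable_fin_num => //; exact: pi.
  by apply: eq_integral => z _; rewrite epatch_indic pZ EFinM muleC.
have hr : \forall z \ae m12, complex.Re (k z * b z) = 0.
  apply: (key (@complex.Re R)) => //; last exact: L1_Re.
  by move=> r z; rewrite ReM/= mul0r subr0.
have hi : \forall z \ae m12, complex.Im (k z * b z) = 0.
  apply: (key (@complex.Im R)) => //; last exact: L1_Im.
  by move=> r z; rewrite ImM/= mul0r addr0.
apply: filterS2 hr hi => z hr hi Fz Gz.
have : k z * b z = 0 by exact: complex_eq.
by rewrite /b !indicE !mem_set//= mul1r mulr1.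
Qed.

End Product.
End Uniqueness.

(** * Haar measure *)

Section AlmostEverywhere.
Context {R : realType} d {T : measurableType d} {mu : {measure set T -> \bar R}}.
Implicit Types P Q S : T -> Prop.

Lemma ae_mono P Q : (forall x, P x -> Q x) ->
  (\forall x \ae mu, P x) -> \forall x \ae mu, Q x.
Proof. by move=> PQ; exact: filterS. Qed.

Lemma ae_mono2 P Q S : (forall x, P x -> Q x -> S x) ->
  (\forall x \ae mu, P x) -> (\forall x \ae mu, Q x) -> \forall x \ae mu, S x.
Proof. by move=> PQ; exact: filterS2. Qed.

Lemma ae_and P Q : (\forall x \ae mu, P x) -> (\forall x \ae mu, Q x) ->
  \forall x \ae mu, P x /\ Q x.
Proof. exact: ae_mono2. Qed.

End AlmostEverywhere.

Lemma measurable_indic_comp {R : realType} d d' (T : measurableType d)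
    (T' : measurableType d') (f : T -> T') (A : set T') :
  measurable_fun setT f -> measurable A ->
  measurable_fun setT (fun x => \1_A (f x) : R).
Proof.
move=> mf mA; apply: (@measurableT_comp _ _ _ _ _ _ (\1_A : T' -> R)) => //.
Qed.

Lemma measure_integral_indic {R : realType} d (T : measurableType d)
    (mu : {measure set T -> \bar R}) (B : set T) : measurable B ->
  (mu B = \int[mu]_x (\1_B x : R)%:E)%E.
Proof. by move=> mB; rewrite integral_indic// setIT. Qed.

Section TopologicalGroupMeasurability.
Context {G : topGroupType}.
Hypothesis scG : @second_countable G.
Local Notation G2 := (borel G * borel G)%type.

Lemma second_countable_seq : exists b : nat -> set G,
  (forall n, open (b n)) /\
  forall x U, nbhs x U -> exists2 n, b n x & b n `<=` U.
Proof.
have [B /countable_injP[f finj] [Bopen Bbase]] := scG.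
(* [f] is an injection of the countable base into [nat], so at most one member of the base
   contributes to this union, and it is empty for the other values of [n]. *)
exists (fun n => \bigcup_(U in [set U | B U /\ f U = n]) U); split.
  by move=> n; apply: bigcup_open => U [BU _]; exact: Bopen.
move=> x U /(Bbase x)[V [BV Vx] VU]; exists (f V).
  by exists V.
apply: subset_trans VU => y [W [BW fW] Wy].
by have <- : W = V by apply: finj; rewrite ?inE.
Qed.

Lemma measurable_open (A : set G) : open A -> measurable (A : set (borel G)).
Proof. exact: sub_sigma_algebra. Qed.

Lemma continuous_measurable (f : G -> G) : continuous f ->
  measurable_fun setT (f : borel G -> borel G).
Proof.
move=> cf; apply: (@measurability _ _ _ _ _ _ (@open G : set (set (borel G)))) => // _ [U oU <-].
by rewrite setTI; apply: measurable_open; exact: open_comp.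
Qed.

(** The preimage of an open set is open in the product topology, whereas measurability refers to the
    product of the Borel sigma-algebras. With a countable base the preimage is a countable union of
    open rectangles. *)
Lemma measurable_mulg : measurable_fun setT (fun z : G2 => (z.1 * z.2)%g : borel G).
Proof.
have [b [bo bb]] := second_countable_seq.
apply: (@measurability _ _ _ _ _ _ (@open G : set (set (borel G)))) => // _ [U oU <-]; rewrite setTI.
pose I n m := [forall z : 'I_1, `[< forall x y, b n x -> b m y -> U (x * y)%g >]].
have -> : (fun z : G2 => (z.1 * z.2)%g : borel G) @^-1` U =
    \bigcup_n \bigcup_m (if `[< forall x y, b n x -> b m y -> U (x * y)%g >]
                         then b n `*` b m else set0).
  apply/seteqP; split => [[x y] /= Uxy|[x y] [n _ [m _]]]; last first.
    by case: asboolP => // h [/= ? ?]; exact: h.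
  have := @mulg_continuous G (x, y) U.
  rewrite nbhs_simpl => /(_ _)[]; first by apply: open_nbhs_nbhs; split.
  move=> -[A B] /= [/bb[n bnx nA] /bb[m bmy mB]] AB.
  exists n => //; exists m => //; case: asboolP => [//|[]] x' y' bx by'.
  by apply: (AB (x', y')); split => /=; [exact: nA|exact: mB].
apply: bigcupT_measurable => n; apply: bigcupT_measurable => m.
by case: ifP => // _; apply: measurableX; exact: measurable_open.
Qed.

Lemma measurable_invg : measurable_fun setT (fun x : borel G => (x^-1)%g : borel G).
Proof. by apply: continuous_measurable; exact: invg_continuous. Qed.

Lemma measurable_mulg_fun d (T : measurableType d) (f g : T -> borel G) :
  measurable_fun setT f -> measurable_fun setT g ->
  measurable_fun setT (fun x => (f x * g x)%g : borel G).
Proof.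
move=> mf mg; exact: (measurableT_comp measurable_mulg (measurable_fun_pair mf mg)).
Qed.

Lemma measurable_invg_fun d (T : measurableType d) (f : T -> borel G) :
  measurable_fun setT f -> measurable_fun setT (fun x => ((f x)^-1)%g : borel G).
Proof. by move=> mf; exact: (measurableT_comp measurable_invg mf). Qed.

Lemma measurable_mulgl (s : G) : measurable_fun setT (fun x : borel G => (s * x)%g : borel G).
Proof. by apply: measurable_mulg_fun => //; exact: measurable_cst. Qed.

Lemma measurable_mulgr (s : G) : measurable_fun setT (fun x : borel G => (x * s)%g : borel G).
Proof. by apply: measurable_mulg_fun => //; exact: measurable_cst. Qed.

Context {R : realType}.
Variable mu : {sigma_finite_measure set (borel G) -> \bar R}.
Hypothesis haar_mu : left_haar mu.
Local Notation mu2 := (mu \x mu)%E.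

Lemma haar_scales (s : G) : scales_measure mu mu (fun x : borel G => (s * x)%g : borel G) 1.
Proof.
split => //; first exact: measurable_mulgl.
move=> A mA; rewrite mul1e; have [_ _ /(_ s)<-] := haar_mu; last first.
- by rewrite -[X in measurable X]setTI; exact: measurable_mulgl.
congr (mu _); apply/seteqP; split => [_ [x /= Ax <-]//|x Ax].
by exists (s^-1 * x)%g => //=; rewrite mulVKg.
Qed.

Lemma ge0_integral_mulgl (s : G) (f : borel G -> \bar R) : measurable_fun setT f ->
  (forall x, 0 <= f x)%E -> (\int[mu]_x f (s * x)%g = \int[mu]_x f x)%E.
Proof. by move=> mf f0; rewrite (ge0_integral_scales (haar_scales s) mf f0) mul1e. Qed.

Lemma ae_mulgl (s : G) (P : borel G -> Prop) :
  (\forall x \ae mu, P x) -> \forall x \ae mu, P (s * x)%g.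
Proof. by move=> hP; exact: (ae_scales (haar_scales s) hP). Qed.

(** Haar measure is not zero. Together with Fubini's theorem this selects one good point from almost
    all. *)
Lemma ae_ex (P : borel G -> Prop) : (\forall x \ae mu, P x) -> exists x, P x.
Proof.
have mu0 : (0 < mu setT)%E by rewrite lt0e measure_ge0 andbT; case: haar_mu.
by move=> hP; have := @filter_ex _ _ (ae_properfilter_algebraOfSetsType mu0) _ hP.
Qed.

(** For every t, left invariance puts [t^-1 * s] outside the null set [N] for almost all s. Fubini's
    theorem gives one s for which this holds for almost all t, and replacing t by [s * t] turns
    [t^-1 * s] into [t^-1]. *)
Lemma ae_invg (P : borel G -> Prop) :
  (\forall x \ae mu, P x) -> \forall x \ae mu, P x^-1%g.
Proof.
move=> [N [mN N0 sN]].
pose Q (z : G2) := ~ N (z.2^-1 * z.1)%g.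
have mQ : measurable [set z | Q z].
  have mf : measurable_fun setT (fun z : G2 => (z.2^-1 * z.1)%g : borel G).
    by apply: measurable_mulg_fun => //; apply: measurable_invg_fun.
  have -> : [set z | Q z] = (fun z : G2 => (z.2^-1 * z.1)%g : borel G) @^-1` (~` N) by [].
  by rewrite -[X in measurable X]setTI; apply: mf => //; exact: measurableC.
have aeN : \forall x \ae mu, ~ N x.
  by exists N; split => // x /= /contrapT.
have : \forall z \ae mu2, Q z.
  by apply: (ae_prod2 mu mu mQ).2; apply: aeW => t; exact: (ae_mulgl t^-1%g aeN).
move/(ae_prod1 mu mu mQ)/ae_ex => [s hs].
have := ae_mulgl s hs; apply: ae_mono => t; rewrite /Q/= invgM mulgVK => h.
by apply: contrapT => nP; apply: h; exact: sN.
Qed.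

(** Right translation by [q] is an inversion, a left translation by [q^-1], and an inversion. *)
Lemma ae_mulgr (q : G) (P : borel G -> Prop) :
  (\forall x \ae mu, P x) -> \forall x \ae mu, P (x * q)%g.
Proof.
move=> /ae_invg /(ae_mulgl q^-1%g) /ae_invg; apply: ae_mono => x.
by rewrite invgM !invgK.
Qed.

(** The measures of the right translates of [E] serve as denominators in [haar_inversion]. *)
Definition good_set (E : set (borel G)) := measurable E /\
  forall x : borel G, (0 < mu [set y : borel G | E (y * x)%g] < +oo)%E.

Lemma measurable_preimage_fun d d' (T : measurableType d) (T' : measurableType d')
    (f : T -> T') (A : set T') :
  measurable_fun setT f -> measurable A -> measurable [set x | A (f x)].
Proof. by move=> mf mA; rewrite -[X in measurable X]setTI; exact: mf. Qed.

(** A compact set of positive measure will do: its right translates are compact, hence of finite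
    measure, and they are not null because right translations preserve null sets. If all compact
    sets were null, countably many basic open sets, each inside a compact one, would cover the group
    and make the measure zero. *)
Lemma good_set_ex : hausdorff_space G -> locally_compact [set: G] ->
  exists E, good_set E.
Proof.
move=> hG lcG.
have [_ muK _] := haar_mu.
suff [K [cK K0]] : exists K : set G, compact K /\ mu K != 0%E.
  have mK : measurable (K : set (borel G)).
    rewrite -(setCK K); apply: measurableC; apply: measurable_open.
    by rewrite openC; exact: compact_closed.
  exists K; split => // x.
  have mKx : measurable [set y : borel G | K (y * x)%g].
    exact: (measurable_preimage_fun (measurable_mulgr x)).
  apply/andP; split; last first.
    have -> : [set y : borel G | K (y * x)%g] = (fun z : G => (z * x^-1)%g) @` K.
      apply/seteqP; split => [y /= Ky|_ [z Kz <-] /=]; last by rewrite mulgVK.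
      by exists (y * x)%g => //; rewrite mulgK.
    apply: muK; apply: continuous_compact => //.
    apply: continuous_subspaceT => z.
    apply: (@continuous_comp _ _ _ (fun z : G => (z, x^-1)%g) (fun z : G * G => (z.1 * z.2)%g)).
      by apply: cvg_pair; [exact: cvg_id|exact: cvg_cst].
    exact: mulg_continuous.
  rewrite lt0e measure_ge0 andbT; apply: contra K0 => /eqP h.
  have : \forall y \ae mu, ~ K (y * x)%g.
    by exists [set y : borel G | K (y * x)%g]; split => // y /= /contrapT.
  move=> /(ae_mulgr x^-1%g) => h2.
  have : \forall y \ae mu, ~ K y by apply: ae_mono h2 => y; rewrite mulgVK.
  move/(ae_measurableP mu (measurableC mK)).
  by rewrite (_ : ~` _ = K) => [->//|]; exact: setCK.
apply: contrapT => nK.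
have K0 (K : set G) : compact K -> mu K = 0%E.
  by move=> cK; apply/eqP; apply: contrapT => /negP h; apply: nK; exists K.
have [b [bo bb]] := second_countable_seq.
pose I n := exists2 K : set G, compact K /\ closed K & b n `<=` K.
have b0 n : I n -> mu (b n) = 0%E.
  move=> [K [cK clK] bK]; apply/eqP; rewrite -measure_le0 -(K0 _ cK).
  apply: le_measure => //; rewrite inE; first exact: measurable_open.
  rewrite -(setCK K); apply: measurableC; apply: measurable_open.
  by rewrite openC.
have : mu setT = 0%E.
  pose c n := if `[< I n >] then b n else set0.
  have cT : [set: G] = \bigcup_n c n.
    apply/seteqP; split => // x _.
    have [U] := lcG x Logic.I.
    rewrite /within/= => hU [cU clU].
    have [n bnx nU] := bb x U (filterS (fun y h => h Logic.I) hU).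
    exists n => //; rewrite /c; case: asboolP => // h; case: h; by exists U.
  have : mu.-negligible (\bigcup_n c n).
    apply: negligible_bigcup => n; rewrite /c; case: asboolP => [In|_]; last exact: negligible_set0.
    apply/negligibleP; [exact: measurable_open|exact: b0].
  by rewrite -cT => /negligibleP; apply.
by move=> h; case: haar_mu => /eqP.
Qed.

(** * The modular function *)

Section Modular.

Lemma good_set_mulr E (q : G) : good_set E -> good_set [set z | E (z * q)%g].
Proof.
move=> [mE gE]; split; first exact: (measurable_preimage_fun (measurable_mulgr q)).
move=> x; have := gE (x * q)%g.
by congr (_ < mu _ < _)%E; apply/seteqP; split => y /=; rewrite mulgA.
Qed.

(** The measure of E x^-1, that is, a multiple of the modular function at [x^-1]; [modular_ex]
    extracts the modular constants from it. *)
Let w (E : set (borel G)) (x : borel G) := fine (mu [set y : borel G | E (y * x)%g]).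

Let measurable_w E : measurable E -> measurable_fun setT (w E).
Proof.
move=> mE; apply: (measurableT_comp (fine_measurable measurableT)).
have mW : measurable [set z : G2 | E (z.2 * z.1)%g].
  apply: (measurable_preimage_fun _ mE).
  by apply: measurable_mulg_fun.
apply: eq_measurable_fun (measurable_fun_xsection mu mW) => x _.
by rewrite /= xsectionE.
Qed.

Let wK E : good_set E -> forall x, ((w E x)%:E = mu [set y : borel G | E (y * x)%g])%E.
Proof. by move=> [_ gE] x; rewrite fineK// ge0_fin_numE//; case/andP: (gE x). Qed.

Let w_gt0 E : good_set E -> forall x, 0 < w E x.
Proof. by move=> gE x; rewrite -lte_fin wK//; case: gE => _ /(_ x)/andP[]. Qed.

Let measurable_winv E : good_set E -> measurable_fun setT (fun x => (w E x)^-1).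
Proof.
move=> gE; have mw := measurable_w gE.1.
apply: eq_measurable_fun (measurableT_comp (@measurable_powR R (-1)) mw) => x _.
by rewrite /= powR_inv1// ltW// w_gt0.
Qed.

(* The substitution x |-> x^-1 in Haar measure: two applications of Tonelli
   and left invariance to the function (x, y) |-> f x / w x * 1_E (y x). *)
Lemma haar_inversion E (f : borel G -> R) : good_set E -> measurable_fun setT f ->
  (forall x, 0 <= f x) ->
  (\int[mu]_x (f x)%:E = mu E * \int[mu]_y (f y^-1%g / w E y^-1%g)%:E)%E.
Proof.
move=> gE mf f0; have [mE _] := gE.
have mw := measurable_w mE.
pose h x := f x / w E x.
have mh : measurable_fun setT h.
  by apply: measurable_funM => //; exact: measurable_winv.
have h0 x : 0 <= h x by rewrite divr_ge0// ltW// w_gt0.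
pose H1 (z : G2) := (h z.1 * \1_E (z.2 * z.1)%g)%:E.
have mH1 : measurable_fun setT H1.
  apply/measurable_EFinP; apply: measurable_funM.
    by apply: (measurableT_comp mh).
  apply: measurable_indic_comp => //.
  by apply: measurable_mulg_fun.
(* [H1] after the substitution of [y^-1 * x] for [x], at fixed [y]. *)
pose H2 (z : G2) := (h (z.2^-1 * z.1)%g * \1_E z.1)%:E.
have mH2 : measurable_fun setT H2.
  apply/measurable_EFinP; apply: measurable_funM.
    apply: (measurableT_comp mh); apply: measurable_mulg_fun => //.
    exact: measurable_invg_fun.
  by apply: measurable_indic_comp => //.
have H1ge0 z : (0 <= H1 z)%E by rewrite lee_fin mulr_ge0.
have H2ge0 z : (0 <= H2 z)%E by rewrite lee_fin mulr_ge0.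
transitivity (\int[mu]_x \int[mu]_y H1 (x, y))%E.
  apply: eq_integral => x _; rewrite /H1/=.
  under eq_integral do rewrite EFinM.
  have mEx : measurable [set y : borel G | E (y * x)%g].
    exact: (measurable_preimage_fun (measurable_mulgr x)).
  rewrite ge0_integralZl//; last first.
  - by rewrite lee_fin h0.
  - by apply/measurable_EFinP; apply: measurable_indic_comp => //; exact: measurable_mulgr.
  have -> : (\int[mu]_y (\1_E (y * x)%g)%:E)%E = (w E x)%:E.
    by rewrite wK//; apply/esym; exact: (measure_integral_indic mu mEx).
  by rewrite -EFinM /h mulfVK// gt_eqF// w_gt0.
rewrite (fubini_tonelli (m1 := mu) (m2 := mu) H1)//.
transitivity (\int[mu]_y \int[mu]_x H2 (x, y))%E.
  apply: eq_integral => y _.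
  rewrite -(ge0_integral_mulgl y (f := fun x => H2 (x, y)))//.
    by apply: eq_integral => x _; rewrite /H1 /H2/= mulKg.
  exact: measurable_fun_pair1.
rewrite -(fubini_tonelli (m1 := mu) (m2 := mu) H2)//.
set C := (\int[mu]_y _)%E.
have C0 : (0 <= C)%E by apply: integral_ge0 => y _; rewrite lee_fin h0.
(* Substituting [x * y] for [y] in [H2] turns [y^-1 * x] into [y^-1] and separates the variables. *)
transitivity (\int[mu]_x ((\1_E x)%:E * C))%E.
  apply: eq_integral => x _.
  rewrite -(ge0_integral_mulgl x (f := fun y => H2 (x, y)))//; last exact: measurable_fun_pair2.
  rewrite /C -ge0_integralZl//.
  - by apply: eq_integral => y _; rewrite /H2/= invgM mulgVK mulrC EFinM.
  - apply/measurable_EFinP; apply: (measurableT_comp mh); exact: measurable_invg.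
  - by move=> y _; rewrite lee_fin h0.
rewrite ge0_integralZr//; last by apply/measurable_EFinP; exact: measurable_indic.
by rewrite integral_indic// setIT.
Qed.

(** [haar_inversion] is applied to the translated indicator of [A] with the set [E], and to the
    indicator of [A] with the translate [E'] of [E] by [q]. Substituting [q * y] for [y] identifies
    the two integrals on the right, and what remains is the ratio of the measures of [E] and [E'],
    the same for all [A]. *)
Lemma modular_ex (q : G) : hausdorff_space G -> locally_compact [set: G] ->
  exists2 kappa : R, 0 < kappa &
    scales_measure mu mu (fun x : borel G => (x * q)%g : borel G) kappa.
Proof.
move=> hG lcG; have [E gE] := good_set_ex hG lcG.
pose E' := [set z | E (z * q^-1)%g].
have gE' : good_set E' by exact: good_set_mulr.
have w1 F : good_set F -> (mu F = (w F 1%g)%:E)%E.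
  by move=> gF; rewrite wK//; congr (mu _); apply/seteqP; split => y /=; rewrite mulg1.
exists (w E 1%g / w E' 1%g); first by rewrite divr_gt0// w_gt0.
split; first exact: measurable_mulgr.
  by rewrite divr_ge0// ltW// w_gt0.
move=> A mA.
have mAq : measurable [set x : borel G | A (x * q)%g].
  exact: (measurable_preimage_fun (measurable_mulgr q)).
transitivity (\int[mu]_x (\1_A (x * q)%g : R)%:E)%E; first exact: (measure_integral_indic mu mAq).
rewrite [X in _ = (_ * X)%E](_ : _ = (\int[mu]_x (\1_A x : R)%:E)%E); last exact: (measure_integral_indic mu mA).
rewrite (haar_inversion gE (f := fun x => \1_A (x * q)%g))//; last first.
  by apply: measurable_indic_comp => //; exact: measurable_mulgr.
rewrite (haar_inversion gE' (f := fun x => \1_A x))//; last first.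
  exact: (measurable_indic_comp (@measurable_id _ _ _) mA).
rewrite muleA (w1 _ gE) (w1 _ gE') -EFinM mulfVK ?gt_eqF ?w_gt0//; congr (_ * _)%E.
have mE := gE.1.
pose F (y : borel G) := ((\1_A (y^-1 * q)%g / w E y^-1%g : R)%:E).
have mF : measurable_fun setT F.
  apply/measurable_EFinP; apply: measurable_funM.
    apply: measurable_indic_comp => //; apply: measurable_mulg_fun.
      exact: measurable_invg.
    exact: measurable_cst.
  by apply: (measurableT_comp (measurable_winv gE)); exact: measurable_invg.
have F0 y : (0 <= F y)%E by rewrite lee_fin divr_ge0// ltW// w_gt0.
transitivity (\int[mu]_y F y)%E; first by [].
rewrite -(ge0_integral_mulgl q)//; apply: eq_integral => y _.
rewrite /F invgM mulgVK; congr (_ / fine (mu _))%:E.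
by apply/seteqP; split => z /=; rewrite /E'/= mulgA.
Qed.

End Modular.

End TopologicalGroupMeasurability.

(** * Normal Haagerup tensor products *)

Section HaagerupSums.
Context {R : realType} d1 d2 {X : measurableType d1} {Y : measurableType d2}.
Variables (mu : {measure set X -> \bar R}) (nu : {measure set Y -> \bar R}).

(** As a row, or as a column, of multiplication operators the first [n] functions have norm at most
    the square root of [C], for every [n]. *)
Definition ae_l2_le d (T : measurableType d) (m : {measure set T -> \bar R})
    (a : nat -> T -> R[i]) (C : R) :=
  (forall i, Linf m (a i)) /\
  \forall x \ae m, forall n, \sum_(i < n) normc (a i x) ^+ 2 <= C.

Lemma sqnorm_ge0 d (T : measurableType d) (m : {measure set T -> \bar R})
  (f : T -> R[i]) : (0 <= sqnorm m f)%E.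
Proof. by apply: integral_ge0 => x _; rewrite lee_fin sqr_ge0. Qed.

Lemma sqnorm0 d (T : measurableType d) (m : {measure set T -> \bar R}) :
  sqnorm m (0 : T -> R[i]) = 0%E.
Proof.
rewrite /sqnorm -[RHS](integral0 m setT); apply: eq_integral => x _.
by rewrite -[(0 : T -> R[i]) x]/(0 : R[i]) Normc.normc0 expr0n.
Qed.

Lemma mulop0l d (T : measurableType d) (f : T -> R[i]) : mulop 0 f = 0.
Proof. by apply/funext => x; exact: mul0r. Qed.

Lemma sumr_fctE (T : Type) I (r : seq I) (F : I -> T -> R[i]) x :
  (\sum_(i <- r) F i) x = \sum_(i <- r) F i x.
Proof. by rewrite fct_sumE. Qed.

Lemma sum_sqnorm d (T : measurableType d) (m : {measure set T -> \bar R})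
    n (xi : 'I_n -> T -> R[i]) : (forall j, cmeasurable (xi j)) ->
  (\sum_(j < n) sqnorm m (xi j) = \int[m]_x (\sum_(j < n) normc (xi j x) ^+ 2)%:E)%E.
Proof.
move=> mxi; rewrite /sqnorm -ge0_integral_sum//.
- by apply: eq_integral => x _; rewrite sumEFin.
- by move=> j; exact: cmeasurable_sqr.
- by move=> j x _; rewrite lee_fin sqr_ge0.
Qed.

(** The pointwise Cauchy-Schwarz inequality, integrated. The row is padded by zeros because
    [cb_norm_le] tests square matrices. *)
Lemma row_norm_le n (a : nat -> X -> R[i]) (C : R) : 0 <= C -> ae_l2_le mu a C ->
  Linf_mx_norm_le mu (fun i k : 'I_n.+1 => if i == ord0 then a k else 0) (Num.sqrt C).
Proof.
move=> C0 [aoo aC] xi xi2; rewrite sqr_sqrtr//.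
rewrite big_ord_recl/= [X in (_ + X)%E]big1 ?adde0; last first.
  by move=> i _; rewrite big1 ?sqnorm0// => j _; rewrite mulop0l.
have mxi j : cmeasurable (xi j) by case: (xi2 j).
rewrite sum_sqnorm// -ge0_integralZl//; first last.
- by move=> x _; rewrite lee_fin sumr_ge0// => j _; exact: sqr_ge0.
- apply/measurable_EFinP; apply: measurable_sum => j.
  by apply: measurable_funX; exact: cmeasurable_normc.
apply: ae_ge0_le_integral => //.
- by move=> x _; rewrite lee_fin sqr_ge0.
- apply: cmeasurable_sqr.
  rewrite (_ : (\sum_(j < n.+1) mulop (a j) (xi j))%R =
    (fun x => \sum_(j < n.+1) mulop (a j) (xi j) x)); last first.
    by apply/funext => x; rewrite sumr_fctE.
  by apply: cmeasurable_sum => j _; apply: cmeasurableM => //; case: (aoo j).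
- by move=> x _; rewrite mule_ge0 ?lee_fin// sumr_ge0// => j _; exact: sqr_ge0.
- apply: measurable_funeM; apply/measurable_EFinP; apply: measurable_sum => j.
  by apply: measurable_funX; exact: cmeasurable_normc.
apply: ae_mono aC => x aC _; rewrite -EFinM lee_fin sumr_fctE /mulop.
have -> : \sum_(j < n.+1) normc (xi j x) ^+ 2 =
   \sum_(j < n.+1) normc (xi (inord j) x) ^+ 2.
  by apply: eq_bigr => j _; rewrite inord_val.
have -> : \sum_(j < n.+1) a j x * xi j x = \sum_(j < n.+1) a j x * xi (inord j) x.
  by apply: eq_bigr => j _; rewrite inord_val.
apply: le_trans (cauchy_schwarz n.+1 (fun j => a j x) (fun j => xi (inord j) x)) _.
by rewrite ler_wpM2r// sumr_ge0// => j _; exact: sqr_ge0.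
Qed.

(** Only the coordinate [ord0] of the vector is seen, and at each point the squares of the column
    add up to at most [C] times its square. *)
Lemma col_norm_le n (b : nat -> Y -> R[i]) (C : R) : 0 <= C -> ae_l2_le nu b C ->
  Linf_mx_norm_le nu (fun k j : 'I_n.+1 => if j == ord0 then b k else 0) (Num.sqrt C).
Proof.
move=> C0 [boo bC] xi xi2; rewrite sqr_sqrtr//.
have mxi j : cmeasurable (xi j) by case: (xi2 j).
have -> : (\sum_(i < n.+1) sqnorm nu
     (\sum_(j < n.+1) mulop (if j == ord0 then b i else 0%R) (xi j))%R =
   \sum_(i < n.+1) sqnorm nu (mulop (b i) (xi ord0)))%E.
  apply: eq_bigr => i _; congr sqnorm.
  rewrite big_ord_recl/= big1 ?addr0// => j _.
  by rewrite mulop0l.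
apply: (@le_trans _ _ (C%:E * sqnorm nu (xi ord0))%E); last first.
  rewrite lee_wpmul2l ?lee_fin// big_ord_recl leeDl// sume_ge0// => i _.
  exact: sqnorm_ge0.
rewrite sum_sqnorm; last first.
  by move=> j; apply: cmeasurableM => //; case: (boo j).
rewrite /sqnorm -ge0_integralZl//; first last.
- by move=> x _; rewrite lee_fin sqr_ge0.
- exact: cmeasurable_sqr.
apply: ae_ge0_le_integral => //.
- by move=> x _; rewrite lee_fin sumr_ge0// => j _; exact: sqr_ge0.
- apply/measurable_EFinP; apply: measurable_sum => j; apply: measurable_funX.
  by apply: cmeasurable_normc; apply: cmeasurableM => //; case: (boo j).
- by move=> x _; rewrite mule_ge0 ?lee_fin// sqr_ge0.
- by apply: measurable_funeM; exact: cmeasurable_sqr.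
apply: ae_mono bC => x bC _; rewrite -EFinM lee_fin /mulop.
under eq_bigr do rewrite Normc.normcM exprMn.
by rewrite -mulr_suml ler_wpM2r// sqr_ge0.
Qed.

(** The value 1 at 0 keeps it unimodular everywhere. *)
Definition phase (z : R[i]) : R[i] :=
  if z == 0 then 1 else (normc z)^-1%:C * z^*%C.

Lemma normc_phase z : normc (phase z) = 1.
Proof.
rewrite /phase; case: eqVneq => [_|z0]; first by rewrite Normc.normc1.
have nz : normc z != 0 by apply: contra z0 => /eqP/Normc.eq0_normc ->.
by rewrite Normc.normcM normcC normc_conj ger0_norm ?invr_ge0 ?normc_ge0// mulVf.
Qed.

Lemma mul_phase z : phase z * z = (normc z)%:C.
Proof.
rewrite /phase; case: eqVneq => [->|z0]; first by rewrite Normc.normc0 mulr0.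
have nz : normc z != 0 by apply: contra z0 => /eqP/Normc.eq0_normc ->.
rewrite -mulrA [z^*%C * z]mulrC mul_conj -rmorphM/=; congr (_%:C).
by rewrite expr2 mulKf.
Qed.

Lemma bilinear_form_Z (F : (X -> R[i]) -> (Y -> R[i]) -> R[i]) : bilinear_form mu nu F -> forall c a b,
  Linf mu a -> Linf nu b -> F (c *: a) b = c * F a b.
Proof.
move=> [F1 F2] c a b aoo boo.
have z0 : Linf mu (0 : X -> R[i]) by exact: Linf_cst.
have F0 : F 0 b = 0.
  have := F1 1 0 0 b z0 z0 boo; rewrite scale1r addr0 mul1r => /eqP.
  by rewrite -subr_eq0 opprD addrA subrr sub0r oppr_eq0 => /eqP.
by have := F1 c a 0 b aoo z0 boo; rewrite addr0 F0 addr0.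
Qed.

(* The amplification of [F] to the row [c_i a_i] and the column [b_i], with
   unimodular [c_i] chosen so that every [c_i F a_i b_i] is nonnegative. *)
Lemma cb_sum_le (F : (X -> R[i]) -> (Y -> R[i]) -> R[i]) (K : R)
    (a : nat -> X -> R[i]) (b : nat -> Y -> R[i]) (C D : R) n : bilinear_form mu nu F -> 0 <= K -> cb_norm_le mu nu F K ->
  0 <= C -> 0 <= D -> ae_l2_le mu a C -> ae_l2_le nu b D ->
  \sum_(i < n) normc (F (a i) (b i)) <= K * Num.sqrt C * Num.sqrt D.
Proof.
move=> bF K0 FK C0 D0 ha hb; case: n => [|n].
  by rewrite big_ord0 !mulr_ge0// sqrtr_ge0.
pose c i := phase (F (a i) (b i)).
pose a' i : X -> R[i] := c i *: a i.
have ha' : ae_l2_le mu a' C.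
  case: ha => aoo aC; split; first by move=> i; exact: LinfZ.
  apply: ae_mono aC => x h m; apply: le_trans (h m); apply: ler_sum => i _.
  by rewrite /a' fctE Normc.normcM normc_phase mul1r.
pose x (i k : 'I_n.+1) : X -> R[i] := if i == ord0 then a' k else 0.
pose y (k j : 'I_n.+1) : Y -> R[i] := if j == ord0 then b k else 0.
have xoo i k : Linf mu (x i k).
  by rewrite /x; case: ifP => _; [case: ha' => + _|exact: Linf_cst].
have yoo i k : Linf nu (y i k).
  by rewrite /y; case: ifP => _; [case: hb => + _|exact: Linf_cst].
have := FK n.+1 x y _ _ xoo yoo (sqrtr_ge0 C) (sqrtr_ge0 D)
  (row_norm_le C0 ha') (col_norm_le D0 hb).
(* The first basis vector selects the first column of the amplified matrix; its entry [ord0] is the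
   sum of the F (a' i) (b i). *)
move=> /(_ (\col_i (if i == ord0 then 1 else 0))).
set A := (\matrix_(i, j) _).
have vE : \sum_(j < n.+1) normc ((\col_i (if i == ord0 then 1 else 0) : 'cV[R[i]]_n.+1) j 0) ^+ 2 = 1 :> R.
  rewrite big_ord_recl big1 ?addr0 => [|j _].
    by rewrite mxE eqxx Normc.normc1 expr1n.
  by rewrite mxE -[lift _ _ == _]/false Normc.normc0 expr0n.
rewrite vE mulr1 => h.
set S := \sum_(i < n.+1) _.
have AE : (A *m \col_i (if i == ord0 then 1 else 0)) ord0 0 = S%:C.
  rewrite mxE big_ord_recl big1 ?addr0; last by move=> j _; rewrite !mxE/= mulr0.
  rewrite !mxE/= mulr1 /S rmorph_sum/=; apply: eq_bigr => k _.
  rewrite /x /y/= /a' (bilinear_form_Z bF); [|by case: ha|by case: hb].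
  by rewrite mul_phase.
have S0 : 0 <= S by apply: sumr_ge0 => i _; exact: normc_ge0.
have : S ^+ 2 <= (K * Num.sqrt C * Num.sqrt D) ^+ 2.
  apply: le_trans h; rewrite big_ord_recl AE normcC ger0_norm//.
  by rewrite lerDl sumr_ge0// => i _; exact: sqr_ge0.
by rewrite ler_pXn2r// ?nnegrE ?mulr_ge0 ?sqrtr_ge0.
Qed.

(** The bound of [cb_sum_le] is uniform in [n]. It makes the series absolutely convergent, whence
    linearity in the form, and it is also the norm estimate. *)
Lemma haagerup_sum_normal (a : nat -> X -> R[i]) (b : nat -> Y -> R[i]) (C D : R) :
  0 <= C -> 0 <= D -> ae_l2_le mu a C -> ae_l2_le nu b D ->
  normal_haagerup mu nu (haagerup_sum a b).
Proof.
move=> C0 D0 ha hb.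
have sF F : normal_cb_form mu nu F -> csummable (fun i => F (a i) (b i)).
  move=> [bF [K K0 FK] _ _]; apply: (@csummable_bound _ _ (K * Num.sqrt C * Num.sqrt D)) => n.
  exact: (@cb_sum_le F K a b C D n).
split=> [c F F' nF nF'|].
  by rewrite /haagerup_sum csumD ?csumZ//; [exact: sF|apply: csummableZ; exact: sF|exact: sF].
exists (Num.sqrt C * Num.sqrt D); first by rewrite mulr_ge0 ?sqrtr_ge0.
move=> F K [bF _ _ _] K0 FK; rewrite mulrC mulrA.
by apply: normc_csum_bound => n; exact: (@cb_sum_le F K a b C D n).
Qed.

End HaagerupSums.

(** * Products of two and three sigma-finite measures *)

Section ProductSigmaFinite.
Context {R : realType} d1 d2 {T1 : measurableType d1} {T2 : measurableType d2}.
Variables (m1 : {sigma_finite_measure set T1 -> \bar R}).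
Variables (m2 : {sigma_finite_measure set T2 -> \bar R}).

Lemma product_sigma_finite : sigma_finite setT (m1 \x m2)%E.
Proof.
(* Increasing exhaustions, so that a single index serves both factors. *)
have /sigma_finiteP[F [TF ndF Foo]] := sigma_finiteT m1.
have /sigma_finiteP[G [TG ndG Goo]] := sigma_finiteT m2.
exists (fun n => F n `*` G n).
  rewrite -setXTT TF TG; apply/seteqP; split => [[x y] [/= [n _ Fnx] [k _ Gky]]|
      [x y] [n _ [/= ? ?]]]; last by split; exists n.
  exists (maxn n k) => //; split.
  - by move: x Fnx; exact/subsetPset/ndF/leq_maxl.
  - by move: y Gky; exact/subsetPset/ndG/leq_maxr.
move=> k; have [? ?] := Foo k; have [? ?] := Goo k.
split; first exact: measurableX.
by rewrite product_measure1E// lte_mul_pinfty// ge0_fin_numE.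
Qed.

(* The library's canonical structure on [m1 \x m2] only applies to
   subprobabilities. *)
Definition product_sf : {sigma_finite_measure set (T1 * T2)%type -> \bar R} :=
  HB.pack_for (sigma_finite_measure (T1 * T2)%type R) (m1 \x m2)%E
    (Measure_isSigmaFinite.Build _ _ _ (m1 \x m2)%E product_sigma_finite).

End ProductSigmaFinite.

Section TripleUniqueness.
Context {R : realType}.

(** A bound at every point makes every slice of the function bounded, not merely almost every
    one. *)
Lemma Linf_truncation d (T : measurableType d) (m : {measure set T -> \bar R})
    (k : T -> R[i]) : Linf m k ->
  exists k' M, [/\ cmeasurable k', 0 <= M, forall x, normc (k' x) <= M &
    \forall x \ae m, k x = k' x].
Proof.
move=> /LinfP[mk [M M0 kM]]; pose A := [set x | normc (k x) <= M].
have mA : measurable A.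
  have -> : A = (fun x => normc (k x)) @^-1` `]-oo, M]%classic.
    by apply/seteqP; split => x /=; rewrite in_itv.
  by rewrite -[X in measurable X]setTI; apply: cmeasurable_normc.
exists (fun x => (\1_A x : R)%:C * k x), M; split => //.
- exact: cmeasurable_indic.
- move=> x; rewrite Normc.normcM normc_indic indicE.
  by case: (boolP (x \in A)) => [|_]; rewrite ?inE/= ?mul1r ?mul0r.
- by apply: ae_mono kM => x kM; rewrite indicE mem_set// mul1r.
Qed.

Lemma normc_cintegral_le d (T : measurableType d) (m : {measure set T -> \bar R})
    (k f : T -> R[i]) (M : R) : cmeasurable k -> 0 <= M -> (forall x, normc (k x) <= M) ->
  L1 m f -> normc (cintegral m (fun x => k x * f x)) <=
    M * fine (\int[m]_x (normc (f x))%:E)%E.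
Proof.
move=> mk M0 kM f1.
have ff : (\int[m]_x (normc (f x))%:E)%E \is a fin_num.
  exact: integrable_fin_num (L1_normc f1).
have L := L1_bounded_mul mk kM f1.
rewrite -lee_fin (le_trans (normc_cintegral L))// EFinM fineK//.
rewrite -ge0_integralZl//; first last.
- by move=> x _; rewrite lee_fin normc_ge0.
- by apply/measurable_EFinP; apply: cmeasurable_normc; case: f1.
apply: ge0_le_integral => //.
- by move=> x _; rewrite lee_fin normc_ge0.
- by apply/measurable_EFinP; apply: cmeasurable_normc; case: L.
- apply: measurable_funeM; apply/measurable_EFinP; apply: cmeasurable_normc.
  by case: f1.
- by move=> x _; rewrite -EFinM lee_fin Normc.normcM ler_wpM2r ?normc_ge0.
Qed.

Context d1 d2 d3 {T1 : measurableType d1} {T2 : measurableType d2}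
  {T3 : measurableType d3}.
Variables (m1 : {sigma_finite_measure set T1 -> \bar R}).
Variables (m2 : {sigma_finite_measure set T2 -> \bar R}).
Variables (m3 : {sigma_finite_measure set T3 -> \bar R}).
Local Notation m12 := (m1 \x m2)%E.
Local Notation m123 := ((m1 \x m2) \x m3)%E.

Lemma L1_tensor3 (f : T1 -> R[i]) (w : T2 -> R[i]) (g : T3 -> R[i]) :
  L1 m1 f -> L1 m2 w -> L1 m3 g -> L1 m123 (fun x => f x.1.1 * w x.1.2 * g x.2).
Proof.
move=> f1 w1 g1.
exact: (@L1_tensor _ _ _ _ _ (product_sf m1 m2) m3 _ _ (L1_tensor f1 w1) g1).
Qed.

Lemma cFubini12_3 (F : T1 * T2 * T3 -> R[i]) : L1 m123 F ->
  cintegral m123 F =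
  cintegral m12 (fun z => cintegral m3 (fun r => F (z, r))).
Proof. exact: (@cFubini1 _ _ _ _ _ (product_sf m1 m2) m3). Qed.

Lemma ae_prod12_3 (P : T1 * T2 * T3 -> Prop) : measurable [set x | P x] ->
  (\forall x \ae m123, P x) <->
  (\forall z \ae m12, \forall r \ae m3, P (z, r)).
Proof. exact: (@ae_prod1 _ _ _ _ _ (product_sf m1 m2) m3). Qed.

Lemma Linf_eq0_3 (k : T1 * T2 * T3 -> R[i]) : Linf m123 k ->
  (forall f, L1 m123 f -> dual_pairing m123 k f = 0) ->
  \forall x \ae m123, k x = 0.
Proof. exact: (@Linf_eq0 _ _ _ (product_sf (product_sf m1 m2) m3)). Qed.

Lemma Linf_tensor3_eq0 (k : T1 * T2 * T3 -> R[i]) : Linf m123 k ->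
  (forall f w g, L1 m1 f -> L1 m2 w -> L1 m3 g ->
    dual_pairing m123 k (fun x => f x.1.1 * w x.1.2 * g x.2) = 0) ->
  \forall x \ae m123, k x = 0.
Proof.
move=> koo k0; have [k' [M [mk' M0 k'M kk']]] := Linf_truncation koo.
have k'0 f w g : L1 m1 f -> L1 m2 w -> L1 m3 g ->
    dual_pairing m123 k' (fun x => f x.1.1 * w x.1.2 * g x.2) = 0.
  move=> f1 w1 g1; rewrite -(k0 f w g)//; apply: ae_eq_dual_pairing => //.
  - by case: koo.
  - by case: (L1_tensor3 f1 w1 g1).
  - by apply: ae_mono kk' => x ->.
suff h : \forall x \ae m123, k' x = 0.
  by apply: (ae_mono2 _ kk' h) => x -> .
have k'oo : Linf m123 k' by exact: bounded_Linf k'M.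
have L F g : L1 m12 F -> L1 m3 g -> L1 m123 (fun x => k' x * (F x.1 * g x.2)).
  move=> F1 g1; apply: (L1_bounded_mul mk' k'M).
  exact: (@L1_tensor _ _ _ _ _ (product_sf m1 m2) m3).
apply: (@Linf_tensor_eq0 _ _ _ _ _ (product_sf m1 m2) m3) => // F g F1 g1.
pose K z := cintegral m3 (fun r => k' (z, r) * g r).
have E F' : L1 m12 F' -> dual_pairing m123 k' (fun x => F' x.1 * g x.2) =
    dual_pairing m12 K F'.
  move=> F'1; rewrite /dual_pairing cFubini12_3; last exact: L.
  apply: eq_cintegral => z /=; rewrite mulrC /K -cintegralZ.
    by apply: eq_cintegral => r; ring.
  apply: (L1_bounded_mul _ (fun r => k'M (z, r))) => //.
  exact: (cmeasurable_comp mk' (pair1_measurable z)).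
rewrite [LHS]E//.
have mkg : cmeasurable (fun x : T1 * T2 * T3 => k' x * g x.2).
  apply: cmeasurableM => //.
  by apply: (cmeasurable_comp _ (@measurable_snd _ _ _ _)); case: g1.
have Koo : Linf m12 K.
  apply: (@bounded_Linf _ _ _ _ _ (M * fine (\int[m3]_r (normc (g r))%:E)%E)).
    exact: (cmeasurable_cintegral m3 mkg).
  move=> z; apply: normc_cintegral_le => //.
  exact: (cmeasurable_comp mk' (pair1_measurable z)).
have K0 : \forall z \ae m12, K z = 0.
  apply: Linf_tensor_eq0 => // f w f1 w1.
  by rewrite -E; [exact: k'0|exact: L1_tensor].
have mK : cmeasurable K by case: Koo.
rewrite (@ae_eq_dual_pairing _ _ _ _ K (fun=> 0))//.
- by rewrite /dual_pairing; under eq_fun do rewrite mul0r; rewrite cintegral0.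
- by case: F1.
Qed.

End TripleUniqueness.

(** * Kernels of square summable sequences of functions *)

Section SchurKernel.
Context {R : realType} d {T : measurableType d}.
Implicit Types (a b : nat -> T -> R[i]) (C D : R).

(** The bound of [ae_l2_le] at every point, so that [kernel] is meaningful on null sets too. *)
Definition l2_le a C := [/\ 0 <= C, forall i, cmeasurable (a i) &
  forall x n, \sum_(i < n) normc (a i x) ^+ 2 <= C].

Lemma l2_prod_sum_le (u v : nat -> R[i]) C D : 0 <= C -> 0 <= D ->
  (forall n, \sum_(i < n) normc (u i) ^+ 2 <= C) ->
  (forall n, \sum_(i < n) normc (v i) ^+ 2 <= D) ->
  forall n, \sum_(i < n) normc (u i * v i) <= Num.sqrt C * Num.sqrt D.
Proof.
move=> C0 D0 uC vD n; rewrite -sqrtrM//.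
under eq_bigr do rewrite Normc.normcM.
set S := \sum_(i < n) _.
have S0 : 0 <= S by apply: sumr_ge0 => i _; rewrite mulr_ge0 ?normc_ge0.
rewrite -(ger0_norm S0) -sqrtr_sqr ler_wsqrtr//.
apply: le_trans (real_cauchy_schwarz n (fun i => normc (u i)) (fun i => normc (v i))) _.
by apply: ler_pM => //; apply: sumr_ge0 => i _; exact: sqr_ge0.
Qed.

Lemma l2_le_normc a C i x : l2_le a C -> normc (a i x) <= Num.sqrt C.
Proof.
move=> [C0 _ aC]; rewrite -(ger0_norm (normc_ge0 (a i x))) -sqrtr_sqr ler_wsqrtr//.
apply: le_trans (aC x i.+1); rewrite big_ord_recr/= lerDr sumr_ge0// => j _.
exact: sqr_ge0.
Qed.

Lemma l2_le_comp d' (T' : measurableType d') a C (p : T' -> T) :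
  measurable_fun setT p -> l2_le a C -> [/\ 0 <= C,
    forall i, cmeasurable (fun x => a i (p x)) &
    forall x n, \sum_(i < n) normc (a i (p x)) ^+ 2 <= C].
Proof. by move=> mp [C0 ma aC]; split => // i; exact: cmeasurable_comp. Qed.

(** All [a i] are set to zero off one measurable set, where every partial sum of squares stays below
    the essential bound. [Num.max C0 0] makes the bound hold for the zero sums off that set. *)
Lemma l2_truncation (mu : {measure set T -> \bar R}) a :
  (forall i, Linf mu (a i)) ->
  (ess_sup mu (fun s => \sum_(0 <= i <oo) (normc (a i s) ^+ 2)%:E) < +oo)%E ->
  exists a' C, l2_le a' C /\ \forall s \ae mu, forall i, a i s = a' i s.
Proof.
move=> aoo hoo.
have [C0 hC] : exists C0 : R, (ess_sup mu (fun s => \sum_(0 <= i <oo) (normc (a i s) ^+ 2)%:E) <= C0%:E)%E.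
  case: (ess_sup _ _) hoo => [r| |] // _; first by exists r.
  by exists 0; rewrite leNye.
pose C := Num.max C0 0.
pose A := \bigcap_n [set s | \sum_(i < n) normc (a i s) ^+ 2 <= C].
have ma i : cmeasurable (a i) by case: (aoo i).
have mA : measurable A.
  apply: bigcap_measurableType => n _.
  have -> : [set s | \sum_(i < n) normc (a i s) ^+ 2 <= C] =
      (fun s => \sum_(i < n) normc (a i s) ^+ 2) @^-1` `]-oo, C]%classic.
    by apply/seteqP; split => x /=; rewrite in_itv.
  rewrite -[X in measurable X]setTI; apply: measurable_sum => // i.
  by apply: measurable_funX; exact: cmeasurable_normc.
exists (fun i s => (\1_A s : R)%:C * a i s), C; split.
  split; first by rewrite le_max lexx orbT.
    by move=> i; exact: cmeasurable_indic.
  move=> s n; have [sA|sA] := boolP (s \in A).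
    under eq_bigr do rewrite indicE sA mul1r.
    by move: sA; rewrite inE => /(_ n I).
  under eq_bigr do rewrite indicE (negbTE sA) mul0r Normc.normc0 expr0n/=.
  by rewrite big1// le_max lexx orbT.
move/ess_supP : hC; apply: ae_mono => s hs i.
rewrite indicE mem_set ?mul1r// => n _ /=.
rewrite le_max -lee_fin; apply/orP; left; apply: le_trans hs.
by apply: le_sum_nneseries => k; exact: sqr_ge0.
Qed.

Definition kernel a b (z : T * T) : R[i] := csum (fun i => a i z.1 * b i z.2).

Section Bounded.
Variables (a b : nat -> T -> R[i]) (C D : R).
Hypotheses (ha : l2_le a C) (hb : l2_le b D).

Lemma kernel_sum_le s t n :
  \sum_(i < n) normc (a i s * b i t) <= Num.sqrt C * Num.sqrt D.
Proof. by case: ha hb => C0 _ aC [D0 _ bD]; exact: (l2_prod_sum_le (u := fun i => a i s) (v := fun i => b i t) C0 D0 (aC s) (bD t)). Qed.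

Lemma kernel_csummable s t : csummable (fun i => a i s * b i t).
Proof. by apply: csummable_bound => n; exact: kernel_sum_le. Qed.

Lemma kernel_cvg s t : ccvg (fun n => \sum_(i < n) a i s * b i t) (kernel a b (s, t)).
Proof. exact: csum_cvg (kernel_csummable s t). Qed.

Lemma kernel_le z : normc (kernel a b z) <= Num.sqrt C * Num.sqrt D.
Proof. by apply: normc_csum_bound => n; exact: kernel_sum_le. Qed.

Lemma kernel_partial_le s t n :
  normc (\sum_(i < n) a i s * b i t) <= Num.sqrt C * Num.sqrt D.
Proof. exact: le_trans (normc_sum _ _ _) (kernel_sum_le s t n). Qed.

Lemma cmeasurable_kernel : cmeasurable (kernel a b).
Proof.
case: ha hb => _ ma _ [_ mb _].
apply: (@cmeasurable_csum _ _ _ (fun i (z : T * T) => a i z.1 * b i z.2)) => [i|z].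
  apply: cmeasurableM.
    exact: (cmeasurable_comp (ma i) measurable_fst).
  exact: (cmeasurable_comp (mb i) measurable_snd).
exact: kernel_csummable.
Qed.

End Bounded.
End SchurKernel.

Section SliceBound.
Context {R : realType} d {T : measurableType d}.
Variable mu : {measure set T -> \bar R}.

(* Test the sum against the coefficients conj z_i. *)
Lemma slice_l2 (k : nat -> T -> R[i]) (C : R) (f : T -> R[i]) n :
  l2_le k C -> L1 mu f ->
  \sum_(i < n) normc (cintegral mu (fun x => k i x * f x)) ^+ 2 <=
  (fine (\int[mu]_x (normc (f x))%:E)%E) ^+ 2 * C.
Proof.
move=> hk f1; have [C0 mk kC] := hk.
set N := fine _.
have N0 : 0 <= N by apply: fine_ge0; apply: integral_ge0 => x _; rewrite lee_fin normc_ge0.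
pose z i := cintegral mu (fun x => k i x * f x).
set S := \sum_(i < n) _.
have S0 : 0 <= S by apply: sumr_ge0 => i _; exact: sqr_ge0.
have Li i : L1 mu (fun x => k i x * f x).
  by apply: (L1_bounded_mul (mk i) _ f1) => x; exact: l2_le_normc hk.
have SE : S%:C = cintegral mu (fun x => (\sum_(i < n) (z i)^*%C * k i x) * f x).
  rewrite (eq_cintegral mu (g := fun x => \sum_(i < n) (z i)^*%C * (k i x * f x))); last first.
    by move=> x; rewrite mulr_suml; apply: eq_bigr => i _; rewrite mulrA.
  rewrite cintegral_sum; last by move=> i; exact: L1Z.
  rewrite /S rmorph_sum/=; apply: eq_bigr => i _.
  by rewrite cintegralZ// -/(z i) mulrC mul_conj.
have : S <= (Num.sqrt S * Num.sqrt C) * N.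
  rewrite -[leLHS](ger0_norm S0) -normcC SE.
  apply: normc_cintegral_le => //.
  - by apply: cmeasurable_sum => i _; exact: cmeasurableZ.
  - move=> x; rewrite (le_trans (normc_sum _ _ _))//.
    rewrite -sqrtrM//.
    under eq_bigr do rewrite Normc.normcM normc_conj.
    set W := \sum_(i < n) _.
    have W0 : 0 <= W by apply: sumr_ge0 => i _; rewrite mulr_ge0 ?normc_ge0.
    rewrite -(ger0_norm W0) -sqrtr_sqr ler_wsqrtr//.
    apply: le_trans (real_cauchy_schwarz n (fun i => normc (z i)) (fun i => normc (k i x))) _.
    by rewrite ler_wpM2l.
move=> h; have sS := sqr_sqrtr S0; have sC := sqr_sqrtr C0.
have := sqrtr_ge0 S; have := sqrtr_ge0 C.
set x := Num.sqrt S in h sS *; set y := Num.sqrt C in h sC * => y0 x0.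
rewrite -sS -sC -exprMn ler_pXn2r ?nnegrE ?mulr_ge0//.
(* The inequality S <= sqrt S sqrt C N is divided by sqrt S, unless S = 0. *)
move: h; rewrite -sS; have [->|xn0] := eqVneq x 0; first by rewrite mulr_ge0.
have xp : 0 < x by rewrite lt_neqAle eq_sym xn0.
by rewrite -mulrA expr2 ler_pM2l// mulrC.
Qed.

End SliceBound.

(** * The image of the kernel under T *)

Section TmapKernel.
Context {R : realType} {G : topGroupType}.
Hypothesis scG : @second_countable G.
Variable mu : {sigma_finite_measure set (borel G) -> \bar R}.
Hypothesis haar_mu : left_haar mu.
Local Notation mu2 := (mu \x mu)%E.
Local Notation mu3 := ((mu \x mu) \x mu)%E.
Local Notation G2 := (borel G * borel G)%type.
Local Notation G3 := (borel G * borel G * borel G)%type.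

(** At fixed first factor the product is a left translation of the second. *)
Lemma ae_mulg2 (P : borel G -> Prop) : (\forall x \ae mu, P x) ->
  \forall z \ae mu2, P (z.1 * z.2)%g.
Proof.
move=> [N [mN N0 sN]].
have aeN : \forall x \ae mu, ~ N x by exists N; split => // x /= /contrapT.
have mQ : measurable [set z : G2 | ~ N (z.1 * z.2)%g].
  exact: (measurable_preimage_fun (measurable_mulg scG) (measurableC mN)).
apply: (@ae_mono _ _ _ _ (fun z : G2 => ~ N (z.1 * z.2)%g)).
  by move=> z h; apply: contrapT => nP; apply: h; exact: sN.
by apply: (ae_prod1 mu mu mQ).2; apply: aeW => s; exact: (ae_mulgl scG haar_mu s aeN).
Qed.

Lemma measurable_mulg_op : measurable_fun setT (fun z : G2 => (z.2 * z.1)%g : borel G).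
Proof. by apply: measurable_mulg_fun. Qed.

(** Fubini's theorem is applied in the other order, so that again only left translations occur. *)
Lemma ae_mulg2_op (P : borel G -> Prop) : (\forall x \ae mu, P x) ->
  \forall z \ae mu2, P (z.2 * z.1)%g.
Proof.
move=> [N [mN N0 sN]].
have aeN : \forall x \ae mu, ~ N x by exists N; split => // x /= /contrapT.
have mQ : measurable [set z : G2 | ~ N (z.2 * z.1)%g].
  exact: (measurable_preimage_fun measurable_mulg_op (measurableC mN)).
apply: (@ae_mono _ _ _ _ (fun z : G2 => ~ N (z.2 * z.1)%g)).
  by move=> z h; apply: contrapT => nP; apply: h; exact: sN.
by apply: (ae_prod2 mu mu mQ).2; apply: aeW => s; exact: (ae_mulgl scG haar_mu s aeN).
Qed.

Variables (a b a' b' : nat -> borel G -> R[i]) (C D : R).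
Hypotheses (aoo : forall i, Linf mu (a i)) (boo : forall i, Linf mu (b i)).
Hypotheses (ha : l2_le a' C) (hb : l2_le b' D).
Hypotheses (aa' : \forall s \ae mu, forall i, a i s = a' i s).
Hypotheses (bb' : \forall s \ae mu, forall i, b i s = b' i s).

Definition translated_kernel (x : G3) : R[i] :=
  kernel a' b' (x.1.1 * x.1.2, x.2 * x.1.2)%g.

Let H := translated_kernel.

Lemma measurable_translated_pair : measurable_fun setT
  (fun x : G3 => ((x.1.1 * x.1.2)%g, (x.2 * x.1.2)%g) : G2).
Proof.
have m1 : measurable_fun setT (fun x : G3 => x.1.1 : borel G).
  by apply: (measurableT_comp measurable_fst).
have m2 : measurable_fun setT (fun x : G3 => x.1.2 : borel G).
  by apply: (measurableT_comp measurable_snd).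
have m3 : measurable_fun setT (fun x : G3 => x.2 : borel G) by exact: measurable_snd.
by apply: measurable_fun_pair; exact: measurable_mulg_fun.
Qed.

Lemma cmeasurable_translated_kernel : cmeasurable H.
Proof. exact: (cmeasurable_comp (cmeasurable_kernel ha hb) measurable_translated_pair). Qed.

Lemma translated_kernel_Linf : Linf mu3 H.
Proof.
apply: (bounded_Linf _ cmeasurable_translated_kernel) => x.
exact: (kernel_le ha hb).
Qed.

Lemma Gamma_ae_l2_le : ae_l2_le mu2 (fun i => Gamma (a i)) C.
Proof.
have [C0 ma aC] := ha.
have h := ae_mulg2 aa'.
split=> [i|].
  apply/LinfP; split.
    by apply: (cmeasurable_comp _ (measurable_mulg scG)); case: (aoo i).
  exists (Num.sqrt C); first exact: sqrtr_ge0.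
  by apply: ae_mono h => z hz; rewrite /Gamma hz; exact: l2_le_normc ha.
by apply: ae_mono h => z hz n; rewrite /Gamma; under eq_bigr do rewrite hz.
Qed.

Lemma Gamma_op_ae_l2_le : ae_l2_le mu2 (fun i => Gamma_op (b i)) D.
Proof.
have [D0 mb bD] := hb.
have h := ae_mulg2_op bb'.
split=> [i|].
  apply/LinfP; split.
    by apply: (cmeasurable_comp _ measurable_mulg_op); case: (boo i).
  exists (Num.sqrt D); first exact: sqrtr_ge0.
  by apply: ae_mono h => z hz; rewrite /Gamma_op hz; exact: l2_le_normc hb.
by apply: ae_mono h => z hz n; rewrite /Gamma_op; under eq_bigr do rewrite hz.
Qed.

Let u := haagerup_map (R := R) Gamma Gamma_op (haagerup_sum a b).

Lemma Gamma_sum_normal : normal_haagerup mu2 mu2 u.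
Proof.
have [C0 _ _] := ha; have [D0 _ _] := hb.
exact: (haagerup_sum_normal C0 D0 Gamma_ae_l2_le Gamma_op_ae_l2_le).
Qed.

(** The common formula for the left slice of [Gamma k] and the right slice of [Gamma_op k]. *)
Definition right_slice (k f : borel G -> R[i]) (t : borel G) : R[i] :=
  cintegral mu (fun s => k (s * t)%g * f s).

(** The equality holds at every [t], because right translation by each [t] preserves null sets. It
    can therefore be rewritten under an arbitrary form, on which nothing is assumed. *)
Lemma slice_left_Gamma f i : L1 mu f ->
  slice_left mu f (Gamma (a i)) = right_slice (a' i) f.
Proof.
move=> [mf _]; apply/funext => t; rewrite /slice_left /right_slice /Gamma/=.
have ma : cmeasurable (a i) by case: (aoo i).
have ma' : cmeasurable (a' i) by case: ha.
apply: ae_eq_cintegral.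
- by apply: cmeasurableM => //; exact: (cmeasurable_comp ma (measurable_mulgr scG t)).
- by apply: cmeasurableM => //; exact: (cmeasurable_comp ma' (measurable_mulgr scG t)).
- by apply: ae_mono (ae_mulgr scG haar_mu t aa') => s ->; rewrite mulrC.
Qed.

Lemma slice_right_Gamma_op g i : L1 mu g ->
  slice_right mu g (Gamma_op (b i)) = right_slice (b' i) g.
Proof.
move=> [mg _]; apply/funext => t; rewrite /slice_right /right_slice /Gamma_op/=.
have mb : cmeasurable (b i) by case: (boo i).
have mb' : cmeasurable (b' i) by case: hb.
apply: ae_eq_cintegral.
- by apply: cmeasurableM => //; exact: (cmeasurable_comp mb (measurable_mulgr scG t)).
- by apply: cmeasurableM => //; exact: (cmeasurable_comp mb' (measurable_mulgr scG t)).
- by apply: ae_mono (ae_mulgr scG haar_mu t bb') => s ->.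
Qed.

Lemma right_slice_l2_le (k : nat -> borel G -> R[i]) (K : R) f : l2_le k K -> L1 mu f ->
  l2_le (fun i => right_slice (k i) f) ((fine (\int[mu]_x (normc (f x))%:E)%E) ^+ 2 * K).
Proof.
move=> hk f1; have [K0 mk kK] := hk; split.
- by rewrite mulr_ge0// sqr_ge0.
- move=> i; apply: (@cmeasurable_cintegral _ _ _ _ _ mu (fun z : G2 => k i (z.2 * z.1)%g * f z.2)).
  apply: cmeasurableM; first exact: (cmeasurable_comp (mk i) measurable_mulg_op).
  by apply: (cmeasurable_comp _ (@measurable_snd _ _ _ _)); case: f1.
- move=> t n; have hkt : l2_le (fun i (s : borel G) => k i (s * t)%g) K.
    exact: (l2_le_comp (measurable_mulgr scG t) hk).
  by rewrite /right_slice; exact: (slice_l2 n hkt f1).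
Qed.

Lemma l2_le_Linf (k : nat -> borel G -> R[i]) K i : l2_le k K -> Linf mu (k i).
Proof.
move=> hk; apply: (@bounded_Linf _ _ _ _ _ (Num.sqrt K)); first by case: hk.
by move=> x; exact: l2_le_normc hk.
Qed.

Lemma ae_l2_le_l2_le (k : nat -> borel G -> R[i]) K : l2_le k K -> ae_l2_le mu k K.
Proof.
move=> hk; split; first by move=> i; exact: l2_le_Linf hk.
by case: hk => _ _ kK; apply: aeW.
Qed.

(** Fubini's theorem: integration over the third variable gives the slice by [g], then over the
    first the slice by [f], and the middle variable remains. *)
Lemma pairing_tensor_term f w g i : L1 mu f -> L1 mu w -> L1 mu g ->
  dual_pairing mu3 (fun x : G3 => a' i (x.1.1 * x.1.2)%g * b' i (x.2 * x.1.2)%g)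
    (tensor3 f w g) =
  dual_pairing mu (fun t => right_slice (a' i) f t * right_slice (b' i) g t) w.
Proof.
move=> f1 w1 g1.
have [C0 ma aC] := ha; have [D0 mb bD] := hb.
have hal := right_slice_l2_le ha f1; have hbe := right_slice_l2_le hb g1.
have m1 : measurable_fun setT (fun x : G3 => (x.1.1 * x.1.2)%g : borel G).
  exact: (measurableT_comp measurable_fst measurable_translated_pair).
have m2 : measurable_fun setT (fun x : G3 => (x.2 * x.1.2)%g : borel G).
  exact: (measurableT_comp measurable_snd measurable_translated_pair).
have L3 : L1 mu3 (fun x : G3 => (a' i (x.1.1 * x.1.2)%g * b' i (x.2 * x.1.2)%g) *
    tensor3 f w g x).
  apply: (@L1_bounded_mul _ _ _ _ _ _ (Num.sqrt C * Num.sqrt D)).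
  - apply: cmeasurableM; first exact: (cmeasurable_comp (ma i) m1).
    exact: (cmeasurable_comp (mb i) m2).
  - move=> x; rewrite Normc.normcM ler_pM ?normc_ge0//.
      exact: l2_le_normc ha.
    exact: l2_le_normc hb.
  - exact: L1_tensor3.
rewrite /dual_pairing cFubini12_3//.
have E1 (z : G2) : cintegral mu (fun r => (a' i (z.1 * z.2)%g * b' i (r * z.2)%g) *
      tensor3 f w g (z, r)) =
    (a' i (z.1 * z.2)%g * right_slice (b' i) g z.2) * (f z.1 * w z.2).
  rewrite /right_slice -mulrA [X in _ = _ * X]mulrC mulrA -cintegralZ.
    by apply: eq_cintegral => r; rewrite /tensor3/=; ring.
  apply: (@L1_bounded_mul _ _ _ _ _ _ (Num.sqrt D)) => //.
    exact: (cmeasurable_comp (mb i) (measurable_mulgr scG z.2)).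
  by move=> r; exact: l2_le_normc hb.
rewrite (eq_cintegral _ E1) cFubini2; last first.
  apply: (@L1_bounded_mul _ _ _ _ (fun z : G2 => a' i (z.1 * z.2)%g * right_slice (b' i) g z.2)
     (fun z => f z.1 * w z.2)
     (Num.sqrt C * Num.sqrt ((fine (\int[mu]_x (normc (g x))%:E)%E) ^+ 2 * D))).
  - apply: cmeasurableM; first exact: (cmeasurable_comp (ma i) (measurable_mulg scG)).
    by apply: (cmeasurable_comp _ (@measurable_snd _ _ _ _)); case: hbe.
  - move=> x; rewrite Normc.normcM ler_pM ?normc_ge0//.
      exact: l2_le_normc ha.
    exact: l2_le_normc hbe.
  - exact: L1_tensor.
apply: eq_cintegral => t /=; rewrite -mulrA [RHS]mulrC /right_slice -cintegralZ.
  by apply: eq_cintegral => s; ring.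
apply: (@L1_bounded_mul _ _ _ _ _ _ (Num.sqrt C)) => //.
  exact: (cmeasurable_comp (ma i) (measurable_mulgr scG t)).
by move=> s; exact: l2_le_normc ha.
Qed.

(** The partial sums of the kernel are uniformly bounded, so dominated convergence reduces to single
    terms. *)
Lemma pairing_translated_kernel f w g : L1 mu f -> L1 mu w -> L1 mu g ->
  dual_pairing mu3 H (tensor3 f w g) =
  csum (fun i => dual_pairing mu
    (fun t => right_slice (a' i) f t * right_slice (b' i) g t) w).
Proof.
move=> f1 w1 g1; apply/esym; apply: ccvg_csum.
have [C0 ma aC] := ha; have [D0 mb bD] := hb.
have m1 : measurable_fun setT (fun x : G3 => (x.1.1 * x.1.2)%g : borel G).
  exact: (measurableT_comp measurable_fst measurable_translated_pair).
have m2 : measurable_fun setT (fun x : G3 => (x.2 * x.1.2)%g : borel G).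
  exact: (measurableT_comp measurable_snd measurable_translated_pair).
have fwg1 : L1 mu3 (tensor3 f w g) by exact: L1_tensor3.
have mterm i : cmeasurable (fun x : G3 => a' i (x.1.1 * x.1.2)%g * b' i (x.2 * x.1.2)%g).
  apply: cmeasurableM; first exact: (cmeasurable_comp (ma i) m1).
  exact: (cmeasurable_comp (mb i) m2).
have Lterm i : L1 mu3 (fun x : G3 => (a' i (x.1.1 * x.1.2)%g * b' i (x.2 * x.1.2)%g) *
    tensor3 f w g x).
  apply: (@L1_bounded_mul _ _ _ _ _ _ (Num.sqrt C * Num.sqrt D)) => //.
  move=> x; rewrite Normc.normcM ler_pM ?normc_ge0//.
    exact: l2_le_normc ha.
  exact: l2_le_normc hb.
pose F n (x : G3) := (\sum_(i < n) a' i (x.1.1 * x.1.2)%g * b' i (x.2 * x.1.2)%g) *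
    tensor3 f w g x.
have -> : (fun n => \sum_(i < n) dual_pairing mu
    (fun t => right_slice (a' i) f t * right_slice (b' i) g t) w) =
    (fun n => cintegral mu3 (F n)).
  apply/funext => n; rewrite /F.
  rewrite (eq_cintegral _ (g := fun x : G3 => \sum_(i < n)
    (a' i (x.1.1 * x.1.2)%g * b' i (x.2 * x.1.2)%g) * tensor3 f w g x)); last first.
    by move=> x; rewrite mulr_suml.
  rewrite cintegral_sum//; apply: eq_bigr => i _.
  by rewrite -pairing_tensor_term.
apply: (@cdominated_convergence _ _ _ _ _ _
  (fun x => Num.sqrt C * Num.sqrt D * normc (tensor3 f w g x))).
- move=> n; apply: cmeasurableM; last by case: fwg1.
  by apply: cmeasurable_sum => i _.
- apply: cmeasurableM; first exact: cmeasurable_translated_kernel.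
  by case: fwg1.
- apply: aeW => x; apply: ccvgM; last exact: ccvg_cst.
  exact: (kernel_cvg ha hb).
- by apply: integrableZ_EFin; exact: L1_normc.
- move=> n x; rewrite Normc.normcM ler_wpM2r ?normc_ge0//.
  exact: (kernel_partial_le ha hb).
Qed.

(** Slicing turns [u] into the sum of the tensors of [al i] and [be i], and multiplication restricts
    its kernel to the diagonal. This diagonal function satisfies the specification of
    [haagerup_mult], so the chosen function does too, and the specification is the required
    identity. *)
Lemma haagerup_mult_slices f w g : L1 mu f -> L1 mu w -> L1 mu g ->
  dual_pairing mu
    (haagerup_mult mu (haagerup_map (slice_left mu f) (slice_right mu g) u)) w =
  csum (fun i => dual_pairing mu
    (fun t => right_slice (a' i) f t * right_slice (b' i) g t) w).
Proof.
move=> f1 w1 g1.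
pose al i := right_slice (a' i) f; pose be i := right_slice (b' i) g.
have hal : l2_le al _ := right_slice_l2_le ha f1.
have hbe : l2_le be _ := right_slice_l2_le hb g1.
set C1 := _ * C in hal; set D1 := _ * D in hbe.
have [C10 mal alC] := hal; have [D10 mbe beD] := hbe.
have uE : haagerup_map (slice_left mu f) (slice_right mu g) u = haagerup_sum al be.
  apply/funext => F; rewrite /u /haagerup_map /haagerup_sum; congr csum.
  by apply/funext => i; rewrite slice_left_Gamma// slice_right_Gamma_op.
rewrite uE.
set S := [set c | [/\ normal_haagerup mu mu (haagerup_sum al be), Linf mu c &
    forall w, L1 mu w -> dual_pairing mu c w =
      haagerup_sum al be (fun a b => dual_pairing mu (a * b) w)]].
suff : S (haagerup_mult mu (haagerup_sum al be)) by move=> [_ _ ->].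
suff SK : S (fun t => kernel al be (t, t)).
  by rewrite /haagerup_mult; exact: (xgetI _ SK).
split.
- exact: (haagerup_sum_normal C10 D10 (ae_l2_le_l2_le hal) (ae_l2_le_l2_le hbe)).
- apply: (@bounded_Linf _ _ _ _ _ (Num.sqrt C1 * Num.sqrt D1)).
    apply: (cmeasurable_comp (cmeasurable_kernel hal hbe)).
    exact: measurable_fun_pair.
  by move=> t; exact: (kernel_le hal hbe).
move=> v v1; rewrite /haagerup_sum; apply/esym; apply: ccvg_csum.
have mterm i : cmeasurable (fun t => al i t * be i t) by exact: cmeasurableM.
have Lterm i : L1 mu (fun t => (al i t * be i t) * v t).
  apply: (@L1_bounded_mul _ _ _ _ _ _ (Num.sqrt C1 * Num.sqrt D1)) => //.
  move=> x; rewrite Normc.normcM ler_pM ?normc_ge0//.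
    exact: l2_le_normc hal.
  exact: l2_le_normc hbe.
pose F n t := (\sum_(i < n) al i t * be i t) * v t.
have -> : (fun n => \sum_(i < n) dual_pairing mu (al i * be i) v) =
    (fun n => cintegral mu (F n)).
  apply/funext => n; rewrite /F.
  rewrite (eq_cintegral _ (g := fun t => \sum_(i < n) (al i t * be i t) * v t)); last first.
    by move=> x; rewrite mulr_suml.
  by rewrite cintegral_sum.
apply: (@cdominated_convergence _ _ _ _ _ _
  (fun x => Num.sqrt C1 * Num.sqrt D1 * normc (v x))).
- move=> n; apply: cmeasurableM; last by case: v1.
  by apply: cmeasurable_sum => i _.
- apply: cmeasurableM; last by case: v1.
  apply: (cmeasurable_comp (cmeasurable_kernel hal hbe)).
  exact: measurable_fun_pair.
- apply: aeW => x; apply: ccvgM; last exact: ccvg_cst.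
  exact: (kernel_cvg hal hbe).
- by apply: integrableZ_EFin; exact: L1_normc.
- move=> n x; rewrite Normc.normcM ler_wpM2r ?normc_ge0//.
  exact: (kernel_partial_le hal hbe).
Qed.

(** [translated_kernel] meets the specification of [Tmap]; two functions meeting it have the same
    pairings with all elementary tensors and agree almost everywhere. *)
Lemma Tmap_Linf_ae : Linf mu3 (Tmap mu u) /\ (Tmap mu u = H %[ae mu3]).
Proof.
set S := [set h | [/\ normal_haagerup mu2 mu2 u, Linf mu3 h &
    forall f w g, L1 mu f -> L1 mu w -> L1 mu g ->
      dual_pairing mu3 h (tensor3 f w g) =
      dual_pairing mu
        (haagerup_mult mu (haagerup_map (slice_left mu f) (slice_right mu g) u)) w]].
have SH : S H.
  split; [exact: Gamma_sum_normal|exact: translated_kernel_Linf|].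
  by move=> f w g f1 w1 g1; rewrite pairing_translated_kernel// haagerup_mult_slices.
have [_ Too TE] : S (Tmap mu u) by rewrite /Tmap; exact: (xgetI _ SH).
have [_ Hoo HE] := SH.
split => //.
have : \forall x \ae mu3, Tmap mu u x - H x = 0.
  apply: Linf_tensor3_eq0.
    have := LinfD Too (LinfZ (-1) Hoo); congr Linf.
    by apply/funext => x; rewrite mulN1r.
  move=> f w g f1 w1 g1.
  rewrite dual_pairingB//; last exact: L1_tensor3.
  by rewrite [X in X - _](TE f w g)// [X in _ - X](HE f w g)// subrr.
by apply: ae_mono => x /subr0_eq ? _.
Qed.

End TmapKernel.

(** * Bounded operators and Schur multiplication *)

Section SquareIntegrable.
Context {R : realType} d {T : measurableType d}.
Variable mu : {measure set T -> \bar R}.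
Implicit Types (f g h : T -> R[i]).

Lemma ae_eq_sqnorm f g : cmeasurable f -> cmeasurable g ->
  (\forall x \ae mu, f x = g x) -> sqnorm mu f = sqnorm mu g.
Proof.
move=> mf mg fg; apply: ge0_ae_eq_integral => //; try exact: cmeasurable_sqr.
- by move=> x _; rewrite lee_fin sqr_ge0.
- by move=> x _; rewrite lee_fin sqr_ge0.
- by apply: ae_mono fg => x ->.
Qed.

Lemma le_sqnorm f g (M : R) : cmeasurable f -> cmeasurable g -> 0 <= M ->
  (forall x, normc (f x) <= M * normc (g x)) ->
  (sqnorm mu f <= (M ^+ 2)%:E * sqnorm mu g)%E.
Proof.
move=> mf mg M0 fg; rewrite /sqnorm -ge0_integralZl//; first last.
- by rewrite lee_fin sqr_ge0.
- by move=> x _; rewrite lee_fin sqr_ge0.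
- exact: cmeasurable_sqr.
apply: ge0_le_integral => //.
- by move=> x _; rewrite lee_fin sqr_ge0.
- exact: cmeasurable_sqr.
- by apply: measurable_funeM; exact: cmeasurable_sqr.
- move=> x _; rewrite -EFinM lee_fin -exprMn ler_pXn2r ?nnegrE ?normc_ge0//.
  by rewrite mulr_ge0 ?normc_ge0.
Qed.

Lemma sqnormZ c f : cmeasurable f ->
  (sqnorm mu (fun x => c * f x)%R = (normc c ^+ 2)%:E * sqnorm mu f)%E.
Proof.
move=> mf; rewrite /sqnorm -ge0_integralZl//; first last.
- by rewrite lee_fin sqr_ge0.
- by move=> x _; rewrite lee_fin sqr_ge0.
- exact: cmeasurable_sqr.
by apply: eq_integral => x _; rewrite Normc.normcM exprMn EFinM.
Qed.

Lemma sqnormD_le f g : cmeasurable f -> cmeasurable g ->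
  (sqnorm mu (fun x => f x + g x)%R <= 2%:E * (sqnorm mu f + sqnorm mu g))%E.
Proof.
move=> mf mg; rewrite /sqnorm -ge0_integralD//; try exact: cmeasurable_sqr;
  try by move=> x _; rewrite lee_fin sqr_ge0.
rewrite -ge0_integralZl//; first last.
- by move=> x _; rewrite -EFinD lee_fin addr_ge0 ?sqr_ge0.
- by apply: emeasurable_funD; exact: cmeasurable_sqr.
apply: ge0_le_integral => //.
- by move=> x _; rewrite lee_fin sqr_ge0.
- by apply: cmeasurable_sqr; exact: cmeasurableD.
- by apply: measurable_funeM; apply: emeasurable_funD; exact: cmeasurable_sqr.
move=> x _; rewrite -EFinD -EFinM lee_fin.
apply: (@le_trans _ _ ((normc (f x) + normc (g x)) ^+ 2)).
  by rewrite ler_pXn2r ?nnegrE ?addr_ge0 ?normc_ge0// le_normcD.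
have := sqr_ge0 (normc (f x) - normc (g x)); rewrite sqrrB sqrrD; lra.
Qed.

Lemma L2_Z c f : L2 mu f -> L2 mu (fun x => c * f x).
Proof.
move=> [mf f2]; split; first exact: cmeasurableZ.
by rewrite sqnormZ// lte_mul_pinfty// lee_fin sqr_ge0.
Qed.

Lemma L2_D f g : L2 mu f -> L2 mu g -> L2 mu (fun x => f x + g x).
Proof.
move=> [mf f2] [mg g2]; split; first exact: cmeasurableD.
apply: le_lt_trans (sqnormD_le mf mg) _.
by rewrite lte_mul_pinfty// lte_add_pinfty.
Qed.

Lemma L2_0 : L2 mu (fun=> 0).
Proof.
split; first exact: cmeasurable_cst.
by rewrite [sqnorm _ _](sqnorm0 mu) ltry.
Qed.

Lemma L2_bounded_mul h f (M : R) : cmeasurable h -> 0 <= M ->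
  (forall x, normc (h x) <= M) -> L2 mu f -> L2 mu (fun x => h x * f x).
Proof.
move=> mh M0 hM [mf f2]; split; first exact: cmeasurableM.
apply: (@le_lt_trans _ _ ((M ^+ 2)%:E * sqnorm mu f)%E).
  apply: le_sqnorm => //; first exact: cmeasurableM.
  by move=> x; rewrite Normc.normcM ler_wpM2r ?normc_ge0.
by rewrite lte_mul_pinfty// lee_fin sqr_ge0.
Qed.

Lemma ae_eq_L2 f g : cmeasurable g -> (\forall x \ae mu, f x = g x) ->
  L2 mu f -> L2 mu g.
Proof. by move=> mg fg [mf f2]; split => //; rewrite -(ae_eq_sqnorm mf mg fg). Qed.

Lemma sqnorm_eq0 f : cmeasurable f -> sqnorm mu f = 0%E -> \forall x \ae mu, f x = 0.
Proof.
move=> mf f0.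
have /ae_eq_integral_abs := cmeasurable_sqr mf.
move=> /(_ mu measurableT)[h _].
have : (\int[mu]_x `|(normc (f x) ^+ 2)%:E| = 0)%E.
  by rewrite -f0; apply: eq_integral => x _; rewrite gee0_abs// lee_fin sqr_ge0.
move=> /h; apply: ae_mono => x /(_ I)[/eqP].
by rewrite sqrf_eq0 => /eqP /Normc.eq0_normc.
Qed.

Lemma L1_inner f g : L2 mu f -> L2 mu g -> L1 mu (fun x => f x * (g x)^*%C).
Proof.
move=> [mf f2] [mg g2].
apply: (@le_L1 _ _ _ _ _ (fun x => 2^-1 * (normc (f x) ^+ 2 + normc (g x) ^+ 2))).
- by apply: cmeasurableM => //; exact: cmeasurable_conj.
- apply: integrableZ_EFin; apply: integrableD_EFin; apply/integrableP; split.
  + exact: cmeasurable_sqr.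
  + by under eq_integral do rewrite gee0_abs ?lee_fin ?sqr_ge0//.
  + exact: cmeasurable_sqr.
  + by under eq_integral do rewrite gee0_abs ?lee_fin ?sqr_ge0//.
- move=> x; rewrite Normc.normcM normc_conj.
  have := sqr_ge0 (normc (f x) - normc (g x)); rewrite sqrrB; lra.
Qed.

(** A crude form of the Cauchy-Schwarz inequality, sufficient for summability. *)
Lemma normc_inner_le f g : L2 mu f -> L2 mu g ->
  ((normc (inner_product mu f g))%:E <= sqnorm mu f + sqnorm mu g)%E.
Proof.
move=> f2 g2; have L := L1_inner f2 g2.
apply: le_trans (normc_cintegral L) _.
rewrite /sqnorm -ge0_integralD//; try by move=> x _; rewrite lee_fin sqr_ge0.
- apply: ge0_le_integral => //.
  + by move=> x _; rewrite lee_fin normc_ge0.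
  + by apply/measurable_EFinP; apply: cmeasurable_normc; case: L.
  + by apply: emeasurable_funD; apply: cmeasurable_sqr; [case: f2|case: g2].
  + move=> x _; rewrite -EFinD lee_fin Normc.normcM normc_conj.
    have := sqr_ge0 (normc (f x) - normc (g x)); rewrite sqrrB.
    have := sqr_ge0 (normc (f x)); have := sqr_ge0 (normc (g x)); lra.
- by apply: cmeasurable_sqr; case: f2.
- by apply: cmeasurable_sqr; case: g2.
Qed.

Lemma innerD f g h : L2 mu f -> L2 mu g -> L2 mu h ->
  inner_product mu (fun x => f x + g x) h = inner_product mu f h + inner_product mu g h.
Proof.
move=> f2 g2 h2; rewrite /inner_product -cintegralD; try exact: L1_inner.
by apply: eq_cintegral => x; rewrite mulrDl.
Qed.

Lemma innerZ c f h : L2 mu f -> L2 mu h ->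
  inner_product mu (fun x => c * f x) h = c * inner_product mu f h.
Proof.
move=> f2 h2; rewrite /inner_product -cintegralZ; last exact: L1_inner.
by apply: eq_cintegral => x; rewrite mulrA.
Qed.

Lemma inner_sum I (r : seq I) (F : I -> T -> R[i]) h : (forall i, L2 mu (F i)) ->
  L2 mu h -> inner_product mu (fun x => \sum_(i <- r) F i x) h =
  \sum_(i <- r) inner_product mu (F i) h.
Proof.
move=> F2 h2; rewrite /inner_product -cintegral_sum; last by move=> i; exact: L1_inner.
by apply: eq_cintegral => x; rewrite mulr_suml.
Qed.

Lemma inner_conj f g : L2 mu f -> L2 mu g ->
  inner_product mu g f = (inner_product mu f g)^*%C.
Proof.
move=> f2 g2; rewrite /inner_product -cintegral_conj; last exact: L1_inner.
by apply: eq_cintegral => x; rewrite rmorphM/= conjcK mulrC.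
Qed.

Lemma inner_ae_eq f g f' g' : cmeasurable f -> cmeasurable g -> cmeasurable f' ->
  cmeasurable g' -> (\forall x \ae mu, f x = f' x) -> (\forall x \ae mu, g x = g' x) ->
  inner_product mu f g = inner_product mu f' g'.
Proof.
move=> mf mg mf' mg' ff' gg'; apply: ae_eq_cintegral.
- by apply: cmeasurableM => //; exact: cmeasurable_conj.
- by apply: cmeasurableM => //; exact: cmeasurable_conj.
- by apply: (ae_mono2 _ ff' gg') => x -> ->.
Qed.

Lemma inner0r f : inner_product mu f (fun=> 0) = 0.
Proof.
rewrite /inner_product -[RHS](cintegral0 mu); apply: eq_cintegral => x.
by rewrite rmorph0 mulr0.
Qed.

Lemma inner0l f : inner_product mu (fun=> 0) f = 0.
Proof.
rewrite /inner_product -[RHS](cintegral0 mu); apply: eq_cintegral => x.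
by rewrite mul0r.
Qed.

(** Tested on h = f - g itself, whose [sqnorm] then vanishes. *)
Lemma inner_eq f g : L2 mu f -> L2 mu g ->
  (forall h, L2 mu h -> inner_product mu f h = inner_product mu g h) ->
  \forall x \ae mu, f x = g x.
Proof.
move=> f2 g2 fg.
pose h x := f x + (-1) * g x.
have h2 : L2 mu h by apply: L2_D => //; exact: L2_Z.
have h0 : inner_product mu h h = 0.
  by rewrite innerD ?innerZ ?fg//; [rewrite mulN1r subrr|exact: L2_Z].
have : sqnorm mu h = 0%E.
  have mh2 : cmeasurable h by case: h2.
  move: h0; rewrite /inner_product (eq_cintegral _ (g := fun x => (normc (h x) ^+ 2)%:C)).
    move=> [+ _]; rewrite /Rintegral => hr.
    rewrite -[LHS]fineK ?hr// ge0_fin_numE; first by case: h2.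
    exact: sqnorm_ge0.
  by move=> x; exact: mul_conj.
move/sqnorm_eq0 => /(_ h2.1); apply: ae_mono => x.
by rewrite /h mulN1r => /subr0_eq.
Qed.

End SquareIntegrable.

Section BoundedOperators.
Context {R : realType} d {T : measurableType d}.
Variable mu : {measure set T -> \bar R}.
Implicit Types (A B : (T -> R[i]) -> (T -> R[i])) (xi eta : nat -> T -> R[i]).

(** The difference of [f] and [g] has norm 0, hence so has its image, and [A] is linear almost
    everywhere. *)
Lemma bounded_operator_ae_eq A f g : bounded_operator mu A -> L2 mu f -> L2 mu g ->
  (\forall x \ae mu, f x = g x) -> \forall x \ae mu, A f x = A g x.
Proof.
move=> [A2 Alin [K K0 AK]] f2 g2 fg.
have h2 : L2 mu (- 1 *: g + f) by apply: L2_D => //; exact: L2_Z.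
have h0 : sqnorm mu (- 1 *: g + f) = 0%E.
  rewrite -[RHS](sqnorm0 mu); apply: ae_eq_sqnorm; [by case: h2|exact: cmeasurable_cst|].
  by apply: ae_mono fg => x fx; rewrite !fctE/= fx scaleN1r addNr.
have : sqnorm mu (A (- 1 *: g + f)) = 0%E.
  apply/eqP; rewrite eq_le sqnorm_ge0 andbT (le_trans (AK _ h2))//.
  by rewrite h0 mule0.
move/sqnorm_eq0 => /(_ (A2 _ h2).1) hA.
have hl := Alin (-1) g f g2 f2.
apply: (ae_mono2 _ hA hl) => x hx /(_ I).
by rewrite hx !fctE/= scaleN1r => /esym/eqP; rewrite addrC subr_eq0 => /eqP.
Qed.

Lemma square_summable_csummable A xi eta : bounded_operator mu A ->
  square_summable mu xi -> square_summable mu eta ->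
  csummable (fun k => inner_product mu (A (xi k)) (eta k)).
Proof.
move=> [A2 _ [K K0 AK]] [xi2 sxi] [eta2 seta].
apply: (@le_lt_trans _ _ (\sum_(0 <= k <oo)
    ((K ^+ 2)%:E * sqnorm mu (xi k) + sqnorm mu (eta k)))%E).
  apply: lee_nneseries => k *; first by rewrite lee_fin normc_ge0.
  apply: le_trans (normc_inner_le (A2 _ (xi2 k)) (eta2 k)) _.
  by rewrite leeD2r// AK.
rewrite nneseriesD; first last.
- by move=> *; exact: sqnorm_ge0.
- by move=> *; rewrite mule_ge0 ?sqnorm_ge0// lee_fin sqr_ge0.
rewrite nneseriesZl; last by move=> *; exact: sqnorm_ge0.
by rewrite lte_add_pinfty// lte_mul_pinfty// lee_fin sqr_ge0.
Qed.

Lemma normal_functional_lin c A B xi eta : bounded_operator mu A ->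
  bounded_operator mu B -> square_summable mu xi -> square_summable mu eta ->
  normal_functional mu xi eta (fun f => c *: A f + B f) =
  c * normal_functional mu xi eta A + normal_functional mu xi eta B.
Proof.
move=> bA bB sxi seta; rewrite /normal_functional -csumZ; last exact: square_summable_csummable.
rewrite -csumD; [|apply: csummableZ; exact: square_summable_csummable|
  exact: square_summable_csummable].
congr csum; apply/funext => k.
have [A2 _ _] := bA; have [B2 _ _] := bB.
have [xi2 _] := sxi; have [eta2 _] := seta.
have h := innerD (L2_Z c (A2 _ (xi2 k))) (B2 _ (xi2 k)) (eta2 k).
by rewrite [LHS]h innerZ//; exact: A2.
Qed.

Lemma square_summable_image A xi : bounded_operator mu A ->
  square_summable mu xi -> square_summable mu (fun k => A (xi k)).
Proof.
move=> [A2 _ [K K0 AK]] [xi2 sxi]; split; first by move=> k; exact: A2.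
apply: (@le_lt_trans _ _ (\sum_(0 <= k <oo) ((K ^+ 2)%:E * sqnorm mu (xi k)))%E).
  apply: lee_nneseries => k *; [exact: sqnorm_ge0|exact: AK].
rewrite nneseriesZl; last by move=> *; exact: sqnorm_ge0.
by rewrite lte_mul_pinfty// lee_fin sqr_ge0.
Qed.

Lemma bounded_operator_lin c A B : bounded_operator mu A -> bounded_operator mu B ->
  bounded_operator mu (fun f => c *: A f + B f).
Proof.
move=> [A2 Alin [K K0 AK]] [B2 Blin [L L0 BL]]; split.
- by move=> f f2; apply: L2_D; [apply: L2_Z; exact: A2|exact: B2].
- move=> e f g f2 g2; apply: (ae_mono2 _ (Alin e f g f2 g2) (Blin e f g f2 g2)) => x h1 h2 xT.
  rewrite !fctE/= [A _ x](h1 xT) [B _ x](h2 xT) !fctE/=.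
  by rewrite -![_ *: _]/(_ * _); ring.
pose N := 2 * ((normc c * K) ^+ 2 + L ^+ 2).
have N0 : 0 <= N by rewrite mulr_ge0// addr_ge0 ?sqr_ge0.
exists (Num.sqrt N); first exact: sqrtr_ge0.
move=> f f2; rewrite sqr_sqrtr//.
have mA : cmeasurable (A f) by case: (A2 f f2).
have mB : cmeasurable (B f) by case: (B2 f f2).
apply: le_trans (sqnormD_le _ (cmeasurableZ c mA) mB) _.
rewrite sqnormZ//.
have -> : (N%:E * sqnorm mu f = 2%:E * ((normc c ^+ 2)%:E * ((K ^+ 2)%:E * sqnorm mu f) +
    (L ^+ 2)%:E * sqnorm mu f))%E.
  rewrite /N EFinM -muleA; congr (_ * _)%E.
  by rewrite muleA -EFinM -exprMn -ge0_muleDl ?lee_fin ?sqr_ge0// EFinD.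
rewrite lee_wpmul2l// leeD//; last exact: BL.
by rewrite lee_wpmul2l ?lee_fin ?sqr_ge0// AK.
Qed.

Lemma bounded_operator_comp A B : bounded_operator mu A -> bounded_operator mu B ->
  bounded_operator mu (A \o B).
Proof.
move=> bA bB; have [A2 Alin [K K0 AK]] := bA; have [B2 Blin [L L0 BL]] := bB; split.
- by move=> f f2; apply: A2; exact: B2.
- move=> c f g f2 g2 /=.
  have h2 : L2 mu (c *: f + g) by apply: L2_D => //; exact: L2_Z.
  have k2 : L2 mu (c *: B f + B g) by apply: L2_D; [apply: L2_Z; exact: B2|exact: B2].
  have e : \forall x \ae mu, B (c *: f + g) x = (c *: B f + B g) x.
    by apply: ae_mono (Blin c f g f2 g2) => x; exact.
  apply: (ae_mono2 _ (bounded_operator_ae_eq bA (B2 _ h2) k2 e)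
    (Alin c _ _ (B2 f f2) (B2 g g2))) => x -> ; exact.
exists (K * L); first exact: mulr_ge0.
move=> f f2; apply: le_trans (AK _ (B2 f f2)) _.
have -> : (((K * L) ^+ 2)%:E * sqnorm mu f = (K ^+ 2)%:E * ((L ^+ 2)%:E * sqnorm mu f))%E.
  by rewrite exprMn EFinM muleA.
by rewrite lee_wpmul2l ?lee_fin ?sqr_ge0// BL.
Qed.

Lemma bounded_operator_0 : bounded_operator mu (fun _ => 0).
Proof.
split.
- by move=> f _; exact: L2_0.
- by move=> c f g _ _; apply: aeW => x _; rewrite scaler0 addr0.
- by exists 0 => // f _; rewrite sqnorm0 mule_ge0 ?sqnorm_ge0// lee_fin sqr_ge0.
Qed.

(** Makes the vector functional <A f, g> an instance of [normal_functional]. *)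
Definition single (f : T -> R[i]) (k : nat) : T -> R[i] := if k is 0%N then f else 0.

Lemma square_summable_single f : L2 mu f -> square_summable mu (single f).
Proof.
move=> f2; split; first by case=> [//|k]; exact: L2_0.
rewrite nneseries_recl//; last by move=> k *; exact: sqnorm_ge0.
by rewrite eseries0 ?adde0; [case: f2|move=> [//|k] _ _; exact: sqnorm0].
Qed.

Lemma csum_single (u : nat -> R[i]) : (forall k, u k.+1 = 0) -> csum u = u 0%N.
Proof.
move=> u0; apply: ccvg_csum; rewrite /ccvg.
apply: cvg_near_cst; exists 1%N => // -[//|n] _ /=.
by rewrite big_ord_recl big1 ?addr0 ?subrr ?Normc.normc0// => i _; exact: u0.
Qed.

Lemma normal_functional_single f g A :
  normal_functional mu (single f) (single g) A = inner_product mu (A f) g.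
Proof. by rewrite /normal_functional csum_single// => k; exact: inner0r. Qed.

End BoundedOperators.

(** * Schur multiplication of an operator *)

Section SchurOperator.
Context {R : realType} d {T : measurableType d}.
Variable mu : {measure set T -> \bar R}.
Variables (a b : nat -> T -> R[i]) (C D : R).
Hypotheses (ha : l2_le a C) (hb : l2_le b D).
Implicit Types (A : (T -> R[i]) -> (T -> R[i])) (f g : T -> R[i]).

Lemma mulop_L2 (c : nat -> T -> R[i]) E i f : l2_le c E -> L2 mu f ->
  L2 mu (mulop (c i) f).
Proof.
move=> hc f2; apply: (L2_bounded_mul (M := Num.sqrt E)) => //.
- by case: hc.
- by move=> x; exact: l2_le_normc hc.
Qed.

(** The column of the [c i] has norm at most the square root of [E]; sum and integral are exchanged
    by Tonelli's theorem. *)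
Lemma sum_sqnorm_mulop (c : nat -> T -> R[i]) E f : l2_le c E -> L2 mu f ->
  (\sum_(0 <= i <oo) sqnorm mu (mulop (c i) f) <= E%:E * sqnorm mu f)%E.
Proof.
move=> hc f2; have [E0 mc cE] := hc.
have mcf i : cmeasurable (mulop (c i) f) by case: (mulop_L2 i hc f2).
rewrite /sqnorm -integral_nneseries//; first last.
- by move=> i x _; rewrite lee_fin sqr_ge0.
- by move=> i; exact: cmeasurable_sqr.
rewrite -ge0_integralZl//; first last.
- by move=> x _; rewrite lee_fin sqr_ge0.
- by apply: cmeasurable_sqr; case: f2.
apply: ge0_le_integral => //.
- by move=> x _; apply: nneseries_ge0 => *; rewrite lee_fin sqr_ge0.
- by apply: ge0_emeasurable_sum => *; [rewrite lee_fin sqr_ge0|exact: cmeasurable_sqr].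
- by apply: measurable_funeM; apply: cmeasurable_sqr; case: f2.
move=> x _; rewrite -EFinM; apply: nneseries_lty_bound => [n|n]; first exact: sqr_ge0.
rewrite /mulop; under eq_bigr do rewrite Normc.normcM exprMn.
by rewrite -mulr_suml ler_wpM2r ?sqr_ge0.
Qed.

Definition square_sum A f (s : T) : \bar R :=
  (\sum_(0 <= i <oo) (normc (A (mulop (b i) f) s) ^+ 2)%:E)%E.

Definition finite_part A f : set T := [set s | (square_sum A f s < +oo)%E].

Definition cut A f i (s : T) : R[i] :=
  (\1_(finite_part A f) s : R)%:C * A (mulop (b i) f) s.

(* The almost everywhere convergent series \sum_i a_i A (b_i f), cut off where
   the square sum of the A (b_i f) diverges. *)
Definition schur_operator A f (s : T) : R[i] := csum (fun i => a i s * cut A f i s).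

Section Fixed.
Variables (A : (T -> R[i]) -> (T -> R[i])) (K : R).
Hypotheses (bA : bounded_operator mu A) (K0 : 0 <= K).
Hypothesis AK : forall f, L2 mu f -> (sqnorm mu (A f) <= (K ^+ 2)%:E * sqnorm mu f)%E.

Let A2 f : L2 mu f -> L2 mu (A f).
Proof. by case: bA => h _ _; exact: h. Qed.

Lemma term_L2 f i : L2 mu f -> L2 mu (A (mulop (b i) f)).
Proof. by move=> f2; apply: A2; exact: mulop_L2 hb f2. Qed.

Lemma square_sum_ge0 f s : (0 <= square_sum A f s)%E.
Proof. by apply: nneseries_ge0 => *; rewrite lee_fin sqr_ge0. Qed.

Lemma measurable_square_sum f : L2 mu f -> measurable_fun setT (square_sum A f).
Proof.
move=> f2; apply: ge0_emeasurable_sum => [i *|i *]; first by rewrite lee_fin sqr_ge0.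
by apply: cmeasurable_sqr; case: (term_L2 i f2).
Qed.

Lemma measurable_finite_part f : L2 mu f -> measurable (finite_part A f).
Proof.
move=> f2; have -> : finite_part A f = square_sum A f @^-1` `]-oo, +oo%E[%classic.
  by apply/seteqP; split => x /=; rewrite in_itv.
by rewrite -[X in measurable X]setTI; apply: measurable_square_sum => //; exact: emeasurable_itv.
Qed.

Lemma sum_sqnorm_term f : L2 mu f ->
  (\sum_(0 <= i <oo) sqnorm mu (A (mulop (b i) f)) <=
   (K ^+ 2 * D)%:E * sqnorm mu f)%E.
Proof.
move=> f2; apply: (@le_trans _ _ (\sum_(0 <= i <oo) ((K ^+ 2)%:E * sqnorm mu (mulop (b i) f)))%E).
  by apply: lee_nneseries => i *; [exact: sqnorm_ge0|apply: AK; exact: mulop_L2 hb f2].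
rewrite nneseriesZl; last by move=> *; exact: sqnorm_ge0.
rewrite [((K ^+ 2) * D)%:E]EFinM -muleA lee_wpmul2l ?lee_fin ?sqr_ge0//.
exact: sum_sqnorm_mulop hb f2.
Qed.

Lemma integral_square_sum f : L2 mu f ->
  (\int[mu]_s square_sum A f s = \sum_(0 <= i <oo) sqnorm mu (A (mulop (b i) f)))%E.
Proof.
move=> f2; rewrite /square_sum integral_nneseries//.
- by move=> i; apply: cmeasurable_sqr; case: (term_L2 i f2).
- by move=> i s _; rewrite lee_fin sqr_ge0.
Qed.

Lemma square_sum_lty f : L2 mu f -> (\int[mu]_s square_sum A f s < +oo)%E.
Proof.
move=> f2; rewrite integral_square_sum// (le_lt_trans (sum_sqnorm_term f2))//.
case: f2 => _ f2; rewrite lte_mul_pinfty// lee_fin mulr_ge0 ?sqr_ge0//.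
by case: hb.
Qed.

Lemma ae_finite_part f : L2 mu f -> \forall s \ae mu, finite_part A f s.
Proof.
move=> f2; have : mu.-integrable setT (square_sum A f).
  apply/integrableP; split; first exact: measurable_square_sum.
  by under eq_integral do rewrite gee0_abs ?square_sum_ge0//; exact: square_sum_lty.
move=> /integrable_ae h.
apply: ae_mono (h measurableT) => s /(_ I) hs.
by rewrite /finite_part/= ltey; move: hs; rewrite fin_numE => /andP[].
Qed.

Lemma cutE f i s : finite_part A f s -> cut A f i s = A (mulop (b i) f) s.
Proof. by move=> fs; rewrite /cut indicE mem_set// mul1r. Qed.

Lemma cut_sum_le f s n : \sum_(i < n) normc (cut A f i s) ^+ 2 <= fine (square_sum A f s).
Proof.
have [fs|fs] := pselect (finite_part A f s).
  under eq_bigr do rewrite cutE//.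
  rewrite -lee_fin fineK; last by rewrite ge0_fin_numE ?square_sum_ge0.
  by apply: le_sum_nneseries => i; exact: sqr_ge0.
rewrite big1; first by rewrite fine_ge0// square_sum_ge0.
by move=> i _; rewrite /cut indicE memNset// mul0r Normc.normc0 expr0n.
Qed.

Lemma cmeasurable_cut f i : L2 mu f -> cmeasurable (cut A f i).
Proof.
move=> f2; apply: cmeasurable_indic; first exact: measurable_finite_part.
by case: (term_L2 i f2).
Qed.

Lemma schur_sum_le f s n : \sum_(i < n) normc (a i s * cut A f i s) <=
  Num.sqrt C * Num.sqrt (fine (square_sum A f s)).
Proof.
have [C0 _ aC] := ha.
apply: (l2_prod_sum_le (u := fun i => a i s) (v := fun i => cut A f i s)) => //.
  by rewrite fine_ge0// square_sum_ge0.
by move=> m; exact: cut_sum_le.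
Qed.

Lemma schur_csummable f s : csummable (fun i => a i s * cut A f i s).
Proof. by apply: csummable_bound => n; exact: schur_sum_le. Qed.

Lemma cmeasurable_schur f : L2 mu f -> cmeasurable (schur_operator A f).
Proof.
move=> f2; apply: (@cmeasurable_csum _ _ _ (fun i s => a i s * cut A f i s)).
  by move=> i; apply: cmeasurableM; [case: ha|exact: cmeasurable_cut].
exact: schur_csummable.
Qed.

(** At almost every point the Cauchy-Schwarz inequality bounds the squared value by [C] times
    [square_sum], whose integral is at most [K ^+ 2 * D] times [sqnorm mu f]. *)
Lemma sqnorm_schur_le f : L2 mu f ->
  (sqnorm mu (schur_operator A f) <= (C * (K ^+ 2 * D))%:E * sqnorm mu f)%E.
Proof.
move=> f2; have [C0 _ _] := ha.
rewrite [(C * _)%:E]EFinM -muleA; apply: le_trans (lee_wpmul2l _ (sum_sqnorm_term f2)); last by rewrite lee_fin.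
rewrite -integral_square_sum// -ge0_integralZl//; first last.
- by move=> s _; exact: square_sum_ge0.
- exact: measurable_square_sum.
apply: ae_ge0_le_integral => //.
- by move=> s _; rewrite lee_fin sqr_ge0.
- by apply: cmeasurable_sqr; exact: cmeasurable_schur.
- by move=> s _; rewrite mule_ge0 ?lee_fin// square_sum_ge0.
- by apply: measurable_funeM; exact: measurable_square_sum.
apply: ae_mono (ae_finite_part f2) => s fs _.
have fq : (square_sum A f s) \is a fin_num by rewrite ge0_fin_numE ?square_sum_ge0.
rewrite -[square_sum A f s]fineK// -EFinM lee_fin.
have q0 : 0 <= fine (square_sum A f s) by rewrite fine_ge0// square_sum_ge0.
rewrite -[leRHS]sqr_sqrtr ?mulr_ge0// sqrtrM// ler_pXn2r ?nnegrE ?mulr_ge0 ?sqrtr_ge0 ?normc_ge0//.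
by apply: normc_csum_bound => n; exact: schur_sum_le.
Qed.

Lemma schur_L2 f : L2 mu f -> L2 mu (schur_operator A f).
Proof.
move=> f2; split; first exact: cmeasurable_schur.
apply: le_lt_trans (sqnorm_schur_le f2) _; case: f2 => _ f2.
have [C0 _ _] := ha; have [D0 _ _] := hb.
by rewrite lte_mul_pinfty// lee_fin !mulr_ge0.
Qed.

Lemma schur_bounded : bounded_operator mu (schur_operator A).
Proof.
have [C0 _ _] := ha; have [D0 _ _] := hb.
split; first exact: schur_L2.
- move=> c f g f2 g2.
  have h2 : L2 mu (c *: f + g) by apply: L2_D => //; exact: L2_Z.
  have [_ Alin _] := bA.
  have lin : \forall s \ae mu, forall i, A (mulop (b i) (c *: f + g)) s =
      c * A (mulop (b i) f) s + A (mulop (b i) g) s.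
    apply: ae_foralln => i.
    have -> : mulop (b i) (c *: f + g) = c *: mulop (b i) f + mulop (b i) g.
      by apply/funext => x; rewrite /mulop !fctE/= -![_ *: _]/(_ * _); ring.
    have := Alin c _ _ (mulop_L2 i hb f2) (mulop_L2 i hb g2).
    by apply: ae_mono => x /(_ I).
  (* Where all three square sums are finite, no cut is active and the series converge absolutely, so
     they can be added termwise. *)
  apply: (ae_mono2 _ lin (ae_and (ae_finite_part h2)
    (ae_and (ae_finite_part f2) (ae_finite_part g2)))).
  move=> s hs [fh [ff fg]] _; rewrite !fctE/= -![_ *: _]/(_ * _) /schur_operator.
  rewrite -csumZ; last exact: schur_csummable.
  rewrite -csumD; [|apply: csummableZ; exact: schur_csummable|exact: schur_csummable].
  by congr csum; apply/funext => i; rewrite !cutE// hs; ring.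
- exists (Num.sqrt (C * (K ^+ 2 * D))); first exact: sqrtr_ge0.
  move=> f f2; rewrite sqr_sqrtr; first exact: sqnorm_schur_le.
  by rewrite !mulr_ge0.
Qed.

Lemma inner_schur f g : L2 mu f -> L2 mu g ->
  inner_product mu (schur_operator A f) g =
  csum (fun i => inner_product mu (A (mulop (b i) f)) (mulop (fun s => (a i s)^*%C) g)).
Proof.
move=> f2 g2; apply/esym; apply: ccvg_csum.
have [C0 ma aC] := ha.
have mcut i : cmeasurable (cut A f i) by exact: cmeasurable_cut.
have mg : cmeasurable g by case: g2.
have Lt i : L1 mu (fun s => (a i s * cut A f i s) * (g s)^*%C).
  apply: L1_inner => //.
  apply: (@ae_eq_L2 _ _ _ mu (fun s => a i s * A (mulop (b i) f) s)).
  - by apply: cmeasurableM => //; exact: ma.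
  - by apply: ae_mono (ae_finite_part f2) => s fs; rewrite cutE.
  - exact: (mulop_L2 i ha (term_L2 i f2)).
pose F n s := (\sum_(i < n) a i s * cut A f i s) * (g s)^*%C.
have -> : (fun n => \sum_(i < n) inner_product mu (A (mulop (b i) f))
    (mulop (fun s => (a i s)^*%C) g)) = (fun n => cintegral mu (F n)).
  apply/funext => n; rewrite /F (eq_cintegral _ (g := fun s =>
     \sum_(i < n) (a i s * cut A f i s) * (g s)^*%C)); last by move=> s; rewrite mulr_suml.
  rewrite cintegral_sum//; apply: eq_bigr => i _; apply: ae_eq_cintegral.
  - apply: cmeasurableM; first by case: (term_L2 i f2).
    by apply: cmeasurable_conj; apply: cmeasurableM => //; apply: cmeasurable_conj; exact: ma.
  - by case: (Lt i).
  - apply: ae_mono (ae_finite_part f2) => s fs.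
    have e : (mulop (fun t => (a i t)^*%C) g s)^*%C = a i s * (g s)^*%C.
      by rewrite /mulop rmorphM; congr (_ * _); exact: conjcK.
    rewrite cutE// [RHS](_ : _ = A (mulop (b i) f) s * (a i s * (g s)^*%C)); last by rewrite mulrCA mulrA.
    exact: congr1 e.
have mq : measurable_fun setT (fun s => fine (square_sum A f s)).
  exact: (measurableT_comp (fine_measurable measurableT) (measurable_square_sum f2)).
(* With q the value of [square_sum], the partial sums times g are at most sqrt (C q) |g|, hence at
   most C q + |g|^2, and q is integrable. *)
apply: (@cdominated_convergence _ _ _ _ _ _
  (fun s => C * fine (square_sum A f s) + normc (g s) ^+ 2)).
- move=> n; apply: cmeasurableM; last exact: cmeasurable_conj.
  by apply: cmeasurable_sum => i _; apply: cmeasurableM => //; exact: ma.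
- by apply: cmeasurableM; [exact: cmeasurable_schur|exact: cmeasurable_conj].
- apply: aeW => s; apply: ccvgM; last exact: ccvg_cst.
  exact: csum_cvg (schur_csummable f s).
- apply: integrableD_EFin.
    apply: integrableZ_EFin; apply/integrableP; split; first exact/measurable_EFinP.
    apply: le_lt_trans (square_sum_lty f2); apply: ge0_le_integral => //.
    + by apply/measurable_EFinP; exact: measurableT_comp.
    + exact: measurable_square_sum.
    + move=> s _; rewrite /= ger0_norm ?fine_ge0 ?square_sum_ge0//.
      have := square_sum_ge0 f s; case: (square_sum A f s) => //= *; exact: leey.
  apply/integrableP; split; first exact: cmeasurable_sqr.
  by under eq_integral do rewrite gee0_abs ?lee_fin ?sqr_ge0//; case: g2.
- move=> n s; rewrite Normc.normcM normc_conj.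
  have h1 : normc (\sum_(i < n) a i s * cut A f i s) <=
      Num.sqrt C * Num.sqrt (fine (square_sum A f s)).
    exact: le_trans (normc_sum _ _ _) (schur_sum_le f s n).
  have q0 : 0 <= fine (square_sum A f s) by rewrite fine_ge0// square_sum_ge0.
  apply: le_trans (ler_wpM2r (normc_ge0 _) h1) _.
  have -> : C * fine (square_sum A f s) =
      (Num.sqrt C * Num.sqrt (fine (square_sum A f s))) ^+ 2.
    by rewrite exprMn !sqr_sqrtr.
  set y := _ * Num.sqrt _; have := sqr_ge0 (y - normc (g s)); rewrite sqrrB.
  by have := sqr_ge0 y; have := sqr_ge0 (normc (g s)); lra.
Qed.

End Fixed.
End SchurOperator.

Lemma csum_sum {R : realType} (u : nat -> nat -> R[i]) n :
  (forall i, csummable (u i)) ->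
  csummable (fun k => \sum_(i < n) u i k) /\
  csum (fun k => \sum_(i < n) u i k) = \sum_(i < n) csum (u i).
Proof.
move=> su; elim: n => [|n [ih1 ih2]].
  under eq_fun do rewrite big_ord0.
  have s0 : csummable (fun=> 0 : R[i]).
    by apply: (@csummable_bound _ _ 0) => n; rewrite big1// => *; exact: Normc.normc0.
  split => //; rewrite big_ord0; apply: ccvg_csum.
  by under eq_fun do rewrite big1//; exact: ccvg_cst.
under eq_fun do rewrite big_ord_recr/=.
by rewrite big_ord_recr/= -ih2 csumD//; split => //; exact: csummableD.
Qed.

(** * Weak* continuity of Schur multiplication *)

Section SchurNormal.
Context {R : realType} d {T : measurableType d}.
Variable mu : {measure set T -> \bar R}.
Implicit Types (A : (T -> R[i]) -> (T -> R[i])) (f g : T -> R[i]).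
Implicit Types (xi eta : nat -> T -> R[i]).

(** The family of all c_i xi_k, listed along the enumeration [e] of pairs. On families representing
    normal functionals this describes the preadjoint of Schur multiplication. *)
Definition amplify (e : nat -> nat * nat) (c : nat -> T -> R[i]) xi m : T -> R[i] :=
  mulop (c (e m).1) (xi (e m).2).

Lemma set_bij_swap (e : nat -> nat * nat) : set_bij setT setT e ->
  set_bij setT setT (fun m => ((e m).2, (e m).1)).
Proof.
move=> [_ ei es]; split => //.
- move=> m n mT nT [h2 h1]; apply: ei => //.
  by rewrite [e m]surjective_pairing h1 h2 -surjective_pairing.
- by move=> [i k] _; have [m _ em] := es (k, i) I; exists m => //; rewrite em.
Qed.

Lemma l2_le_conj (c : nat -> T -> R[i]) E : l2_le c E ->
  l2_le (fun i s => (c i s)^*%C) E.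
Proof.
move=> [E0 mc cE]; split => // [i|x n]; first exact: cmeasurable_conj.
by under eq_bigr do rewrite normc_conj; exact: cE.
Qed.

(** For fixed k the squares add up to at most [E] times the square of the norm of [xi k]. The sum
    over i thus has to be the inner one, which the swapped enumeration achieves. *)
Lemma square_summable_amplify e (c : nat -> T -> R[i]) E xi : set_bij setT setT e ->
  l2_le c E -> square_summable mu xi -> square_summable mu (amplify e c xi).
Proof.
move=> be hc [xi2 sxi]; split; first by move=> m; exact: mulop_L2 hc (xi2 _).
pose p k i := fine (sqnorm mu (mulop (c i) (xi k))).
have pE k i : (p k i)%:E = sqnorm mu (mulop (c i) (xi k)).
  rewrite /p fineK// ge0_fin_numE ?sqnorm_ge0//.
  by case: (mulop_L2 i hc (xi2 k)).
have p0 k i : 0 <= p k i by rewrite -lee_fin pE sqnorm_ge0.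
have -> : (\sum_(0 <= m <oo) sqnorm mu (amplify e c xi m) =
    \sum_(0 <= m <oo) (p (e m).2 (e m).1)%:E)%E.
  by apply: eq_eseriesr => m _; rewrite pE.
have := double_series_ge0 (set_bij_swap be) p0; rewrite /= => ->.
have [E0 _ _] := hc.
apply: (@le_lt_trans _ _ (\sum_(0 <= k <oo) (E%:E * sqnorm mu (xi k)))%E).
  apply: lee_nneseries => k *.
    by apply: nneseries_ge0 => *; rewrite lee_fin.
  under eq_eseriesr do rewrite pE.
  exact: sum_sqnorm_mulop hc (xi2 k).
rewrite nneseriesZl; last by move=> *; exact: sqnorm_ge0.
by rewrite lte_mul_pinfty.
Qed.

Lemma inner_mulop (c : T -> R[i]) f g :
  inner_product mu (mulop c f) g = inner_product mu f (mulop (fun s => (c s)^*%C) g).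
Proof.
apply: eq_cintegral => s.
have e : (mulop (fun t => (c t)^*%C) g s)^*%C = c s * (g s)^*%C.
  by rewrite /mulop rmorphM; congr (_ * _); exact: conjcK.
rewrite [RHS](_ : _ = f s * (c s * (g s)^*%C)); first by rewrite /mulop mulrCA mulrA.
exact: congr1 e.
Qed.

Section Representation.
Variables (a b a' b' : nat -> T -> R[i]) (C D : R) (e : nat -> nat * nat).
Hypotheses (aoo : forall i, Linf mu (a i)) (boo : forall i, Linf mu (b i)).
Hypotheses (ha : l2_le a' C) (hb : l2_le b' D) (be : set_bij setT setT e).
Hypotheses (aa' : \forall s \ae mu, forall i, a i s = a' i s).
Hypotheses (bb' : \forall s \ae mu, forall i, b i s = b' i s).
Variables (A : (T -> R[i]) -> (T -> R[i])).
Hypotheses (bA : bounded_operator mu A).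

Let term xi eta i k :=
  inner_product mu (A (mulop (b' i) (xi k))) (mulop (fun s => (a' i s)^*%C) (eta k)).

Let dsummable_term xi eta : square_summable mu xi -> square_summable mu eta ->
  dsummable (term xi eta) /\ dsummable (fun k i => term xi eta i k).
Proof.
move=> sxi seta.
have s := square_summable_csummable bA (square_summable_amplify be hb sxi)
  (square_summable_amplify be (l2_le_conj ha) seta).
rewrite /dsummable; split.
  rewrite -(@double_series_ge0 R (fun i k => normc (term xi eta i k)) e be)//.
  by move=> *; exact: normc_ge0.
rewrite -(@double_series_ge0 R (fun k i => normc (term xi eta i k)) _ (set_bij_swap be))//.
by move=> *; exact: normc_ge0.
Qed.

Let normal_amplify xi eta : square_summable mu xi -> square_summable mu eta ->
  normal_functional mu (amplify e b' xi) (amplify e (fun i s => (a' i s)^*%C) eta) A =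
  csum (fun i => csum (term xi eta i)).
Proof.
move=> sxi seta; have [s _] := dsummable_term sxi seta.
by rewrite -(csum_double be s).
Qed.

Let normal_schur xi eta : square_summable mu xi -> square_summable mu eta ->
  normal_functional mu xi eta (schur_operator a' b' A) =
  csum (fun i => csum (term xi eta i)).
Proof.
move=> sxi seta; have [s1 s2] := dsummable_term sxi seta.
(* [schur_operator] sums over i inside each k, whereas the partial sums that define [Phi] sum over k
   inside each i; absolute convergence identifies both with the sum along [e]. *)
transitivity (csum (fun k => csum (fun i => term xi eta i k))); last first.
  by rewrite -(csum_double be s1) -(csum_double (set_bij_swap be) s2).
have [_ _ [K K0 AK]] := bA; have [xi2 _] := sxi; have [eta2 _] := seta.
congr csum; apply/funext => k; exact: (inner_schur ha hb bA AK (xi2 k) (eta2 k)).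
Qed.

Let schur_term i f : L2 mu f -> [/\ L2 mu (mulop (a' i) (A (mulop (b' i) f))),
  cmeasurable (mulop (a i) (A (mulop (b i) f))) &
  \forall s \ae mu, mulop (a i) (A (mulop (b i) f)) s = mulop (a' i) (A (mulop (b' i) f)) s].
Proof.
move=> f2; have [A2 _ _] := bA.
have b2' : L2 mu (mulop (b' i) f) by exact: mulop_L2 hb f2.
have bb : \forall s \ae mu, mulop (b' i) f s = mulop (b i) f s.
  by apply: ae_mono bb' => s bs; rewrite /mulop bs.
have b2 : L2 mu (mulop (b i) f).
  apply: ae_eq_L2 bb b2'; apply: cmeasurableM; last by case: f2.
  by case: (boo i).
split; first exact: mulop_L2 ha (A2 _ b2').
  by apply: cmeasurableM; [case: (aoo i)|case: (A2 _ b2)].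
apply: (ae_mono2 _ aa' (bounded_operator_ae_eq bA b2' b2 bb)) => s as_ e1.
by rewrite /mulop as_ e1.
Qed.

Let normal_partial xi eta n : square_summable mu xi -> square_summable mu eta ->
  normal_functional mu xi eta (fun f => \sum_(i < n) mulop (a i) (A (mulop (b i) f))) =
  \sum_(i < n) csum (term xi eta i).
Proof.
move=> sxi seta; have [s1 _] := dsummable_term sxi seta.
have [_ <-] := csum_sum n (fun i => dsummable_row i s1).
have [xi2 _] := sxi; have [eta2 _] := seta.
congr csum; apply/funext => k.
have -> : \sum_(i < n) mulop (a i) (A (mulop (b i) (xi k))) =
    (fun s => \sum_(i < n) mulop (a i) (A (mulop (b i) (xi k))) s).
  by apply/funext => s; rewrite sumr_fctE.
have -> : \sum_(i < n) term xi eta i k =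
    \sum_(i < n) inner_product mu (mulop (a' i) (A (mulop (b' i) (xi k)))) (eta k).
  by apply: eq_bigr => i _; rewrite inner_mulop.
rewrite -inner_sum//; last by move=> i; case: (schur_term i (xi2 k)).
apply: inner_ae_eq.
- by apply: cmeasurable_sum => i _; case: (schur_term i (xi2 k)).
- by case: (eta2 k).
- by apply: cmeasurable_sum => i _; case: (schur_term i (xi2 k)) => -[].
- by case: (eta2 k).
- have h : \forall s \ae mu, forall i, mulop (a i) (A (mulop (b i) (xi k))) s =
      mulop (a' i) (A (mulop (b' i) (xi k))) s.
    by apply: ae_foralln => i; case: (schur_term i (xi2 k)).
  by apply: ae_mono h => s hs; apply: eq_bigr => i _.
- exact: aeW.
Qed.

(** [schur_operator] is the witness for the choice made by [Phi], and uniqueness of limits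
    determines the functionals of the chosen operator. The second clause is the weak* continuity of
    Schur multiplication. *)
Lemma Phi_spec : bounded_operator mu (Phi mu a b A) /\
  forall xi eta, square_summable mu xi -> square_summable mu eta ->
  normal_functional mu xi eta (Phi mu a b A) =
  normal_functional mu (amplify e b' xi) (amplify e (fun i s => (a' i s)^*%C) eta) A.
Proof.
have [_ _ [K K0 AK]] := bA.
have lim xi eta : square_summable mu xi -> square_summable mu eta ->
    ccvg (fun n => normal_functional mu xi eta
      (fun f => \sum_(i < n) mulop (a i) (A (mulop (b i) f))))
    (csum (fun i => csum (term xi eta i))).
  move=> sxi seta; have [s1 _] := dsummable_term sxi seta.
  under eq_fun do rewrite normal_partial//.
  exact: csum_cvg (dsummable_csum s1).
pose Q := [set S : (T -> R[i]) -> (T -> R[i]) | bounded_operator mu S /\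
  forall xi eta, square_summable mu xi -> square_summable mu eta ->
    ccvg (fun n => normal_functional mu xi eta
            (fun f => \sum_(i < n) mulop (a i) (A (mulop (b i) f))))
         (normal_functional mu xi eta S)].
have QS : Q (schur_operator a' b' A).
  split; first exact: (schur_bounded ha hb bA K0 AK).
  by move=> xi eta sxi seta; rewrite normal_schur//; exact: lim.
have [bS hS] : Q (Phi mu a b A) by exact: (xgetI _ QS).
split => // xi eta sxi seta.
rewrite normal_amplify//; apply: (ccvg_unique (hS _ _ sxi seta)); exact: lim.
Qed.

(** The functionals of [single] families are the vector functionals, which separate functions up to
    null sets. *)
Lemma Phi_ae f : L2 mu f -> Phi mu a b A f = schur_operator a' b' A f %[ae mu].
Proof.
have [_ _ [K K0 AK]] := bA.
move=> f2; have [bS hS] := Phi_spec.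
have [S2 _ _] := bS; have [S2' _ _] := schur_bounded ha hb bA K0 AK.
suff : \forall x \ae mu, Phi mu a b A f x = schur_operator a' b' A f x.
  by apply: ae_mono => x ->.
apply: inner_eq; [exact: S2|exact: S2'|move=> g g2].
have sf := square_summable_single f2; have sg := square_summable_single g2.
by rewrite -!normal_functional_single hS// normal_schur// normal_amplify.
Qed.

End Representation.
End SchurNormal.

Lemma normc_ltD {R : realType} (x y z : R[i]) (e : R) :
  normc (x - y) < e / 2 -> normc (y - z) < e / 2 -> normc (x - z) < e.
Proof.
move=> h1 h2; have -> : x - z = (x - y) + (y - z) by rewrite addrA subrK.
by apply: (@le_lt_trans _ _ _ _ _ (le_normcD _ _)); lra.
Qed.

Lemma normc_conjB {R : realType} (x y : R[i]) : normc (x^*%C - y^*%C) = normc (x - y).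
Proof. by rewrite -rmorphB normc_conj. Qed.

(** The summand 1 in the denominator covers the case [c = 0]. *)
Lemma normc_lin_lt {R : realType} (c x x' y y' : R[i]) (e : R) :
  normc (x - x') < e / (2 * (normc c + 1)) -> normc (y - y') < e / 2 ->
  normc (c * x + y - (c * x' + y')) < e.
Proof.
rewrite opprD addrACA -mulrBr => h1 h2.
apply: (@le_lt_trans _ _ _ _ _ (le_normcD _ _)); rewrite Normc.normcM.
move: h1 h2 (normc_ge0 c) (normc_ge0 (x - x')).
move: (normc c) (normc (x - x')) (normc (y - y')) => k u v + h2 k0 u0.
rewrite ltr_pdivlMr; last by rewrite mulr_gt0// ltr_wpDl.
have -> : u * (2 * (k + 1)) = 2 * (k * u) + 2 * u by ring.
by move=> h1; lra.
Qed.

(** * The group von Neumann algebra *)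

Section GeneratedAlgebra.
Context {R : realType} d {T : measurableType d}.
Variable mu : {measure set T -> \bar R}.
Implicit Types (A B : (T -> R[i]) -> (T -> R[i])) (xi eta : nat -> T -> R[i]).

Lemma normal_functional_comp A B xi eta :
  normal_functional mu xi eta (A \o B) = normal_functional mu (fun k => B (xi k)) eta A.
Proof. by []. Qed.

Lemma normal_functional_adjoint A B xi eta :
  adjoint_operators mu A B -> square_summable mu xi -> square_summable mu eta ->
  normal_functional mu xi eta A = normal_functional mu xi (fun k => B (eta k)) id.
Proof.
by move=> AB [xi2 _] [eta2 _]; congr csum; apply/funext => k; exact: AB.
Qed.

Lemma normal_functional_conj A B xi eta : bounded_operator mu A -> bounded_operator mu B ->
  adjoint_operators mu A B -> square_summable mu xi -> square_summable mu eta ->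
  normal_functional mu xi eta B = (normal_functional mu eta xi A)^*%C.
Proof.
move=> bA bB AB sxi seta; rewrite /normal_functional -csum_conj; last first.
  exact: square_summable_csummable.
have [xi2 _] := sxi; have [eta2 _] := seta; have [B2 _ _] := bB.
by congr csum; apply/funext => k; rewrite AB// -inner_conj//; exact: B2.
Qed.

Lemma sub_operator_wstar_closure (M : set (operator (R := R) (T := T))) :
  M `<=` bounded_operator mu -> M `<=` operator_wstar_closure mu M.
Proof.
move=> bM A MA; split; first exact: bM.
move=> e n xi eta e0 _ _; exists A => // i.
by rewrite subrr Normc.normc0.
Qed.

Variable W : set (operator (R := R) (T := T)).
Hypothesis W_bounded : W `<=` bounded_operator mu.
Hypothesis W_id : W id.
Hypothesis W_lin : forall (c : R[i]) A B, W A -> W B -> W (fun f => c *: A f + B f).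
Hypothesis W_comp : forall A B, W A -> W B -> W (A \o B).
Hypothesis W_adj : forall A, W A -> exists2 B, W B & adjoint_operators mu A B.

Let cl := operator_wstar_closure mu W.

Lemma closure_lin (c : R[i]) A B : cl A -> cl B -> cl (fun f => c *: A f + B f).
Proof.
move=> [bA hA] [bB hB]; split; first exact: bounded_operator_lin.
move=> e n xi eta e0 sxi seta.
have c1 : 0 < 2 * (normc c + 1) by rewrite mulr_gt0// ltr_wpDl// normc_ge0.
have [A' WA' AA'] := hA (e / (2 * (normc c + 1))) n xi eta (divr_gt0 e0 c1) sxi seta.
have [B' WB' BB'] := hB (e / 2) n xi eta (divr_gt0 e0 (ltr0n _ 2)) sxi seta.
exists (fun f => c *: A' f + B' f); first exact: W_lin.
move=> i; rewrite (normal_functional_lin c bA bB (sxi i) (seta i)).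
rewrite (normal_functional_lin c (W_bounded WA') (W_bounded WB') (sxi i) (seta i)).
exact: normc_lin_lt (AA' i) (BB' i).
Qed.

(** Composition is only separately weak* continuous, so the approximations are successive. [A] is
    replaced by some [A'] in [W] on the families B xi; then [B] is replaced on families moved by the
    adjoint of [A'], which exists because [A'] lies in [W]. *)
Lemma closure_comp A B : cl A -> cl B -> cl (A \o B).
Proof.
move=> [bA hA] [bB hB]; split; first exact: bounded_operator_comp.
move=> e n xi eta e0 sxi seta.
have e2 : 0 < e / 2 by rewrite divr_gt0.
have sB i : square_summable mu (fun k => B (xi i k)) by exact: square_summable_image.
have [A' WA' AA'] := hA (e / 2) n (fun i k => B (xi i k)) eta e2 sB seta.
have [As WAs AAs] := W_adj WA'.
have sA i : square_summable mu (fun k => As (eta i k)).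
  by apply: square_summable_image => //; exact: W_bounded.
have [B' WB' BB'] := hB (e / 2) n xi (fun i k => As (eta i k)) e2 sxi sA.
exists (A' \o B'); first exact: W_comp.
move=> i; have h1 := AA' i; have h2 := BB' i.
have sB' : square_summable mu (fun k => B' (xi i k)).
  by apply: square_summable_image => //; exact: W_bounded.
move: h1 h2; rewrite !normal_functional_comp.
rewrite (normal_functional_adjoint AAs (sB i) (seta i)).
rewrite (normal_functional_adjoint AAs sB' (seta i)).
exact: normc_ltD.
Qed.

(** Passing to the adjoint conjugates the functional and exchanges its two families. *)
Lemma closure_adjoint A B : cl A -> bounded_operator mu B -> adjoint_operators mu A B -> cl B.
Proof.
move=> [bA hA] bB AB; split; first exact: bB.
move=> e n xi eta e0 sxi seta.
have [A' WA' AA'] := hA e n eta xi e0 seta sxi.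
have [As WAs AAs] := W_adj WA'.
exists As; first exact: WAs.
move=> i; rewrite (normal_functional_conj bA bB AB (sxi i) (seta i)).
rewrite (normal_functional_conj (W_bounded WA') (W_bounded WAs) AAs (sxi i) (seta i)).
by rewrite normc_conjB; exact: AA'.
Qed.

Lemma closure_idem : operator_wstar_closure mu cl `<=` cl.
Proof.
move=> A [bA hA]; split => // e n xi eta e0 sxi seta.
have e2 : 0 < e / 2 by rewrite divr_gt0.
have [B [bB hB] AB] := hA (e / 2) n xi eta e2 sxi seta.
have [C WC BC] := hB (e / 2) n xi eta e2 sxi seta.
by exists C => // i; exact: normc_ltD (AB i) (BC i).
Qed.

Lemma closure_von_neumann : von_neumann_algebra mu cl.
Proof.
split.
- by move=> A [].
- exact: sub_operator_wstar_closure.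
- exact: closure_lin.
- exact: closure_comp.
- by split; [exact: closure_adjoint|exact: closure_idem].
Qed.

End GeneratedAlgebra.

(** Passage to the limit: [v] is the value at an approximant, for which the relation is exact, while
    [x] and [w] belong to the limit. *)
Lemma scaled_approx_eq {R : realType} (c x w : R[i]) :
  (forall e : R, 0 < e -> exists2 v, normc (x - c * v) < e & normc (v - w) < e) ->
  x = c * w.
Proof.
move=> h; apply/eqP; rewrite -subr_eq0; apply/eqP/Normc.eq0_normc/eqP.
rewrite eq_le normc_ge0 andbT; apply/ler_addgt0Pr => e e0; rewrite add0r.
have n0 : 0 < 2 * (normc c + 1) by rewrite mulr_gt0// ltr_wpDl// normc_ge0.
have [v h1 h2] := h _ (divr_gt0 e0 n0); apply: ltW.
have h3 : normc (c * v - x) < e / 2.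
  rewrite normcB (lt_le_trans h1)// ler_pM2l// lef_pV2 ?posrE//.
  by rewrite ler_peMr// lerDr normc_ge0.
rewrite normcB; have -> : c * w - x = c * w + c * v - (c * v + x) by ring.
by apply: normc_lin_lt h3; rewrite normcB.
Qed.

(** * Translations and the algebra they generate *)

Section Translations.
Context {R : realType} {G : topGroupType}.
Hypothesis scG : @second_countable G.
Variable mu : {sigma_finite_measure set (borel G) -> \bar R}.
Hypothesis haar_mu : left_haar mu.
Implicit Types (f g h : borel G -> R[i]) (s q r : G).

Lemma sqnorm_scales (tau : borel G -> borel G) (kappa : R) f :
  scales_measure mu mu tau kappa -> cmeasurable f ->
  (sqnorm mu (f \o tau) = kappa%:E * sqnorm mu f)%E.
Proof.
move=> ht mf; rewrite /sqnorm.
rewrite -(ge0_integral_scales ht (f := fun x => (normc (f x) ^+ 2 : R)%:E))//.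
- exact: cmeasurable_sqr.
- by move=> x; rewrite lee_fin sqr_ge0.
Qed.

Lemma L2_scales (tau : borel G -> borel G) (kappa : R) f :
  scales_measure mu mu tau kappa -> L2 mu f -> L2 mu (f \o tau).
Proof.
move=> ht [mf f2]; split; first exact: cmeasurable_scales ht _ mf.
have [_ k0 _] := ht.
by rewrite (sqnorm_scales ht mf) lte_mul_pinfty.
Qed.

Lemma lambda_L2 s f : L2 mu f -> L2 mu (lambda s f).
Proof. exact: (L2_scales (haar_scales scG haar_mu s^-1%g)). Qed.

Lemma lambda_bounded s : bounded_operator mu (lambda s).
Proof.
split; [exact: lambda_L2|by move=> c f g _ _; exact: aeW|exists 1 => // f [mf _]].
by rewrite (sqnorm_scales (haar_scales scG haar_mu s^-1%g) mf) expr1n.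
Qed.

Lemma lambda_adjoint s : adjoint_operators mu (lambda s) (lambda s^-1%g).
Proof.
move=> f g f2 g2; rewrite /inner_product.
have g2' := lambda_L2 s^-1%g g2.
have := cintegral_scales (haar_scales scG haar_mu s^-1%g) (L1_inner f2 g2').
rewrite mul1r => <-; apply: eq_cintegral => x.
by rewrite /lambda invgK mulgA mulgV mul1g.
Qed.

(** Linear combinations given as lists of terms. They are concrete maps on functions, so that
    [span_rho] is an equality of functions. *)
Inductive translation_span : (operator (R := R) (T := borel G)) -> Prop :=
| span0 : translation_span (fun _ => 0)
| span_cons c s B : translation_span B ->
    translation_span (fun f => c *: lambda s f + B f).

Lemma span_bounded A : translation_span A -> bounded_operator mu A.
Proof.
elim=> [|c s B _ bB]; first exact: bounded_operator_0.
by apply: bounded_operator_lin => //; exact: lambda_bounded.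
Qed.

Lemma span_lin (c : R[i]) A B : translation_span A -> translation_span B ->
  translation_span (fun f => c *: A f + B f).
Proof.
move=> sA sB; elim: sA => [|c' s A' _ ih].
  by rewrite (_ : (fun _ => _) = B)//; apply/funext => f; rewrite scaler0 add0r.
rewrite (_ : (fun _ => _) = fun f => (c * c') *: lambda s f + (c *: A' f + B f)).
  exact: span_cons.
by apply/funext => f; rewrite scalerDr scalerA addrA.
Qed.

Lemma span_lambda s : translation_span (lambda s).
Proof.
rewrite (_ : lambda s = fun f => 1 *: lambda s f + 0); first exact: span_cons span0.
by apply/funext => f; rewrite scale1r addr0.
Qed.

Lemma span_id : translation_span id.
Proof.
rewrite (_ : id = lambda 1%g); first exact: span_lambda.
by apply/funext => f; apply/funext => x; rewrite /lambda invg1 mul1g.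
Qed.

Lemma span_lambda_comp s B : translation_span B ->
  translation_span (fun f => lambda s (B f)).
Proof.
elim=> [|c r B' _ ih]; first exact: span0.
rewrite (_ : (fun _ => _) = fun f => c *: lambda (s * r)%g f + lambda s (B' f)).
  exact: span_cons.
apply/funext => f; apply/funext => x.
by rewrite /lambda !fctE/= invgM mulgA.
Qed.

Lemma span_comp A B : translation_span A -> translation_span B ->
  translation_span (A \o B).
Proof.
move=> sA sB; elim: sA => [|c s A' _ ih]; first exact: span0.
exact: span_lin (span_lambda_comp s sB) ih.
Qed.

Lemma span_adjoint A : translation_span A ->
  exists2 B, translation_span B & adjoint_operators mu A B.
Proof.
elim=> [|c s A' sA' [B' sB' AB']].
  exists (fun _ => 0); first exact: span0.
  by move=> f g _ _; rewrite [RHS]inner0r [LHS]inner0l.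
exists (fun f => c^*%C *: lambda s^-1%g f + B' f); first exact: span_cons.
move=> f g f2 g2.
have [A2' _ _] := span_bounded sA'; have [B2' _ _] := span_bounded sB'.
have l2 := lambda_L2 s f2; have l2' := lambda_L2 s^-1%g g2.
transitivity (c * inner_product mu (lambda s f) g + inner_product mu (A' f) g).
  by rewrite -(innerZ c l2 g2) -(innerD (L2_Z c l2) (A2' _ f2) g2).
rewrite lambda_adjoint// AB'//.
have h2 : L2 mu (c^*%C *: lambda s^-1%g g + B' g).
  by apply: L2_D; [exact: L2_Z|exact: B2'].
rewrite [RHS](inner_conj h2 f2).
rewrite (innerD (L2_Z c^*%C l2') (B2' _ g2) f2) (innerZ c^*%C l2' f2) rmorphD rmorphM.
by congr (_ * _ + _); [exact/esym/conjcK|exact: inner_conj|apply: inner_conj => //; exact: B2'].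
Qed.

(** The closure of the span is itself a von Neumann algebra containing the translations, hence one
    of those whose intersection is [VN]. *)
Lemma VN_sub_closure : VN mu `<=` operator_wstar_closure mu translation_span.
Proof.
move=> A; apply.
- apply: closure_von_neumann.
  + exact: span_bounded.
  + exact: span_id.
  + exact: span_lin.
  + exact: span_comp.
  + exact: span_adjoint.
- move=> _ [s _ <-]; apply: sub_operator_wstar_closure; first exact: span_bounded.
  exact: span_lambda.
Qed.

(** Right translation without the square root of the modular function: a bounded operator that need
    not be unitary, whence the factor in [rho_adjoint]. *)
Definition rho q f : borel G -> R[i] := fun t => f (t * q)%g.

Lemma span_rho A q f : translation_span A -> A (rho q f) = rho q (A f).
Proof.
elim=> [//|c s A' _ ih]; rewrite ih.
by apply/funext => x; rewrite /rho /lambda !fctE/= mulgA.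
Qed.

Hypotheses (hausdorffG : hausdorff_space G) (lcG : locally_compact [set: G]).

Lemma rho_L2 q f : L2 mu f -> L2 mu (rho q f).
Proof.
have [kappa _ hk] := modular_ex scG haar_mu q hausdorffG lcG.
exact: L2_scales hk.
Qed.

Lemma rho_adjoint q : exists2 kappa : R, 0 < kappa & forall f g, L2 mu f -> L2 mu g ->
  inner_product mu (rho q f) g = kappa%:C * inner_product mu f (rho q^-1%g g).
Proof.
have [kappa k0 hk] := modular_ex scG haar_mu q hausdorffG lcG.
exists kappa => // f g f2 g2; have g2' := rho_L2 q^-1%g g2.
rewrite /inner_product -(cintegral_scales hk (L1_inner f2 g2')).
by apply: eq_cintegral => x; rewrite /rho -mulgA mulgV mulg1.
Qed.

Lemma VN_bounded A : VN mu A -> bounded_operator mu A.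
Proof. by move=> /VN_sub_closure[]. Qed.

(** One [B] in the span approximates [A] for two vector functionals at once, that of [rho q f] and
    [g] and that of [f] and [rho q^-1%g g]. Since [B] commutes with [rho q], these two values of [B]
    differ by the factor [kappa], which therefore holds for [A]. *)
Lemma VN_rho A q f : VN mu A -> L2 mu f -> \forall x \ae mu, A (rho q f) x = rho q (A f) x.
Proof.
move=> /VN_sub_closure[bA hA] f2.
have [A2 _ _] := bA.
have [kappa k0 hk] := rho_adjoint q.
have fq2 := rho_L2 q f2.
apply: inner_eq; [exact: A2|apply: rho_L2; exact: A2|move=> g g2].
rewrite hk//; last exact: A2.
have gq2 := rho_L2 q^-1%g g2.
apply: scaled_approx_eq => e e0.
pose xi (i : 'I_2) := if i == 0 then single (rho q f) else single f.
pose eta (i : 'I_2) := if i == 0 then single g else single (rho q^-1%g g).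
have sxi i : square_summable mu (xi i) by rewrite /xi; case: ifP => _; exact: square_summable_single.
have seta i : square_summable mu (eta i) by rewrite /eta; case: ifP => _; exact: square_summable_single.
have [B sB AB] := hA e 2 xi eta e0 sxi seta.
exists (inner_product mu (B f) (rho q^-1%g g)).
  have [B2 _ _] := span_bounded sB.
  rewrite -hk//; last exact: B2.
  by rewrite -(span_rho _ _ sB) -!normal_functional_single; exact: (AB 0).
by rewrite normcB -!normal_functional_single; exact: (AB 1).
Qed.

End Translations.

(** Supplies the measurable property that Fubini's theorem asks for, when the given one need not be
    measurable. *)
Lemma ae_hull {R : realType} d {T : measurableType d} (m : {measure set T -> \bar R})
    (P : T -> Prop) : (\forall x \ae m, P x) ->
  exists Q : T -> Prop, [/\ measurable [set x | Q x], \forall x \ae m, Q x &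
    forall x, Q x -> P x].
Proof.
move=> [N [mN N0 sN]]; exists (fun x => ~ N x); split.
- exact: measurableC.
- by exists N; split => // x /= /contrapT.
- by move=> x h; apply: contrapT => nP; apply: h; exact: sN.
Qed.

(** * Almost everywhere statements on products *)

Section ProductAlmostEverywhere.
Context {R : realType} d1 d2 {T1 : measurableType d1} {T2 : measurableType d2}.
Variables (m1 : {sigma_finite_measure set T1 -> \bar R}).
Variables (m2 : {sigma_finite_measure set T2 -> \bar R}).
Local Notation m12 := (m1 \x m2)%E.

Lemma ae_prod_curry (P : T1 * T2 -> Prop) : (\forall z \ae m12, P z) ->
  \forall x \ae m1, \forall y \ae m2, P (x, y).
Proof.
move=> /ae_hull[Q [mQ aeQ QP]].
apply: ae_mono ((ae_prod1 m1 m2 mQ).1 aeQ) => x; apply: ae_mono => y; exact: QP.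
Qed.

Lemma ae_fst (P : T1 -> Prop) : (\forall x \ae m1, P x) -> \forall z \ae m12, P z.1.
Proof.
move=> /ae_hull[Q [mQ aeQ QP]].
apply: (ae_mono (P := fun z : T1 * T2 => Q z.1)); first by move=> z; exact: QP.
apply: (ae_prod1 m1 m2 (P := fun z => Q z.1) _).2; last by apply: ae_mono aeQ => x Qx; exact: aeW.
exact: (measurable_preimage_fun measurable_fst mQ).
Qed.

Lemma ae_snd (P : T2 -> Prop) : (\forall x \ae m2, P x) -> \forall z \ae m12, P z.2.
Proof.
move=> /ae_hull[Q [mQ aeQ QP]].
apply: (ae_mono (P := fun z : T1 * T2 => Q z.2)); first by move=> z; exact: QP.
apply: (ae_prod1 m1 m2 (P := fun z => Q z.2) _).2; last exact: aeW.
exact: (measurable_preimage_fun measurable_snd mQ).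
Qed.

Lemma measurable_ae_section (P : T1 * T2 -> Prop) : measurable [set z | P z] ->
  measurable [set x | \forall y \ae m2, P (x, y)].
Proof.
move=> mP; have mx : measurable_fun setT (m2 \o xsection (~` [set z | P z])).
  by apply: measurable_fun_xsection; exact: measurableC.
have -> : [set x | \forall y \ae m2, P (x, y)] =
    (m2 \o xsection (~` [set z | P z])) @^-1` [set 0%E].
  apply/seteqP; split => x /=.
  - move=> /ae_measurableP <-; first by rewrite xsectionE.
    by have := measurable_xsection x mP; rewrite xsectionE.
  - move=> h; apply/ae_measurableP.
      by have := measurable_xsection x mP; rewrite xsectionE.
    by rewrite -[RHS]h xsectionE.
by rewrite -[X in measurable X]setTI; exact: mx.
Qed.

Lemma scales_fst (tau : T1 -> T1) (kappa : R) : scales_measure m1 m1 tau kappa ->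
  scales_measure m12 m12 (fun z => (tau z.1, z.2)) kappa.
Proof.
move=> [mt k0 hk].
have mt2 : measurable_fun setT (fun z : T1 * T2 => (tau z.1, z.2)).
  by apply/measurable_fun_pairP; split; [exact: (measurableT_comp mt measurable_fst)|exact: measurable_snd].
split => // A mA.
have mA' : measurable ((fun z : T1 * T2 => (tau z.1, z.2)) @^-1` A).
  by rewrite -[X in measurable X]setTI; exact: mt2.
rewrite [LHS](product_measure2_integral m1 m2 mA') [X in (_ * X)%E](product_measure2_integral m1 m2 mA).
rewrite -ge0_integralZl//; last first.
  exact: measurable_fun_ysection.
apply: eq_integral => y _; rewrite -hk; last exact: measurable_ysection.
by congr (m1 _); apply/seteqP; split => x /=; rewrite /ysection/= !in_setE.
Qed.

Lemma scales_snd (tau : T2 -> T2) (kappa : R) : scales_measure m2 m2 tau kappa ->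
  scales_measure m12 m12 (fun z => (z.1, tau z.2)) kappa.
Proof.
move=> [mt k0 hk].
have mt2 : measurable_fun setT (fun z : T1 * T2 => (z.1, tau z.2)).
  by apply/measurable_fun_pairP; split; [exact: measurable_fst|exact: (measurableT_comp mt measurable_snd)].
split => // A mA.
have mA' : measurable ((fun z : T1 * T2 => (z.1, tau z.2)) @^-1` A).
  by rewrite -[X in measurable X]setTI; exact: mt2.
rewrite /product_measure1 -ge0_integralZl//; last first.
  exact: measurable_fun_xsection.
apply: eq_integral => x _; rewrite -hk; last exact: measurable_xsection.
by congr (m2 _); apply/seteqP; split => y /=; rewrite /xsection/= !in_setE.
Qed.

End ProductAlmostEverywhere.

(** Fubini's theorem splits off the third variable, then exchanges the first two; for fixed middle
    variable the outer two are joined again. *)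
Lemma ae_prod_middle {R : realType} d {T : measurableType d}
    (mu : {sigma_finite_measure set T -> \bar R}) (P : T * T * T -> Prop) :
  measurable [set x | P x] ->
  (\forall x \ae ((mu \x mu) \x mu)%E, P x) <->
  (\forall t \ae mu, \forall z \ae (mu \x mu)%E, P (z.1, t, z.2)).
Proof.
move=> mP; apply: (iff_trans (ae_prod12_3 mu mu mu mP)).
have mQ := measurable_ae_section mu mP.
apply: (iff_trans (ae_prod2 mu mu mQ)).
have mPt t : measurable [set z : T * T | P (z.1, t, z.2)].
  apply: (measurable_preimage_fun (f := fun z : T * T => (z.1, t, z.2)) _ mP).
  apply/measurable_fun_pairP; split; last exact: measurable_snd.
  by apply/measurable_fun_pairP; split; [exact: measurable_fst|exact: measurable_cst].
by split; apply: ae_mono => t; rewrite (ae_prod1 mu mu (mPt t)).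
Qed.

Section LinfProduct.
Context {R : realType} d1 d2 {T1 : measurableType d1} {T2 : measurableType d2}.
Variables (m1 : {sigma_finite_measure set T1 -> \bar R}).
Variables (m2 : {sigma_finite_measure set T2 -> \bar R}).

Lemma Linf_fst (k : T1 -> R[i]) : Linf m1 k -> Linf (m1 \x m2)%E (fun z => k z.1).
Proof.
move=> /LinfP[mk [M M0 kM]]; apply/LinfP; split.
  by apply: cmeasurable_comp mk _; exact: measurable_fst.
by exists M => //; exact: ae_fst kM.
Qed.

Lemma Linf_snd (k : T2 -> R[i]) : Linf m2 k -> Linf (m1 \x m2)%E (fun z => k z.2).
Proof.
move=> /LinfP[mk [M M0 kM]]; apply/LinfP; split.
  by apply: cmeasurable_comp mk _; exact: measurable_snd.
by exists M => //; exact: ae_snd kM.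
Qed.

End LinfProduct.

Lemma Linf_sum {R : realType} d {T : measurableType d} (m : {measure set T -> \bar R})
    I (r : seq I) (F : I -> T -> R[i]) : (forall i, Linf m (F i)) ->
  Linf m (\sum_(i <- r) F i).
Proof.
move=> FL; elim: r => [|i r ih]; first by rewrite big_nil; exact: Linf_cst.
by rewrite big_cons; exact: LinfD.
Qed.

(** * Invariant kernels *)

Section KernelNets.
Context {R : realType}.

(** The finitely supported sequences with rational coordinates, a countable dense subset of l^2;
    past the end of [w] the default value gives 0. *)
Definition rational_point (w : seq (rat * rat)) (i : nat) : R[i] :=
  ratr (nth (0, 0) w i).1 +i* ratr (nth (0, 0) w i).2.

Lemma rational_approximation (x e : R) : 0 < e -> exists r : rat, (x - ratr r) ^+ 2 <= e.
Proof.
move=> e0; have d0 : 0 < Num.sqrt e by rewrite sqrtr_gt0.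
have [r] : exists r : rat, x - Num.sqrt e < ratr r < x + Num.sqrt e.
  have xx : x - Num.sqrt e < x + Num.sqrt e by lra.
  by have [r] := rat_in_itvoo xx; rewrite in_itv/= => h; exists r.
move=> /andP[h1 h2]; exists r; rewrite -[e]sqr_sqrtr ?(ltW e0)//.
rewrite -[leLHS]real_normK ?num_real// ler_pXn2r ?nnegrE// ?(ltW d0)//.
by rewrite ler_norml; lra.
Qed.

Lemma rational_l2_approximation (u : nat -> R[i]) (C e : R) :
  (forall n, \sum_(i < n) normc (u i) ^+ 2 <= C) -> 0 < e ->
  exists w, forall m, \sum_(i < m) normc (u i - rational_point w i) ^+ 2 <= e.
Proof.
move=> uC e0; pose p i := normc (u i) ^+ 2.
pose E := [set \sum_(i < n) p i | n in [set: nat]].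
have supE : has_sup E.
  by split; [exists (\sum_(i < 0) p i), 0%N|exists C => _ [n _ <-]; exact: uC].
have e2 : 0 < e / 2 by rewrite divr_gt0.
have [_ [n _ <-] hn] := sup_adherent e2 supE.
have tail m : \sum_(j < m) p (n + j)%N <= e / 2.
  have : \sum_(i < n + m) p i <= sup E by apply: sup_upper_bound => //; exists (n + m)%N.
  by rewrite big_split_ord/=; lra.
(* Each of the first [n] coordinates costs at most [eta] in its real and [eta] in its imaginary
   part, in total 2 n eta, which is below e / 2. The successor avoids a division by zero. *)
pose eta := e / (4 * n.+1%:R).
have n1 : 0 < 4 * n.+1%:R :> R by rewrite mulr_gt0.
have eta0 : 0 < eta by rewrite divr_gt0.
have /choice[z hz] : forall i, exists z : rat * rat,
    normc (u i - (ratr z.1 +i* ratr z.2)) ^+ 2 <= 2 * eta.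
  move=> i; have [r hr] := rational_approximation (complex.Re (u i)) eta0.
  have [s hs] := rational_approximation (complex.Im (u i)) eta0.
  exists (r, s); rewrite sqr_normcE ReB ImB/=; lra.
exists (mkseq z n) => m.
pose f i := normc (u i - rational_point (mkseq z n) i) ^+ 2.
have f0 i : 0 <= f i by exact: sqr_ge0.
apply: (@le_trans _ _ (\sum_(i < n + m) f i)).
  by rewrite addnC big_split_ord/= lerDl sumr_ge0.
rewrite big_split_ord/= [e]splitr lerD//.
- apply: (@le_trans _ _ (\sum_(i < n) (2 * eta))).
    apply: ler_sum => i _; rewrite /f /rational_point nth_mkseq//; exact: hz.
  rewrite sumr_const card_ord -[_ *+ n]mulr_natr /eta.
  have -> : 2 * (e / (4 * n.+1%:R)) * n%:R = e / 2 * (n%:R / n.+1%:R).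
    have : n.+1%:R != 0 :> R by rewrite pnatr_eq0.
    by move: (n.+1%:R) => N N0; field.
  by rewrite ler_piMr ?(ltW e2)// ler_pdivrMr// mul1r ler_nat.
- apply: le_trans (tail m); apply: ler_sum => j _.
  rewrite /f /rational_point nth_default ?size_mkseq ?leq_addr//.
  by rewrite !rmorph0 (_ : 0 +i* 0 = 0 :> R[i])// subr0.
Qed.

Context d {T : measurableType d}.

(** The rows of [K] form a separable set for the supremum norm: for each [e], countably many cells
    cover [T], and rows from one cell differ by at most [e], uniformly in [t]. *)
Definition has_nets (K : T * T -> R[i]) := forall e : R, 0 < e ->
  exists net : nat -> T -> Prop, (forall s, exists j, net j s) /\
    forall j s s' t, net j s -> net j s' -> normc (K (s, t) - K (s', t)) <= e.

(** A cell consists of the points whose sequence a_i(s) lies within [eta] of a given rational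
    sequence in l^2. The Cauchy-Schwarz inequality against b_i(t) costs a factor sqrt D, uniform in
    [t]; the 1 added to it in [eta] covers [D = 0]. *)
Lemma kernel_nets (a b : nat -> T -> R[i]) (C D : R) : l2_le a C -> l2_le b D ->
  has_nets (kernel a b).
Proof.
move=> ha hb e e0; have [C0 _ aC] := ha; have [D0 _ bD] := hb.
have D1 : 0 < 2 * (Num.sqrt D + 1) by rewrite mulr_gt0// ltr_wpDl// sqrtr_ge0.
pose eta := e / (2 * (Num.sqrt D + 1)).
have eta0 : 0 < eta by rewrite divr_gt0.
have eta2 : 0 < eta ^+ 2 by rewrite exprn_gt0.
exists (fun j s => exists2 w, unpickle j = Some w &
  forall m, \sum_(i < m) normc (a i s - rational_point w i) ^+ 2 <= eta ^+ 2); split.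
  move=> s; have [w hw] := rational_l2_approximation (u := fun i => a i s) (aC s) eta2.
  by exists (pickle w), w => //; rewrite pickleK.
move=> j s s' t [w jw hs] [w' jw']; move: jw'; rewrite jw => -[<-] hs'.
have half r n : (forall m, \sum_(i < m) normc (a i r - rational_point w i) ^+ 2 <= eta ^+ 2) ->
    normc (\sum_(i < n) (a i r - rational_point w i) * b i t) <= e / 2.
  move=> hr; apply: le_trans (normc_sum _ _ _) _.
  apply: (le_trans (l2_prod_sum_le (u := fun i => a i r - rational_point w i)
    (v := fun i => b i t) (ltW eta2) D0 hr (bD t) n)).
  rewrite sqrtr_sqr gtr0_norm//.
  by have : eta * (2 * (Num.sqrt D + 1)) = e; [rewrite divfK// gt_eqF|nra].
have cv := ccvgD (kernel_cvg ha hb s t) (ccvgZ (-1) (kernel_cvg ha hb s' t)).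
rewrite -mulN1r; apply: ccvg_normc_le cv => n.
have -> : \sum_(i < n) a i s * b i t + -1 * (\sum_(i < n) a i s' * b i t) =
    \sum_(i < n) (a i s - rational_point w i) * b i t -
    \sum_(i < n) (a i s' - rational_point w i) * b i t.
  rewrite mulr_sumr -sumrN -!big_split; apply: eq_bigr => i _ /=; ring.
apply: le_trans (le_normcD _ _) _; rewrite normcN [e]splitr lerD//; exact: half.
Qed.

Lemma has_netsB (K L : T * T -> R[i]) : has_nets K -> has_nets L ->
  has_nets (fun z => K z - L z).
Proof.
move=> hK hL e e0; have e2 : 0 < e / 2 by rewrite divr_gt0.
have [net [cov close]] := hK _ e2; have [net' [cov' close']] := hL _ e2.
exists (fun j s => exists2 w : nat * nat, unpickle j = Some w & net w.1 s /\ net' w.2 s); split.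
  move=> s; have [j sj] := cov s; have [j' sj'] := cov' s.
  by exists (pickle (j, j')), (j, j') => //; rewrite pickleK.
move=> j s s' t [w jw [h1 h2]] [w' jw']; move: jw'; rewrite jw => -[<-] [h1' h2'].
have -> : K (s, t) - L (s, t) - (K (s', t) - L (s', t)) =
  (K (s, t) - K (s', t)) - (L (s, t) - L (s', t)) by ring.
apply: le_trans (le_normcD _ _) _; rewrite normcN [e]splitr lerD//.
- exact: close h1 h1'.
- exact: close' h2 h2'.
Qed.

Lemma has_nets_comp (K : T * T -> R[i]) (p q : T -> T) : has_nets K ->
  has_nets (fun z => K (p z.1, q z.2)).
Proof.
move=> hK e e0; have [net [cov close]] := hK _ e0.
exists (fun j s => net j (p s)); split; first by move=> s; exact: cov.
by move=> j s s' t h h'; exact: close h h'.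
Qed.

(* Countably many cells, hence countably many rows [K (s, _)], determine [K] up
   to [e]; this makes the restriction of [K] to a null set such as the graph of
   a translation meaningful. *)
Lemma has_nets_eq0 (mu : {sigma_finite_measure set T -> \bar R}) (K : T * T -> R[i]) :
  has_nets K -> (\forall z \ae (mu \x mu)%E, K z = 0) ->
  exists S S' : T -> Prop, [/\ \forall s \ae mu, S s, \forall t \ae mu, S' t &
    forall s t, S s -> S' t -> K (s, t) = 0].
Proof.
move=> hK K0; pose S s := \forall t \ae mu, K (s, t) = 0.
have Sae : \forall s \ae mu, S s := ae_prod_curry K0.
have /choice[net hnet] : forall k : nat, exists net : nat -> T -> Prop,
    (forall s, exists j, net j s) /\
    forall j s s' t, net j s -> net j s' -> normc (K (s, t) - K (s', t)) <= k.+1%:R^-1.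
  by move=> k; apply: hK; rewrite invr_gt0.
(* A representative of each cell, taken in [S] whenever the cell meets [S]. The set for [t] is then
   the countable intersection of the conditions that the representative rows in [S] vanish at
   [t]. *)
have /choice[rep hrep] : forall kj : nat * nat, exists s',
    forall s, S s -> net kj.1 kj.2 s -> S s' /\ net kj.1 kj.2 s'.
  move=> [k j]; have [[s [Ss ns]]|nex] := pselect (exists s, S s /\ net k j s).
    by exists s.
  by exists point => s Ss ns; exfalso; apply: nex; exists s.
exists S, (fun t => forall k j, S (rep (k, j)) -> K (rep (k, j), t) = 0); split => //.
  apply: ae_foralln => k; apply: ae_foralln => j.
  have [Sr|nSr] := pselect (S (rep (k, j))); last by apply: aeW => t /nSr.
  by apply: ae_mono Sr.
move=> s t Ss h; apply: Normc.eq0_normc; apply/eqP; rewrite eq_le normc_ge0 andbT.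
apply/ler_addgt0Pr => e e0; rewrite add0r.
have [k /ltW ke] : exists k : nat, k.+1%:R^-1 < e.
  by have [k _ hk] := near_infty_natSinv_lt (PosNum e0); exists k; apply: (hk k) => /=.
have [cov close] := hnet k; have [j nj] := cov s.
have [Sr nr] := hrep (k, j) s Ss nj.
by have := close j s _ t nj nr; rewrite h// subr0 => /le_trans; apply.
Qed.

End KernelNets.

(** * The conditions and the invariance of the kernel *)

Section Equivalences.
Context {R : realType} {G : topGroupType}.
Hypotheses (hausdorffG : hausdorff_space G) (lcG : locally_compact [set: G]).
Hypothesis scG : @second_countable G.
Variable mu : {sigma_finite_measure set (borel G) -> \bar R}.
Hypothesis haar_mu : left_haar mu.
Local Notation mu2 := (mu \x mu)%E.
Local Notation mu3 := ((mu \x mu) \x mu)%E.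
Local Notation G2 := (borel G * borel G)%type.
Local Notation G3 := (borel G * borel G * borel G)%type.
Variables (chi : G2 -> R[i]) (a b a' b' : nat -> borel G -> R[i]) (C D : R).
Hypothesis chi_ab : wstar_representation mu chi a b.
Hypotheses (ha : l2_le a' C) (hb : l2_le b' D).
Hypotheses (aa' : \forall s \ae mu, forall i, a i s = a' i s).
Hypotheses (bb' : \forall s \ae mu, forall i, b i s = b' i s).

Let aoo i : Linf mu (a i).
Proof. by case: chi_ab => _ [h _] _ _ _; exact: h. Qed.

Let boo i : Linf mu (b i).
Proof. by case: chi_ab => _ [_ h] _ _ _; exact: h. Qed.

Let X : G2 -> R[i] := kernel a' b'.
Let H : G3 -> R[i] := translated_kernel a' b'.
Let TGchi := Tmap mu (haagerup_map (R := R) Gamma Gamma_op (haagerup_sum a b)).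

Let mX : cmeasurable X.
Proof. exact: cmeasurable_kernel ha hb. Qed.

Let mH : cmeasurable H.
Proof. exact (cmeasurable_translated_kernel scG ha hb). Qed.

Let TGchi_Linf : Linf mu3 TGchi.
Proof. by have [] := Tmap_Linf_ae scG haar_mu aoo boo ha hb aa' bb'. Qed.

Let TGchi_ae : \forall x \ae mu3, TGchi x = H x.
Proof.
have [_ h] := Tmap_Linf_ae scG haar_mu aoo boo ha hb aa' bb'.
by apply: ae_mono h => x; exact.
Qed.

Lemma chi_kernel : \forall z \ae mu2, chi z = X z.
Proof.
have [_ _ _ _ h] := chi_ab.
have hab : \forall z \ae mu2, (forall i, a i z.1 = a' i z.1) /\ (forall i, b i z.2 = b' i z.2).
  have h1 := ae_fst mu aa'; have h2 := ae_snd mu bb'.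
  exact (ae_and h1 h2).
apply: (ae_mono2 _ h hab) => -[s t] /= cv [as_ bt]; apply: ccvg_unique cv _.
have := kernel_cvg ha hb s t; congr (ccvg _ _); apply/funext => n.
by apply: eq_bigr => i _; rewrite as_ bt.
Qed.

Definition invariant_kernel := forall q : G,
  \forall z \ae mu2, X ((z.1 * q)%g, (z.2 * q)%g) = X z.

Lemma ae_diag_mulgr (q : G) (P : G2 -> Prop) : (\forall z \ae mu2, P z) ->
  \forall z \ae mu2, P ((z.1 * q)%g, (z.2 * q)%g).
Proof.
have [kappa _ hk] := modular_ex scG haar_mu q hausdorffG lcG.
by move=> /(ae_scales (scales_snd mu hk)) /(ae_scales (scales_fst mu hk)).
Qed.

Lemma invariant_kernelP : invariant_kernel <-> Vinf_inv mu chi.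
Proof.
split=> [inv|[_ inv] q].
  split; first by exists a, b.
  move=> q; have h := ae_and chi_kernel (ae_diag_mulgr q chi_kernel).
  by apply: (ae_mono2 _ h (inv q)) => z [-> ->] ->.
have h := ae_and chi_kernel (ae_diag_mulgr q chi_kernel).
by apply: (ae_mono2 _ h (inv q)) => z [h1 h2] /(_ I); rewrite h1 h2.
Qed.

Let measurable_outer : measurable_fun setT (fun x : G3 => (x.1.1, x.2) : G2).
Proof.
apply/measurable_fun_pairP; split; last exact: measurable_snd.
exact: (measurableT_comp measurable_fst measurable_fst).
Qed.

Let chi_middle : \forall x \ae mu3, chi (x.1.1, x.2) = X (x.1.1, x.2).
Proof.
have [Q [mQ aeQ QP]] := ae_hull chi_kernel.
apply: (ae_mono (P := fun x : G3 => Q (x.1.1, x.2))); first by move=> x; exact: QP.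
apply: (ae_prod_middle mu _).2; first exact: (measurable_preimage_fun measurable_outer mQ).
by apply: aeW => t; apply: ae_mono aeQ => -[].
Qed.

Lemma invariant_flip : invariant_kernel -> TGchi = id_flip (tensor_one chi) %[ae mu3].
Proof.
move=> inv.
have h1 : \forall x \ae mu3, H x = X (x.1.1, x.2).
  apply: (ae_prod_middle mu _).2; last by apply: aeW => t; apply: ae_mono (inv t) => -[].
  by apply: measurable_ceq => //; exact (cmeasurable_comp (p := fun x : G3 => (x.1.1, x.2)) mX measurable_outer).
have h := ae_and h1 chi_middle.
by apply: (ae_mono2 _ TGchi_ae h) => x -> [-> <-].
Qed.

(** The partial sums with entries a'_i, 1, b'_i converge boundedly at every point, so by dominated
    convergence they converge in pairing with each of the finitely many given functions. *)
Lemma flip_Linf : TGchi = id_flip (tensor_one chi) %[ae mu3] -> Linf_1_Linf mu TGchi.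
Proof.
move=> TGE; split; first exact: TGchi_Linf.
move=> e n f e0 f1.
pose g N : G3 -> R[i] := \sum_(i < N) tensor3 (a' i) (fun=> 1) (b' i).
have gE N x : g N x = \sum_(i < N) a' i x.1.1 * b' i x.2.
  by rewrite /g sumr_fctE; apply: eq_bigr => i _; rewrite /tensor3 mulr1.
have mY : cmeasurable (fun x : G3 => X (x.1.1, x.2)) by exact (cmeasurable_comp (p := fun x : G3 => (x.1.1, x.2)) mX measurable_outer).
have TGY : \forall x \ae mu3, TGchi x = X (x.1.1, x.2).
  by apply: (ae_mono2 _ TGE chi_middle) => x /(_ I) -> <-.
have mg N : cmeasurable (g N).
  rewrite (_ : g N = fun x => \sum_(i < N) a' i x.1.1 * b' i x.2); last exact/funext/gE.
  apply: cmeasurable_sum => i _; apply: cmeasurableM.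
  - apply: (cmeasurable_comp (p := fun x : G3 => x.1.1)); first by case: ha.
    exact: (measurableT_comp measurable_fst measurable_fst).
  - apply: (cmeasurable_comp (p := fun x : G3 => x.2)); first by case: hb.
    exact: measurable_snd.
have cv k : ccvg (fun N => dual_pairing mu3 (g N) (f k)) (dual_pairing mu3 TGchi (f k)).
  have mf : cmeasurable (f k) by case: (f1 k).
  rewrite (ae_eq_dual_pairing _ mY mf TGY); last by case: TGchi_Linf.
  apply: (@cdominated_convergence _ _ _ _ _ _
    (fun x => Num.sqrt C * Num.sqrt D * normc (f k x))).
  - by move=> N; exact: cmeasurableM.
  - exact: cmeasurableM.
  - apply: aeW => x; apply: ccvgM; last exact: ccvg_cst.
    by under eq_fun do rewrite gE; exact: kernel_cvg ha hb _ _.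
  - by apply: integrableZ_EFin; exact: L1_normc.
  - move=> N x; rewrite Normc.normcM ler_wpM2r ?normc_ge0// gE.
    exact: kernel_partial_le ha hb _ _ _.
have [N _ hN] : \forall N \near \oo, forall k,
    normc (dual_pairing mu3 (g N) (f k) - dual_pairing mu3 TGchi (f k)) < e.
  apply: filter_forall => k; have /cvgrPdist_lt/(_ e e0) := cv k.
  by apply: filterS => N; rewrite sub0r normrN ger0_norm// normc_ge0.
exists (g N); last by move=> k; rewrite normcB; apply: hN => /=.
exists N, (fun i => a' i), (fun i => b' i); split => //.
- by move=> i; exact: l2_le_Linf ha.
- by move=> i; exact: l2_le_Linf hb.
Qed.

Let HE s t r : H (s, t, r) = X ((s * t)%g, (r * t)%g).
Proof. by []. Qed.

(** The approximants do not depend on the middle variable, so composing the test function with [tau]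
    multiplies their pairings by [kappa], and in the limit those of [H]. The same factor appears
    when [H] and the test function are both composed with [tau]. Every test function is a composite
    with [tau], so [H] and [H \o tau] agree almost everywhere. *)
Lemma Linf_invariant : Linf_1_Linf mu TGchi -> invariant_kernel.
Proof.
move=> [_ hcl] q.
have [kappa k0 hk] := modular_ex scG haar_mu q hausdorffG lcG.
pose tau (x : G3) : G3 := (x.1.1, (x.1.2 * q)%g, x.2).
have htau : scales_measure mu3 mu3 tau kappa.
  exact (scales_fst (m1 := product_sf mu mu) mu (scales_snd mu hk)).
have HL : Linf mu3 H by exact (translated_kernel_Linf scG mu ha hb).
have [mtau _ _] := htau.
have H1 f : L1 mu3 f -> dual_pairing mu3 TGchi (f \o tau) = kappa%:C * dual_pairing mu3 TGchi f.
  move=> f1; have ft1 := L1_scales htau f1.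
  apply: scaled_approx_eq => e e0.
  (* Both test functions are given to the closure together, so that one approximant serves them
     both. *)
  pose fs (i : 'I_2) := if i == 0 then f \o tau else f.
  have fs1 i : L1 mu3 (fs i) by rewrite /fs; case: ifP.
  have [h [n [c [d [cL dL hE]]]] hh] := hcl e 2 fs e0 fs1.
  have hL : Linf mu3 h.
    rewrite hE; apply: Linf_sum => i.
    have -> : tensor3 (c i) (fun=> 1) (d i) = fun x : G3 => c i x.1.1 * d i x.2.
      by apply/funext => x; rewrite /tensor3 mulr1.
    apply: LinfM; last exact: (Linf_snd (product_sf mu mu) (dL i)).
    exact: (Linf_fst (m1 := product_sf mu mu) mu (Linf_fst mu (cL i))).
  have htE x : h (tau x) = h x by rewrite hE !sumr_fctE.
  have h2 : dual_pairing mu3 h (f \o tau) = kappa%:C * dual_pairing mu3 h f.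
    rewrite /dual_pairing -(cintegral_scales htau (L1_Linf_mul hL f1)).
    by apply: eq_cintegral => x; rewrite htE.
  exists (dual_pairing mu3 h f); first by rewrite -h2; exact: (hh 0).
  by rewrite normcB; exact: (hh 1).
have H2 f : L1 mu3 f -> dual_pairing mu3 H (f \o tau) = kappa%:C * dual_pairing mu3 H f.
  move=> f1; have ft1 := L1_scales htau f1.
  have mT : cmeasurable TGchi by case: TGchi_Linf.
  rewrite -(ae_eq_dual_pairing mT mH ft1.1 TGchi_ae) -(ae_eq_dual_pairing mT mH f1.1 TGchi_ae).
  exact: H1.
have HtL : Linf mu3 (H \o tau).
  apply: (@bounded_Linf _ _ _ _ _ (Num.sqrt C * Num.sqrt D)).
    exact (cmeasurable_comp mH mtau).
  by move=> x; exact: (kernel_le ha hb).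
have H3 f : L1 mu3 f -> dual_pairing mu3 (H \o tau) (f \o tau) = kappa%:C * dual_pairing mu3 H f.
  by move=> f1; rewrite /dual_pairing -(cintegral_scales htau (L1_Linf_mul HL f1)).
have [kappa' _ hk'] := modular_ex scG haar_mu q^-1%g hausdorffG lcG.
pose tau' (x : G3) : G3 := (x.1.1, (x.1.2 * q^-1)%g, x.2).
have htau' : scales_measure mu3 mu3 tau' kappa'.
  exact (scales_fst (m1 := product_sf mu mu) mu (scales_snd mu hk')).
have DL : Linf mu3 (fun x => H x - (H \o tau) x).
  have := LinfD HL (LinfZ (-1) HtL).
  by congr (Linf _ _); apply/funext => x; rewrite mulN1r.
have : \forall x \ae mu3, H x - (H \o tau) x = 0.
  apply: (Linf_eq0_3 DL) => g g1.
  have g1' := L1_scales htau' g1.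
  have gE : g = (g \o tau') \o tau.
    by apply/funext => -[[s t] r]; rewrite /tau /tau'/= mulgK.
  have E1 := H2 _ g1'; have E2 := H3 _ g1'; rewrite -gE in E1 E2.
  by rewrite (dual_pairingB HL HtL g1) E1 E2 subrr.
have mHt : cmeasurable (H \o tau) by case: HtL.
move=> D0; have : \forall x \ae mu3, H x = (H \o tau) x.
  by apply: ae_mono D0 => x /subr0_eq.
move=> /(ae_prod_middle mu (measurable_ceq mH mHt)) /(ae_ex haar_mu) [t0 ht0].
(* At one fixed middle value [t0] the equality concerns X(s t0, r t0); translating both variables by
   its inverse removes [t0]. *)
have := ae_diag_mulgr t0^-1%g ht0; apply: ae_mono => -[s r].
by rewrite /tau/= !HE !mulgA !mulgVK => ->.
Qed.

Lemma Phi_lambda r f : L2 mu f -> \forall s \ae mu,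
  Phi mu a b (lambda r) f s = X (s, (r^-1 * s)%g) * f (r^-1 * s)%g.
Proof.
move=> f2; have [e be] := nat2_bij.
have bl := lambda_bounded scG haar_mu r.
have h1 := Phi_ae aoo boo ha hb be aa' bb' bl f2.
have [_ _ [K K0 AK]] := bl.
have h2 := ae_finite_part hb bl AK f2.
apply: (ae_mono2 _ h1 h2) => s /(_ I) -> fs; rewrite /schur_operator.
rewrite mulrC -csumZ; last exact: kernel_csummable ha hb _ _.
by congr csum; apply/funext => i; rewrite cutE// /lambda /mulop; ring.
Qed.

Lemma VN_lambda r : VN mu (lambda (R := R) r).
Proof. by move=> M _; apply; exists r. Qed.

Lemma L2_indic (A : set (borel G)) : measurable A -> (mu A < +oo)%E ->
  L2 mu (fun x => (\1_A x : R)%:C).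
Proof.
move=> mA Aoo; split; first by case: (L1_indic mA Aoo).
rewrite /sqnorm (eq_integral (fun x => (\1_A x : R)%:E)); first by rewrite -measure_integral_indic.
by move=> x _; rewrite normc_indic indicE; case: (_ \in _); rewrite ?expr1n ?expr0n.
Qed.

Lemma VN_invariant : [set Phi mu a b A | A in VN mu] `<=` VN mu -> invariant_kernel.
Proof.
move=> hVN q.
have [F TF FP] : sigma_finite setT mu := sigma_finiteT mu.
(* At each point some [f n] has value 1, which reads off the multiplier there. *)
pose f n : borel G -> R[i] := fun x => (\1_(F n) x : R)%:C.
have f2 n : L2 mu (f n) by have [? ?] := FP n; exact: L2_indic.
pose P (z : G2) := X ((z.2 * q)%g, (z.1^-1 * z.2 * q)%g) = X (z.2, (z.1^-1 * z.2)%g).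
have P1 x : \forall s \ae mu, P (x, s).
  have TV : VN mu (Phi mu a b (lambda x)) by apply: hVN; exists (lambda x) => //; exact: VN_lambda.
  have h : \forall s \ae mu, forall n, X (s, (x^-1 * s)%g) * f n (x^-1 * s * q)%g =
      X ((s * q)%g, (x^-1 * (s * q))%g) * f n (x^-1 * (s * q))%g.
    apply: ae_foralln => n.
    have h1 := VN_rho scG haar_mu hausdorffG lcG q TV (f2 n).
    have h2 := Phi_lambda x (rho_L2 scG haar_mu hausdorffG lcG q (f2 n)).
    have h3 := ae_mulgr scG haar_mu q (Phi_lambda x (f2 n)).
    apply: (ae_mono2 _ h1 (ae_and h2 h3)) => s e1 [e2 e3].
    by rewrite -[LHS]e2 e1 [LHS]e3.
  apply: ae_mono h => s hs; rewrite /P/=.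
  have [n _ Fn] : (\bigcup_n F n) (x^-1 * s * q)%g by rewrite -TF.
  by have := hs n; rewrite !mulgA /f indicE mem_set// !mulr1.
have mq1 : measurable_fun setT (fun z : G2 => (z.1 * q)%g : borel G).
  exact (measurableT_comp (measurable_mulgr scG q) measurable_fst).
have mq2 : measurable_fun setT (fun z : G2 => (z.2 * q)%g : borel G).
  exact (measurableT_comp (measurable_mulgr scG q) measurable_snd).
have mP : measurable [set z | P z].
  have mi : measurable_fun setT (fun z : G2 => (z.1^-1)%g : borel G).
    exact (measurableT_comp (@measurable_invg G) measurable_fst).
  have m1 : measurable_fun setT (fun z : G2 => (z.1^-1 * z.2)%g : borel G).
    exact (measurable_mulg_fun scG mi measurable_snd).
  have m1q : measurable_fun setT (fun z : G2 => (z.1^-1 * z.2 * q)%g : borel G).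
    exact (measurableT_comp (measurable_mulgr scG q) m1).
  have mp : measurable_fun setT (fun z : G2 => ((z.2 * q)%g, (z.1^-1 * z.2 * q)%g) : G2).
    by apply/measurable_fun_pairP; split.
  have mp' : measurable_fun setT (fun z : G2 => (z.2, (z.1^-1 * z.2)%g) : G2).
    by apply/measurable_fun_pairP; split; [exact: measurable_snd|].
  exact (measurable_ceq (cmeasurable_comp mX mp) (cmeasurable_comp mX mp')).
have : \forall z \ae mu2, P z by apply: (ae_prod1 mu mu mP).2; exact: aeW.
move=> /(ae_prod2 mu mu mP) P2.
have mp : measurable_fun setT (fun z : G2 => ((z.1 * q)%g, (z.2 * q)%g) : G2).
  by apply/measurable_fun_pairP; split.
apply: (ae_prod1 mu mu (measurable_ceq (cmeasurable_comp mX mp) mX)).2.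
apply: ae_mono P2 => s hs.
(* The translating element becomes [s * r^-1], so that its inverse times [s] is [r]. *)
have := ae_invg scG haar_mu (ae_mulgl scG haar_mu s hs).
by apply: ae_mono => r; rewrite /P/= invgM invgK mulgVK.
Qed.

(** The function s |-> X(s, r^-1 s) lives on the graph of a translation. By [has_nets_eq0] the
    invariance under [q] holds on a product of two conull sets, and almost every point of the graph
    lies in it because left translations preserve null sets. So for every [q] the function is
    invariant almost everywhere, and Fubini's theorem, at a single [s0], makes it constant. *)
Lemma invariant_diagonal : invariant_kernel -> forall r, exists c,
  \forall s \ae mu, X (s, (r^-1 * s)%g) = c.
Proof.
move=> inv r.
pose P (z : G2) := X ((z.2 * z.1)%g, (r^-1 * (z.2 * z.1))%g) = X (z.2, (r^-1 * z.2)%g).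
have P1 q : \forall s \ae mu, P (q, s).
  have K0 : \forall z \ae mu2, X ((z.1 * q)%g, (z.2 * q)%g) - X z = 0.
    by apply: ae_mono (inv q) => z ->; rewrite subrr.
  have hX := kernel_nets ha hb.
  pose p (x : borel G) : borel G := (x * q)%g.
  have hK := has_netsB (has_nets_comp p p hX) hX.
  have [S [S' [aeS aeS' SS']]] := has_nets_eq0 hK K0.
  apply: (ae_mono2 _ aeS (ae_mulgl scG haar_mu r^-1%g aeS')) => s hs hs'.
  by rewrite /P/= mulgA; apply: subr0_eq; exact: SS' hs hs'.
have mP : measurable [set z | P z].
  have m21 : measurable_fun setT (fun z : G2 => (z.2 * z.1)%g : borel G).
    exact (measurable_mulg_fun scG measurable_snd measurable_fst).
  have mr : measurable_fun setT (fun z : G2 => (r^-1 * (z.2 * z.1))%g : borel G).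
    exact (measurableT_comp (measurable_mulgl scG r^-1%g) m21).
  have mr2 : measurable_fun setT (fun z : G2 => (r^-1 * z.2)%g : borel G).
    exact (measurableT_comp (measurable_mulgl scG r^-1%g) measurable_snd).
  have mp : measurable_fun setT (fun z : G2 => ((z.2 * z.1)%g, (r^-1 * (z.2 * z.1))%g) : G2).
    by apply/measurable_fun_pairP; split.
  have mp' : measurable_fun setT (fun z : G2 => (z.2, (r^-1 * z.2)%g) : G2).
    by apply/measurable_fun_pairP; split; [exact: measurable_snd|].
  exact (measurable_ceq (cmeasurable_comp mX mp) (cmeasurable_comp mX mp')).
have : \forall z \ae mu2, P z by apply: (ae_prod1 mu mu mP).2; exact: aeW.
move=> /(ae_prod2 mu mu mP) /(ae_ex haar_mu) [s0 hs0].
exists (X (s0, (r^-1 * s0)%g)).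
have := ae_mulgl scG haar_mu s0^-1%g hs0; apply: ae_mono => s.
by rewrite /P/= (mulgA s0) mulgV mul1g.
Qed.

Lemma invariant_Phi_lambda : invariant_kernel -> forall r, exists c,
  forall f, L2 mu f -> \forall s \ae mu, Phi mu a b (lambda r) f s = c * lambda r f s.
Proof.
move=> inv r; have [c hc] := invariant_diagonal inv r.
exists c => f f2; apply: (ae_mono2 _ (Phi_lambda r f2) hc) => s -> ->.
by [].
Qed.

Lemma span_sub_algebra (M : set (operator (R := R) (T := borel G))) :
  von_neumann_algebra mu M -> range (@lambda R G) `<=` M ->
  (@translation_span R G) `<=` M.
Proof.
move=> [_ Mid Mlin _ _] lM A; elim=> [|c s B _ MB].
  (* The zero operator is obtained from the identity by linear combination. *)
  rewrite (_ : (fun _ => 0) = fun f : borel G -> R[i] => -1 *: id f + id f).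
    exact: Mlin.
  by apply/funext => f; rewrite scaleN1r addNr.
by apply: Mlin => //; apply: lM; exists s.
Qed.

(** [B'] represents the Schur multiple of [B], described by its normal functionals. In this form
    linearity is that of normal functionals, and the induction never has to compare the choices that
    [Phi] makes for different operators. *)
Lemma invariant_Phi_span (e : nat -> nat * nat) B : set_bij setT setT e ->
  invariant_kernel -> translation_span B ->
  exists2 B', translation_span B' & forall xi eta, square_summable mu xi ->
    square_summable mu eta -> normal_functional mu xi eta B' =
    normal_functional mu (amplify e b' xi) (amplify e (fun i s => (a' i s)^*%C) eta) B.
Proof.
move=> be inv; elim=> [|c r A sA [A' sA' hA']].
  exists (fun _ => 0); first exact: span0.
  move=> xi eta _ _; rewrite /normal_functional.
  by congr csum; apply/funext => k; rewrite [LHS]inner0l [RHS]inner0l.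
have bl := lambda_bounded scG haar_mu r.
have [phi hphi] := invariant_Phi_lambda inv r.
exists (fun f => (c * phi) *: lambda r f + A' f); first exact: span_cons.
move=> xi eta sxi seta.
have sX := square_summable_amplify be hb sxi.
have sY := square_summable_amplify be (l2_le_conj ha) seta.
have bA := span_bounded scG haar_mu sA; have bA' := span_bounded scG haar_mu sA'.
rewrite (normal_functional_lin _ bl bA' sxi seta) (normal_functional_lin _ bl bA sX sY).
rewrite (hA' _ _ sxi seta); congr (_ + _).
have [bP hP] := Phi_spec aoo boo ha hb be aa' bb' bl.
rewrite -(hP _ _ sxi seta) -mulrA; congr (_ * _).
transitivity (csum (fun k => phi * inner_product mu (lambda r (xi k)) (eta k))).
  exact/esym/csumZ/(square_summable_csummable bl sxi seta).
have [xi2 _] := sxi; have [eta2 _] := seta.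
congr csum; apply/funext => k.
have l2 := lambda_L2 scG haar_mu r (xi2 k); have [P2 _ _] := bP.
rewrite -(innerZ phi l2 (eta2 k)); apply/esym; apply: inner_ae_eq.
- by case: (P2 _ (xi2 k)).
- by case: (eta2 k).
- by case: (L2_Z phi l2).
- by case: (eta2 k).
- exact: hphi.
- exact: aeW.
Qed.

(** Weak* continuity: [A] is approximated by [B] in the span on the amplified families, and by
    [Phi_spec] and [invariant_Phi_span] the operator [B'] then approximates the image of [A] on the
    original ones, within the same error. *)
Lemma invariant_VN : invariant_kernel -> [set Phi mu a b A | A in VN mu] `<=` VN mu.
Proof.
move=> inv _ [A VA <-] M vM lM.
have [e be] := nat2_bij; have bA := VN_bounded scG haar_mu VA.
have [bP hP] := Phi_spec aoo boo ha hb be aa' bb' bA.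
have [_ _ _ _ [_ Mcl]] := vM; apply: Mcl; split; first exact: bP.
move=> eps n xi eta eps0 sxi seta.
have sX i := square_summable_amplify be hb (sxi i).
have sY i := square_summable_amplify be (l2_le_conj ha) (seta i).
have [_ /(_ eps n _ _ eps0 sX sY) [B sB AB]] := VN_sub_closure scG haar_mu VA.
have [B' sB' hB'] := invariant_Phi_span be inv sB.
exists B'; first exact: span_sub_algebra vM lM _ sB'.
by move=> i; rewrite (hP _ _ (sxi i) (seta i)) (hB' _ _ (sxi i) (seta i)); exact: AB.
Qed.

End Equivalences.

Theorem theorem5p6 (R : realType) (G : topGroupType)
  (hausdorffG : hausdorff_space G)
  (locally_compactG : locally_compact [set: G])
  (second_countableG : @second_countable G)
  (mu : {sigma_finite_measure set (borel G) -> \bar R})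
  (haar_mu : left_haar mu)
  (chi : borel G * borel G -> R[i]) (a b : nat -> borel G -> R[i])
  (chi_ab : wstar_representation mu chi a b) :
  let TGchi := Tmap mu (haagerup_map Gamma Gamma_op (haagerup_sum a b)) in
  [<-> [set Phi mu a b A | A in VN mu] `<=` VN mu;
       Linf_1_Linf mu TGchi;
       TGchi = id_flip (tensor_one chi) %[ae ((mu \x mu) \x mu)%E];
       Vinf_inv mu chi].
Proof.
move=> TGchi; have [_ [aoo boo] aL bL _] := chi_ab.
have [a' [C [ha aa']]] := l2_truncation aoo aL.
have [b' [D [hb bb']]] := l2_truncation boo bL.
have VN_inv := VN_invariant hausdorffG locally_compactG second_countableG haar_mu
  chi_ab ha hb aa' bb'.
have inv_VN := invariant_VN second_countableG haar_mu chi_ab ha hb aa' bb'.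
have inv_flip := invariant_flip second_countableG haar_mu chi_ab ha hb aa' bb'.
have flip_L := flip_Linf second_countableG haar_mu chi_ab ha hb aa' bb'.
have L_inv := Linf_invariant hausdorffG locally_compactG second_countableG haar_mu
  chi_ab ha hb aa' bb'.
have invP := invariant_kernelP hausdorffG locally_compactG second_countableG haar_mu
  chi_ab ha hb aa' bb'.
(* Each implication of the cycle passes through [invariant_kernel]. *)
tfae.
- by move=> /VN_inv/inv_flip/flip_L.
- by move=> /L_inv/inv_flip.
- by move=> /flip_L/L_inv/invP.
- by move=> /invP/inv_VN.
Qed.
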